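(* Suppose the stability and light-tail assumptions stated in the context hold. Assume in addition that for some constants $K_2>0$ and $0<\alpha\le1$ the following hold for all $k\ge 1$: (a) $\lceil 6\log(k)/\min(\gamma,\eta)\rceil\le D_k\le K_2k^{2-\alpha}$; (b) $\mathbb E[\|x_k-x_{k+1}\|^2]\le K_2k^{-2\alpha}$. Then there exists a constant $K>0$, independent of $k$ and $L$, such that $$R_{1,k}\le K k^{-\alpha}\log(k)\quad\text{for all }k\ge2,\qquad\text{and}\qquad R_1(L)\le K\sum_{k=1}^Lk^{-\alpha}\log(k)\quad\text{for all }L\ge2.$$
   Context: **Model.** Fix $0<\underline\mu<\bar\mu$, $0<\underline p<\bar p$, $\mathcal B=[\underline\mu,\bar\mu]\times[\underline p,\bar p]$, a demand function $\lambda:[\underline p,\bar p]\to(0,\infty)$, a staffing cost function $c$ on $[\underline\mu,\bar\mu]$, and a holding cost $h_0>0$. Let $U_1,U_2,\dots$ and $V_1,V_2,\dots$ be two independent i.i.d. sequences of nonnegative random variables with unit means. The $GI/GI/1$ (FIFO) queue with parameter $(\mu,p)$ has interarrival times $U_n/\lambda(p)$ and service times $V_n/\mu$, with waiting times $W_n=(W_{n-1}+V_n/\mu-U_n/\lambda(p))^+$; $W_\infty(\mu,p)$ is its steady-state waiting time. The objective (loss rate) is $f(\mu,p)=h_0\lambda(p)(\mathbb E[W_\infty(\mu,p)]+\frac1\mu)+c(\mu)-p\lambda(p)$. **Stability assumption.** $\lambda$ is continuously differentiable and non-increasing; $c$ is continuously differentiable and non-decreasing; $\lambda(\underline p)<\underline\mu$.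 **Light-tail assumption.** There is a sufficiently small constant $\eta>0$ with $\mathbb E[e^{\eta V_n}]<\infty$, $\mathbb E[e^{\eta U_n}]<\infty$, and there are constants $0<\theta<\eta/(2\bar\mu)$, $0<a<(\underline\mu-\lambda(\underline p))/(\underline\mu+\lambda(\underline p))$ and $\gamma>0$ with $\phi_U(-\theta)<-(1-a)\theta-\gamma$ and $\phi_V(\theta)<(1+a)\theta-\gamma$, where $\phi_V(\theta)=\log\mathbb E[e^{\theta V_n}]$, $\phi_U(\theta)=\log\mathbb E[e^{\theta U_n}]$. **Dynamics in cycles.** The queue is operated in cycles $k=1,2,\dots$ with policies $x_k=(\mu_k,p_k)\in\mathcal B$ and deterministic integer cycle lengths $D_k\ge1$, starting empty. Cycle $k$ ends when $D_k$ customers have entered service in it. Policies are generated by $x_{k+1}=\Pi_{\mathcal B}(x_k-\eta_kH_k)$ ($\Pi_{\mathcal B}$ = projection onto $\mathcal B$, $\eta_k$ deterministic step sizes, $H_k$ computed from data collected up to the end of cycle $k$), so that $x_k$ is measurable with respect to the $\sigma$-algebra $\mathcal F_k$ of events in the first $k-1$ cycles. Customer $n$ of cycle $k$ ($1\le n\le D_k$) is the $n$th to enter service in cycle $k$; customer $0$ of cycle $k$ is customer $D_{k-1}$ of cycle $k-1$, who enters service at the beginning of cycle $k$. Customer $n-1$ of cycle $k$ has service time $S_n^k=V_n^k/\mu_k$; $U_n^k$ corresponds to the interarrival time between customers $n-1$ and $n$; $(U_n^k),(V_n^k)$ are independent i.i.d. copies of $U,V$. $Q_k$ is the number of customers present at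 the beginning of cycle $k$, including customer $0$ just entering service ($Q_1=0$, $Q_k\ge1$ for $k\ge2$); thus customers $1,\dots,Q_k-1$ are waiting then. The service rate becomes $\mu_k$ at the beginning of cycle $k$; the price becomes $p_k$ only right after the first arrival in cycle $k$ (customer $Q_k$). For $1\le n\le Q_k$ let $p_n^k\in\{p_1,\dots,p_{k-1}\}$ be the price charged to customer $n$ (the price in force during the interarrival time preceding that customer), $\lambda_n^k=\lambda(p_n^k)$; let $\lambda_k=\lambda(p_k)$. The interarrival time is $U_n^k/\lambda_n^k$ for $n\le Q_k$ and $U_n^k/\lambda_k$ for $n>Q_k$. With $\ell_n^k=\lambda_n^k$ if $n\le Q_k$ and $\ell_n^k=\lambda_k$ if $n>Q_k$, waiting times and observed busy periods are, for $1\le n\le D_k$, $$W_n^k=\Big(W_{n-1}^k+\tfrac{V_n^k}{\mu_k}-\tfrac{U_n^k}{\ell_n^k}\Big)^+,\quad X_n^k=\Big(X_{n-1}^k+\tfrac{U_n^k}{\ell_n^k}\Big)\mathbf 1_{\{W_n^k>0\}},\quad W_0^k=W_{D_{k-1}}^{k-1},\ X_0^k=X_{D_{k-1}}^{k-1},$$ with $W_0^1=X_0^1=0$. $T_k$ is the duration of cycle $k$. **Smallness of $\eta$.** ''Sufficiently small'' means that there is a finite $M>0$ such that for any policy sequence in $\mathcal B$ and any $D_k\ge1$, the quantities $\mathbb E[(W_n^k)^m]$, $\mathbb E[(X_n^k)^m]$, $\mathbb E[(Q_k)^m]$, $\mathbb E[e^{\eta W_n^k}]$, $\mathbb E[e^{\eta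 Q_k}]$ are at most $M$ for all $k\ge1$, $1\le n\le D_k$, $1\le m\le4$. **Regret of nonstationarity.** With $$\rho_k=\mathbb E\Big[\sum_{n=1}^{Q_k\wedge D_k}\big(h_0(W_n^k+S_n^k)-p_n^k\big)+\sum_{n=Q_k+1}^{D_k}\big(h_0(W_n^k+S_n^k)-p_k\big)+c(\mu_k)T_k\Big]$$ (the second sum being $0$ if $D_k<Q_k+1$), set $R_{1,k}=\rho_k-\mathbb E[f(\mu_k,p_k)T_k]$ and $R_1(L)=\sum_{k=1}^LR_{1,k}$. *)

(* Defs.v *)
(* MathComp-Analysis. *)
From HB Require Import structures.
From mathcomp Require Import all_boot all_order all_algebra finmap.
From mathcomp Require Import all_classical all_reals all_analysis.

Set Implicit Arguments.
Unset Strict Implicit.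
Unset Printing Implicit Defensive.

Import Order.TTheory GRing.Theory Num.Theory.
Import numFieldNormedType.Exports.

Local Open Scope classical_set_scope.
Local Open Scope ring_scope.

(** * Model data *)

(* [lam] and [cost] are only meant on [[p_lo, p_hi]] and [[mu_lo, mu_hi]]. *)
Record queue_model (R : realType) := QueueModel {
  mu_lo : R; mu_hi : R; p_lo : R; p_hi : R;
  lam : R -> R; cost : R -> R; h0 : R }.

Section model.
Context {R : realType}.
Implicit Types (q : queue_model R) (f g : R -> R) (y z : R * R).

Definition box q : set (R * R) :=
  [set z | [/\ mu_lo q <= z.1, z.1 <= mu_hi q, p_lo q <= z.2 & z.2 <= p_hi q]].

Definition model_ok q :=
  [/\ 0 < mu_lo q < mu_hi q, 0 < p_lo q < p_hi q, 0 < h0 q &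
      {in `[p_lo q, p_hi q], forall p, 0 < lam q p}].

(* One-sided difference quotients are taken at the end points. *)
Definition C1_on f (a b : R) :=
  exists g, {within `[a, b], continuous g} /\
    forall r, a <= r <= b ->
      (fun s => (f s - f r) / (s - r)) @ within `[a, b] r^' --> g r.

Definition stability q :=
  [/\ C1_on (lam q) (p_lo q) (p_hi q),
      {in `[p_lo q, p_hi q] &, {homo lam q : r s /~ r <= s}},
      C1_on (cost q) (mu_lo q) (mu_hi q),
      {in `[mu_lo q, mu_hi q] &, {homo cost q : r s / r <= s}} &
      lam q (p_lo q) < mu_lo q].

(* The norm that the library puts on pairs is the sup norm. *)
Definition enorm z : R := Num.sqrt (z.1 ^+ 2 + z.2 ^+ 2).

Definition is_projection (B : set (R * R)) y z :=
  B z /\ forall b, B b -> enorm (y - z) <= enorm (y - b).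

End model.

(** * Sample paths *)

Record customer (R : realType) :=
  Customer { arrival : R; wait : R; busy : R }.

(* Customers are numbered 0, 1, 2, ... across all cycles: customer n of cycle k
   is customer [offset k + n]. Customer 0 is the virtual customer 0 of cycle 1,
   who arrives and enters service at time 0. [u m] is the (unscaled)
   interarrival time between customers m and m+1, [v m] the (unscaled) service
   time of customer m; so u 0, u 1, ... and v 0, v 1, ... are the U_1, U_2, ...
   and V_1, V_2, ... of the model. Cycles are numbered from 1; [D 0] and [x 0]
   are not used. *)
Section sample_path.
Context {R : realType}.
Variables (l : R -> R) (D : nat -> nat) (x : nat -> R * R) (u v : nat -> R).
Implicit Types (h : nat -> customer R) (k m n : nat).

Definition offset k : nat := \sum_(1 <= j < k) D j.

Definition service_start h m : R := arrival (h m) + wait (h m).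

(* The cycle that customer m sees when entering service; it is opened by
   customer m when m is one of the offsets. *)
Definition service_cycle m : nat :=
  \max_(1 <= k < m.+2 | (offset k <= m)%N) k.

(* The last cycle that started strictly before the arrival of customer m (1 if
   there is none). A price takes effect just after the first arrival in its
   cycle, so this is the cycle whose price is in force from the arrival of
   customer m to that of customer m+1. The cycle opened by a customer j > m
   does not start before customer m arrives, whence the bound on
   [offset k]. *)
Definition price_cycle h m : nat :=
  maxn 1 (\max_(1 <= k < m.+2 |
    (offset k <= m)%N && (service_start h (offset k) < arrival (h m))) k).

Definition next_customer h m : customer R :=
  let t := u m / l (x (price_cycle h m)).2 in
  let w := Num.max 0 (wait (h m) + v m / (x (service_cycle m)).1 - t) in
  Customer (arrival (h m) + t) w (if 0 < w then busy (h m) + t else 0).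

Fixpoint customers_upto m : nat -> customer R :=
  if m is m'.+1 then
    fun j => if (j <= m')%N then customers_upto m' j
             else next_customer (customers_upto m') m'
  else fun=> Customer 0 0 0.

Definition customer_at m : customer R := customers_upto m m.

Definition price m : R := (x (price_cycle customer_at m.-1)).2.

Definition cycle_time k : R := service_start customer_at (offset k).

(* The set is almost surely finite. Customers arriving exactly when the cycle
   starts are counted as present. *)
Definition cycle_queue k : nat :=
  if (k <= 1)%N then 0%N
  else #|` fset_set [set m | (offset k <= m)%N /\
                             arrival (customer_at m) <= cycle_time k]|.

Definition cycle_length k : R := cycle_time k.+1 - cycle_time k.
Definition cycle_wait k n : R := wait (customer_at (offset k + n)).
Definition cycle_busy k n : R := busy (customer_at (offset k + n)).
Definition cycle_service k n : R := v (offset k + n).-1 / (x k).1.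
Definition cycle_price k n : R := price (offset k + n).

End sample_path.

(** * The controlled queue *)

Section queue.
Context {R : realType} {d : measure_display} {Om : measurableType d}.
Variables (P : probability Om R) (U V : nat -> {RV P >-> R}).

Definition sigma_of (S : set (Om -> R)) : set (set Om) :=
  <<s \bigcup_(Z in S) preimage_set_system setT Z measurable >>.

Definition iid (Z : nat -> {RV P >-> R}) :=
  (forall n A, measurable A -> P (Z n @^-1` A) = P (Z 0 @^-1` A)) /\
  (forall (s : seq nat) (A : nat -> set R), uniq s ->
     (forall n, measurable (A n)) ->
     P (\bigcap_(n in [set` s]) Z n @^-1` A n) =
     (\prod_(n <- s) P (Z n @^-1` A n))%E).

Definition independent_sigma (F G : set (set Om)) :=
  forall A B, F A -> G B -> P (A `&` B) = (P A * P B)%E.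

Definition primitives_ok :=
  [/\ iid U, iid V,
      independent_sigma (sigma_of (range (fun n => U n : Om -> R)))
                        (sigma_of (range (fun n => V n : Om -> R))),
      (forall n o, 0 <= U n o /\ 0 <= V n o) &
      (forall n, 'E_P[U n] = 1 /\ 'E_P[V n] = 1)%E].

Definition log_mgf (Z : Om -> R) (t : R) : \bar R := lne ('M_P Z t).

Definition light_tail (q : queue_model R) (eta gamma : R) :=
  [/\ 0 < eta, 0 < gamma,
      (forall n, 'M_P (V n) eta < +oo /\ 'M_P (U n) eta < +oo)%E &
      exists theta a : R,
        [/\ 0 < theta < eta / (2 * mu_hi q),
            0 < a < (mu_lo q - lam q (p_lo q)) / (mu_lo q + lam q (p_lo q)),
            (log_mgf (U 0) (- theta) < (- (1 - a) * theta - gamma)%:E)%E &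
            (log_mgf (V 0) theta < ((1 + a) * theta - gamma)%:E)%E]].

(* The law of the steady-state waiting time: the stationary distribution of
   W_n = (W_(n-1) + V_n / mu - U_n / r)^+. *)
Definition steady_state (mu r : R) (pi : probability R R) :=
  forall A : set R, measurable A ->
    pi A = (\int[pi]_w
      P [set o | A (Num.max 0 (w + V 0 o / mu - U 0 o / r))%R])%E.

Section policy.
Variables (q : queue_model R) (D : nat -> nat) (x : nat -> Om -> R * R).
Implicit Types (k n : nat) (o : Om).

(* Q_k, T_k, W_n^k, X_n^k, p_n^k and S_n^k as random variables. *)
Definition QQ k o : nat := cycle_queue (lam q) D (x ^~ o) (U ^~ o) (V ^~ o) k.
Definition TT k o : R := cycle_length (lam q) D (x ^~ o) (U ^~ o) (V ^~ o) k.
Definition WW k n o : R := cycle_wait (lam q) D (x ^~ o) (U ^~ o) (V ^~ o) k n.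
Definition XX k n o : R := cycle_busy (lam q) D (x ^~ o) (U ^~ o) (V ^~ o) k n.
Definition pp k n o : R := cycle_price (lam q) D (x ^~ o) (U ^~ o) (V ^~ o) k n.
Definition SS k n o : R := cycle_service D (x ^~ o) (V ^~ o) k n.

(* The events of the first k-1 cycles: the variables of the customers who
   entered service in them, and the arrivals before cycle k starts of the
   customers who are then waiting. *)
Definition history k : set (set Om) :=
  sigma_of [set Z : Om -> R |
    [\/ exists2 m, (m < offset D k)%N & Z = U m \/ Z = V m,
        Z = (fun o => (QQ k o)%:R) |
        exists n, Z = (fun o => U (offset D k + n) o * (n.+1 < QQ k o)%:R)]].

Definition history_measurable k (Y : Om -> R * R) :=
  forall A : set (R * R), measurable A -> history k (Y @^-1` A).

Definition policy_ok :=
  forall k, (1 <= k)%N ->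
    [/\ (1 <= D k)%N, (forall o, box q (x k o)) & history_measurable k (x k)].

(* x_(k+1) is the projection of x_k - step_k H_k onto the box. *)
Definition projected_updates :=
  exists (step : nat -> R) (H : nat -> Om -> R * R),
    forall k, (1 <= k)%N ->
      history_measurable k.+1 (H k) /\
      forall o, is_projection (box q)
        (x k o - (step k * (H k o).1, step k * (H k o).2)) (x k.+1 o).

Section regret.
Variable Winf : R -> R -> probability R R.

Definition loss_rate (z : R * R) : R :=
  h0 q * lam q z.2 * (\int[Winf z.1 z.2]_w w + 1 / z.1)
  + cost q z.1 - z.2 * lam q z.2.

Definition cycle_cost k o : R :=
  \sum_(1 <= n < (minn (QQ k o) (D k)).+1)
     (h0 q * (WW k n o + SS k n o) - pp k n o)
  + \sum_((QQ k o).+1 <= n < (D k).+1)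
     (h0 q * (WW k n o + SS k n o) - (x k o).2)
  + cost q (x k o).1 * TT k o.

Definition regret_ns k : \bar R :=
  ('E_P[cycle_cost k] - 'E_P[fun o => (loss_rate (x k o) * TT k o)%R])%E.

End regret.
End policy.

Definition small_enough (q : queue_model R) (eta : R) :=
  exists2 M : R, 0 < M & forall (D : nat -> nat) (x : nat -> Om -> R * R),
    policy_ok q D x ->
    forall k n m, (1 <= k)%N -> (1 <= n <= D k)%N -> (1 <= m <= 4)%N ->
    [/\ ('E_P[fun o => ((WW q D x k n o) ^+ m)%R] <= M%:E)%E,
        ('E_P[fun o => ((XX q D x k n o) ^+ m)%R] <= M%:E)%E,
        ('E_P[fun o => ((QQ q D x k o)%:R ^+ m)%R] <= M%:E)%E,
        ('E_P[fun o => (expR (eta * WW q D x k n o))%R] <= M%:E)%E &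
        ('E_P[fun o => (expR (eta * (QQ q D x k o)%:R))%R] <= M%:E)%E].

End queue.

(* Main.v *)
(* Let w(x) be the mean stationary waiting time under the policy x. The light
   tail assumption makes the exponential moment of the increments of the
   Lindley recursion at most e^-gamma, so that the recursion contracts
   exponentially fast; this gives both the Lipschitz continuity of w and, by
   splitting the first n customers of a cycle in two halves, an error
   exponentially small in n between the waiting time of customer n and w(x_k)
   (the first half is used to wait until the customers left over from earlier
   cycles are gone, since x_k is not independent of their interarrival times).
   The cost of cycle k minus f(x_k) T_k is, pointwise, a sum over its customers
   of W_n - w(x_k), of centered multiples of V_n - 1 and U_n - 1, and of terms
   carried by the customers n <= Q_k, plus an end term. The terms in U_n, the
   leftover terms and the end term are of the order of |x_k - x_(k-1)| times a
   random variable with moments, hence O(k^-alpha). For the waiting times, the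
   customers n > C log k are in steady state up to O(k^-alpha), and each of the
   others is compared with its waiting time under the policy that merges cycle
   k into cycle k-1, which is off by O(k^-alpha) as well. All products are
   estimated by AM-GM with weights k^alpha and k^-alpha. *)
From HB Require Import structures.
Require Import Defs.
From mathcomp Require Import all_boot all_order all_algebra finmap.
From mathcomp Require Import all_classical all_reals all_analysis measurable_realfun.
From mathcomp Require Import zify ring lra.
Import Order.TTheory GRing.Theory Num.Theory.
Import numFieldNormedType.Exports.
Local Open Scope classical_set_scope.
Local Open Scope ring_scope.

Set Implicit Arguments.
Unset Strict Implicit.
Unset Printing Implicit Defensive.

(** * Sample paths *)

(** The obstacle is that [x k] is not a function of primitives with bounded index: the history
    contains the number in queue and the interarrival times of customers still waiting, so it
    reaches a random distance into the sequence [U]. Everything is therefore cut to events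
    [early k a], on which the history uses only interarrival times of index below the deterministic
    [a]. The cut variables belong to a sigma-algebra [info S1 S2] with fixed index sets, and a
    primitive outside these sets is integrated out by Tonelli. Off these events the queue is long,
    and its exponential moment pays. Distances between waiting times are measured by |exp(t y) -
    exp(t y')| with t = theta times the arrival rate: this scaling puts the exponent of U at -theta
    for every price, exactly where the light-tail assumption bounds it. The moment and decay
    constants are uniform over admissible policies, so they also serve the merged policy. The decay
    rate [kap] is min(gamma, eta)/4; hence the 6 in the lower bound on D_k makes exp(-kap D_k) at
    most k^(-3/2), below k^-alpha. *)

Section offsets.
Variables (D : nat -> nat).
Hypothesis D1 : forall k, (1 <= k)%N -> (1 <= D k)%N.

Lemma offset1 : offset D 1 = 0%N.
Proof. by rewrite /offset big_geq. Qed.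

Lemma offset0 : offset D 0 = 0%N.
Proof. by rewrite /offset big_geq. Qed.

Lemma offsetS k : (1 <= k)%N -> offset D k.+1 = (offset D k + D k)%N.
Proof. by move=> k1; rewrite /offset big_nat_recr. Qed.

Lemma offset_mono j k : (j <= k)%N -> (offset D j <= offset D k)%N.
Proof.
move=> jk; rewrite /offset; case: (leqP 1 j) => [j1|]; last first.
  by case: j jk => // jk _; rewrite big_geq.
by rewrite [X in (_ <= X)%N](big_cat_nat j1 jk) leq_addr.
Qed.

(** Every cycle has at least one customer. This makes the bound [m.+2] in [service_cycle] and
    [price_cycle] large enough: [offset D k <= m] forces [k <= m.+1]. *)
Lemma offset_ge k : (k <= (offset D k).+1)%N.
Proof.
elim: k => // k IH; case: k IH => // k IH.
by rewrite offsetS// ltnS (leq_trans IH)// -addn1 leq_add2l D1.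
Qed.

Lemma offset_le_lt j k m : (1 <= k)%N -> (offset D j <= m)%N ->
  (m < offset D k)%N -> (j < k)%N.
Proof.
move=> k1 jm mk; rewrite ltnNge; apply/negP => /offset_mono kj.
by move: (leq_trans kj jm); rewrite leqNgt mk.
Qed.

Lemma max_cycle (P : pred nat) k m : (1 <= k)%N -> (offset D k <= m)%N -> P k ->
  (forall j, (k < j)%N -> (offset D j <= m)%N -> ~~ P j) ->
  (\max_(1 <= j < m.+2 | (offset D j <= m)%N && P j) j)%N = k.
Proof.
move=> k1 km Pk hP; apply/eqP; rewrite eqn_leq; apply/andP; split.
  apply/bigmax_leqP_seq => j _ /andP[jm Pj].
  by rewrite leqNgt; apply/negP => kj; move: (hP _ kj jm); rewrite Pj.
apply: (@leq_bigmax_seq _ _ _ (fun j => j) k); last by rewrite km.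
by rewrite mem_index_iota k1 ltnS (leq_trans (offset_ge _)).
Qed.

Lemma service_cycleE k m : (1 <= k)%N -> (offset D k <= m < offset D k.+1)%N ->
  service_cycle D m = k.
Proof.
move=> k1 /andP[km mk]; rewrite -[RHS](@max_cycle predT k m)//.
  by apply: eq_bigl => j; rewrite andbT.
by move=> j kj jm; have := offset_le_lt (ltn0Sn _) jm mk; rewrite ltnS leqNgt kj.
Qed.

Lemma service_cycle_ge1 m : (1 <= service_cycle D m)%N.
Proof.
by rewrite /service_cycle; apply: (@leq_bigmax_seq _ _ _ (fun j => j) 1%N); rewrite ?offset1// mem_index_iota.
Qed.

Lemma service_cycle_offset m : (offset D (service_cycle D m) <= m)%N.
Proof.
rewrite /service_cycle; apply: (big_ind (fun k => offset D k <= m)%N) => //.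
- by rewrite offset0.
- by move=> a b am bm; rewrite /maxn; case: ifP.
Qed.

Lemma service_cycle_lt m k : (1 <= k)%N -> (m < offset D k)%N ->
  (service_cycle D m < k)%N.
Proof. by move=> k1 mk; apply: offset_le_lt mk => //; exact: service_cycle_offset. Qed.

End offsets.

(** * Arrivals, waiting times and queue lengths along one path *)

Section paths.
Context {R : realType}.
Variables (l : R -> R) (D : nat -> nat) (x : nat -> R * R) (u v : nat -> R).
Hypothesis D1 : forall k, (1 <= k)%N -> (1 <= D k)%N.
Local Notation cust := (customer_at l D x u v).
Local Notation A m := (arrival (cust m)).
Local Notation W m := (wait (cust m)).
Local Notation Xb m := (busy (cust m)).
Local Notation B m := (service_start cust m).
Local Notation o := (offset D).

Lemma customers_uptoE m j : (j <= m)%N -> customers_upto l D x u v m j = cust j.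
Proof.
elim: m => [|m IH]; first by rewrite leqn0 => /eqP->.
rewrite leq_eqVlt => /predU1P[->//|]; rewrite ltnS => jm.
by rewrite /= jm IH.
Qed.

Lemma price_cycle_ext (h h' : nat -> customer R) m :
  (forall j, (j <= m)%N -> h j = h' j) -> price_cycle D h m = price_cycle D h' m.
Proof.
move=> hh; rewrite /price_cycle; congr maxn; apply: eq_bigl => k.
case: leqP => //= km; rewrite /service_start !hh//.
Qed.

Lemma customer_atS m : cust m.+1 = next_customer l D x u v cust m.
Proof.
rewrite [LHS]/customer_at /= ltnn /next_customer customers_uptoE//.
rewrite (@price_cycle_ext _ cust)// => j; exact: customers_uptoE.
Qed.

Definition gap m := u m / l (x (price_cycle D cust m)).2.
Definition svc m := v m / (x (service_cycle D m)).1.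

Lemma A0 : A 0 = 0. Proof. by []. Qed.
Lemma W0 : W 0 = 0. Proof. by []. Qed.
Lemma X0 : Xb 0 = 0. Proof. by []. Qed.
Lemma AS m : A m.+1 = A m + gap m. Proof. by rewrite customer_atS. Qed.
Lemma WS m : W m.+1 = Num.max 0 (W m + svc m - gap m).
Proof. by rewrite customer_atS. Qed.
Lemma XS m : Xb m.+1 = if 0 < W m.+1 then Xb m + gap m else 0.
Proof. by rewrite customer_atS. Qed.
Lemma W_ge0 m : 0 <= W m.
Proof. by case: m => [|m]; rewrite ?WS ?le_max lexx. Qed.

Lemma price_cycle_ge1 (h : nat -> customer R) m : (1 <= price_cycle D h m)%N.
Proof. by rewrite /price_cycle leq_maxl. Qed.

Hypothesis lx0 : forall k, (1 <= k)%N -> 0 < l (x k).2.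
Hypothesis mx0 : forall k, (1 <= k)%N -> 0 < (x k).1.
Hypothesis u0 : forall m, 0 <= u m.
Hypothesis v0 : forall m, 0 <= v m.

Lemma gap_ge0 m : 0 <= gap m.
Proof. by rewrite divr_ge0// ltW// lx0// price_cycle_ge1. Qed.
Lemma svc_ge0 m : 0 <= svc m.
Proof. by rewrite divr_ge0// ltW// mx0// service_cycle_ge1. Qed.

Lemma X_ge0 m : 0 <= Xb m.
Proof.
elim: m => [|m IH]; first by rewrite X0.
by rewrite XS; case: ifP => // _; rewrite addr_ge0// gap_ge0.
Qed.

Lemma A_mono i j : (i <= j)%N -> A i <= A j.
Proof.
move=> /subnK <-; elim: (j - i)%N => [|n IH]; first by rewrite add0n.
by rewrite addSn AS (le_trans IH)// lerDl gap_ge0.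
Qed.

Lemma A_ge0 m : 0 <= A m. Proof. by rewrite -A0 A_mono. Qed.

Lemma B_mono i j : (i <= j)%N -> B i <= B j.
Proof.
move=> /subnK <-; elim: (j - i)%N => [|n IH]; first by rewrite add0n.
rewrite addSn (le_trans IH)// /service_start AS WS.
apply: (@le_trans _ _ (A (n+i)%N + gap (n+i) + (W (n+i)%N + svc (n+i) - gap (n+i)))); last by rewrite lerD2l le_max lexx orbT.
by have := svc_ge0 (n + i); lra.
Qed.

Lemma A_le_B m : A m <= B m. Proof. by rewrite lerDl W_ge0. Qed.

Definition divergent (u : nat -> R) := forall K, exists n, K < \sum_(0 <= j < n) u j.

Lemma max_price_cycle k m : (1 <= k)%N -> (o k <= m)%N ->
  B (o k) < A m -> (forall j, (k < j)%N -> (o j <= m)%N -> A m <= B (o j)) ->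
  price_cycle D cust m = k.
Proof.
move=> k1 km Bk hk; rewrite /price_cycle.
rewrite (@max_cycle _ D1 (fun j => service_start cust (offset D j) < arrival (cust m)) k)//.
  by apply/maxn_idPr.
by move=> j kj jm; rewrite -leNgt hk.
Qed.

Lemma price_cycle_lt k m : (2 <= k)%N -> A m <= B (o k) ->
  (price_cycle D cust m < k)%N.
Proof.
move=> k2 AB; rewrite /price_cycle gtn_max k2 /=.
case: k k2 AB => // k k2 AB; rewrite ltnS.
apply/bigmax_leqP_seq => j _ /andP[jm Pj].
rewrite leqNgt; apply/negP => kj.
by move: Pj; rewrite ltNge (le_trans AB)// B_mono// offset_mono.
Qed.

Lemma price_cycle_eq k m : (1 <= k)%N -> (o k <= m < o k.+1)%N ->
  B (o k) < A m -> price_cycle D cust m = k.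
Proof.
move=> k1 /andP[km mk] Bk; apply: max_price_cycle => // j kj jm.
have := offset_le_lt (ltn0Sn _) jm mk; rewrite ltnS leqNgt kj//.
Qed.

Lemma price_cycle1 m : (m < o 2)%N -> price_cycle D cust m = 1%N.
Proof.
move=> m2; apply/eqP; rewrite eqn_leq price_cycle_ge1 andbT /price_cycle geq_max leqnn /=.
apply/bigmax_leqP_seq => j _ /andP[jm _].
by rewrite -ltnS; apply: offset_le_lt m2.
Qed.

(** Arrival times are nondecreasing, so the customers present form an initial segment of those
    numbered from [o k] on. As some arrival is later than the start of the cycle, the segment is
    finite, and its length is the least [p] whose arrival is later. *)
Lemma cycle_queue_finite k m : (2 <= k)%N -> B (o k) < A m ->
  forall i, (i < cycle_queue l D x u v k)%N = (A (o k + i) <= B (o k)).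
Proof.
move=> k2 Bm.
have hex : exists i, B (o k) < A (o k + i).
  by exists m; apply: (lt_le_trans Bm); rewrite A_mono// leq_addl.
pose p := ex_minn hex.
have [Bp pmin] : B (o k) < A (o k + p) /\
    forall i, B (o k) < A (o k + i) -> (p <= i)%N by rewrite /p; case: ex_minnP.
have pP i : (i < p)%N = (A (o k + i) <= B (o k)).
  apply/idP/idP => [ip|Ai].
    by rewrite leNgt; apply/negP => /pmin; rewrite leqNgt ip.
  rewrite ltnNge; apply/negP => pi.
  by move: (lt_le_trans Bp (A_mono (leq_add (leqnn (o k)) pi))); rewrite ltNge Ai.
have -> : cycle_queue l D x u v k = p.
  rewrite /cycle_queue leqNgt k2 /=.
  rewrite [X in fset_set X](_ : _ = [set` [fset m in iota (o k) p]%fset]).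
    by rewrite set_fsetK card_fseq undup_id ?iota_uniq// size_iota.
  apply/seteqP; split => j /=; rewrite !inE mem_iota.
    move=> [kj Aj]; rewrite kj/= -(subnKC kj) ltn_add2l pP subnKC//.
  move=> /andP[kj jp]; split=> //.
  have := pP (j - o k)%N; rewrite subnKC// => <-.
  by rewrite -(ltn_add2l (o k)) subnKC.
exact: pP.
Qed.

(** [fset_set] sends an infinite set to the empty one, so 0 is the default count when arrivals never
    pass the start of the cycle. *)
Lemma cycle_queue_infinite k : (2 <= k)%N -> (forall m, A m <= B (o k)) ->
  cycle_queue l D x u v k = 0%N.
Proof.
move=> k2 AB; rewrite /cycle_queue leqNgt k2 /= /fset_set.
case: pselect => // fin; exfalso; apply: infinite_nat.
have : finite_set ((fun j => j + o k)%N @^-1` [set m | (offset D k <= m)%N /\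
    arrival (cust m) <= cycle_time l D x u v k]).
  by apply: finite_preimage fin => i j _ _ /addIn.
apply: sub_finite_set => i _ /=; split; first exact: leq_addl.
exact: AB.
Qed.

Lemma divergent_A : (exists lmax, forall k, (1 <= k)%N -> l (x k).2 <= lmax) ->
  divergent u -> forall K, exists m, K < A m.
Proof.
move=> [lmax hl] ud K.
have lmax0 : 0 < lmax by apply: lt_le_trans (lx0 (leqnn 1)) (hl _ _).
have [n hn] := ud (K * lmax); exists n.
rewrite -(ltr_pM2r lmax0) (lt_le_trans hn)//.
elim: n {hn} => [|n IH]; first by rewrite big_geq// A0 mul0r.
rewrite big_nat_recr//= AS mulrDl lerD// /gap mulrAC -mulrA.
have h := price_cycle_ge1 cust n.
by rewrite ler_peMr// ler_pdivlMr ?lx0// mul1r hl.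
Qed.

Lemma cycle_length_sum k : (1 <= k)%N -> cycle_length l D x u v k =
  \sum_(1 <= n < (D k).+1) gap (o k + n).-1 + W (o k.+1) - W (o k).
Proof.
move=> k1; rewrite /cycle_length /cycle_time /service_start.
rewrite offsetS//.
have -> : A (offset D k + D k) =
    A (offset D k) + \sum_(1 <= n < (D k).+1) gap (o k + n).-1.
  elim: (D k) => [|n IH]; first by rewrite addn0 big_geq// addr0.
  by rewrite big_nat_recr//= addnS AS IH addrA.
by lra.
Qed.

End paths.

(** * Dependence of the path on past policies and services *)

Section causality.
Context {R : realType}.
Variables (l : R -> R) (D D' : nat -> nat) (x x' : nat -> R * R) (u v v' : nat -> R).
Hypothesis D1 : forall k, (1 <= k)%N -> (1 <= D k)%N.
Hypothesis D1' : forall k, (1 <= k)%N -> (1 <= D' k)%N.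
Hypothesis lx0 : forall k, (1 <= k)%N -> 0 < l (x k).2.
Hypothesis mx0 : forall k, (1 <= k)%N -> 0 < (x k).1.
Hypothesis lx0' : forall k, (1 <= k)%N -> 0 < l (x' k).2.
Hypothesis mx0' : forall k, (1 <= k)%N -> 0 < (x' k).1.
Hypothesis u0 : forall m, 0 <= u m.
Hypothesis v0 : forall m, 0 <= v m.
Hypothesis v0' : forall m, 0 <= v' m.
Variables (j a : nat).
Hypothesis j1 : (1 <= j)%N.
Hypothesis xx : forall i, (1 <= i < j)%N -> x i = x' i.
Hypothesis offE : forall i, (i < j)%N -> offset D i = offset D' i.
Hypothesis aj : (a <= offset D j)%N.
Hypothesis aj' : (a <= offset D' j)%N.
Hypothesis vv : forall m, (m < a)%N -> v m = v' m.
Local Notation c := (customer_at l D x u v).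
Local Notation c' := (customer_at l D' x' u v').

Lemma cycle_max_causal (P P' : pred nat) m :
  (forall i, (i < j)%N -> (offset D i <= m)%N -> P i = P' i) ->
  (forall i, (j <= i)%N -> (offset D i <= m)%N -> ~~ P i) ->
  (forall i, (j <= i)%N -> (offset D' i <= m)%N -> ~~ P' i) ->
  (\max_(1 <= i < m.+2 | (offset D i <= m)%N && P i) i =
   \max_(1 <= i < m.+2 | (offset D' i <= m)%N && P' i) i)%N.
Proof.
move=> h1 h2 h3; apply: eq_bigl => i.
case: (ltnP i j) => ij.
  by rewrite -offE//; case: leqP => //= im; rewrite h1.
transitivity false.
  by case: leqP => //= im; exact/negbTE/h2.
by case: leqP => //= im; apply/esym/negbTE/h3.
Qed.

(** In both systems the cycles from [j] on open with a customer of index at least [a], so they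
    influence neither the services nor the prices that determine customers up to [a]. Inequalities
    [aj] and [aj'] in place of equal offsets let cycle [j] begin later in one system, as happens
    when two cycles are merged. *)
Lemma customer_at_causal m : (m <= a)%N -> c m = c' m.
Proof.
elim/ltn_ind: m => -[//|m] IH ma.
have E i : (i <= m)%N -> c i = c' i by move=> im; apply: IH => //; exact: ltnW (leq_ltn_trans im ma).
have na i : (j <= i)%N -> (offset D i <= m)%N -> false.
  move=> ji im; move: (leq_trans aj (offset_mono D ji)).
  by rewrite leqNgt (leq_ltn_trans im).
have na' i : (j <= i)%N -> (offset D' i <= m)%N -> false.
  move=> ji im; move: (leq_trans aj' (offset_mono D' ji)).
  by rewrite leqNgt (leq_ltn_trans im).
have mj : (m < offset D j)%N by exact: leq_trans aj.
have mj' : (m < offset D' j)%N by exact: leq_trans aj'.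
have S : service_cycle D m = service_cycle D' m.
  rewrite /service_cycle.
  have := @cycle_max_causal predT predT m (fun _ _ _ => erefl).
  rewrite (eq_bigl (fun k => (offset D k <= m)%N)); last by move=> i; rewrite andbT.
  rewrite [in RHS](eq_bigl (fun k => (offset D' k <= m)%N)); last by move=> i; rewrite andbT.
  by apply => i ji im; [have := na i ji im|have := na' i ji im].
have Pc : price_cycle D c m = price_cycle D' c' m.
  rewrite /price_cycle; congr maxn; apply: cycle_max_causal.
  - by move=> i ij im; rewrite /service_start -offE// !E.
  - by move=> i ji im; have := na i ji im.
  - by move=> i ji im; have := na' i ji im.
rewrite !customer_atS /next_customer -S -Pc E// (vv ma).
have -> : x (service_cycle D m) = x' (service_cycle D m).
  by apply: xx; rewrite service_cycle_ge1 service_cycle_lt.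
suff -> : x (price_cycle D c m) = x' (price_cycle D c m) by [].
apply: xx; rewrite price_cycle_ge1 /=.
rewrite /price_cycle gtn_max; apply/andP; split.
  rewrite ltn_neqAle j1 andbT; apply/eqP => j_1.
  by move: mj; rewrite -j_1 offset1.
case: (j) j1 na => // j0 _ na; rewrite ltnS; apply/bigmax_leqP_seq => i _ /andP[im _].
by rewrite leqNgt; apply/negP => ji; have := na i ji im.
Qed.

Hypothesis j2 : (2 <= j)%N.

Lemma price_cycle_lt_causal m : arrival (c m) <= service_start c a ->
  (price_cycle D c m < j)%N.
Proof.
move=> h; apply: price_cycle_lt => //; apply: (le_trans h).
exact: B_mono.
Qed.

(** A cycle opened by a customer up to [a] starts at the same time in both systems. One opened later
    starts no earlier than customer [a] does, hence not before the arrival of [m], and is excluded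
    in both. *)
Lemma price_cycle_causal m : arrival (c m) = arrival (c' m) ->
  arrival (c m) <= service_start c a -> price_cycle D c m = price_cycle D' c' m.
Proof.
move=> e le; rewrite /price_cycle; congr maxn; apply: cycle_max_causal.
- move=> i ij im; rewrite -offE// -e; case: (leqP (offset D i) a) => ia.
    by rewrite /service_start customer_at_causal.
  have ca : service_start c a = service_start c' a.
    by rewrite /service_start customer_at_causal.
  rewrite !ltNge; congr (~~ _); transitivity true.
    by rewrite (le_trans le)// B_mono// ltnW.
  by apply/esym; rewrite (le_trans le)// ca B_mono// ltnW.
- move=> i ij im; rewrite -leNgt (le_trans le)// B_mono//.
  by rewrite (leq_trans aj)// offset_mono.
- have ca : service_start c a = service_start c' a.
    by rewrite /service_start customer_at_causal.
  move=> i ij im; rewrite -leNgt -e (le_trans le)// ca B_mono//.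
  by rewrite (leq_trans aj')// offset_mono.
Qed.

(** Customers beyond [a] who arrive before [a] enters service still see only old prices, so their
    arrival times agree although their services may not. Once the arrivals pass this moment they do
    so in both systems at the same customer, and monotonicity keeps them there. *)
Lemma arrival_phase m : (a <= m)%N ->
  (arrival (c m) = arrival (c' m) /\ arrival (c m) <= service_start c a) \/
  (service_start c a < arrival (c m) /\ service_start c a < arrival (c' m)).
Proof.
elim: m => [|m IH]; first by move=> am; left; rewrite A0 addr_ge0// ?A0 ?A_ge0 ?W_ge0.
rewrite leq_eqVlt => /predU1P[<-|]; first by left; rewrite A_le_B customer_at_causal.
rewrite ltnS => /IH[[e le]|[h h']]; last first.
  by right; split; [apply: (lt_le_trans h)|apply: (lt_le_trans h')]; exact: A_mono.
have e1 : arrival (c m.+1) = arrival (c' m.+1).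
  rewrite !AS /gap -price_cycle_causal// e xx// price_cycle_ge1/=.
  exact: price_cycle_lt_causal.
case: (leP (arrival (c m.+1)) (service_start c a)) => h; first by left.
by right; rewrite -e1.
Qed.

End causality.

Lemma offset_ext (D D' : nat -> nat) k :
  (forall i, (1 <= i < k)%N -> D i = D' i) -> offset D k = offset D' k.
Proof.
by move=> h; apply: eq_big_nat => i; exact: h.
Qed.

Lemma cycle_queue_causal {R : realType} (l : R -> R) (D D' : nat -> nat)
    (x x' : nat -> R * R) (u v v' : nat -> R) k :
  (forall k, (1 <= k)%N -> (1 <= D k)%N) -> (forall k, (1 <= k)%N -> (1 <= D' k)%N) ->
  (forall k, (1 <= k)%N -> 0 < l (x k).2) -> (forall k, (1 <= k)%N -> 0 < (x k).1) ->
  (forall k, (1 <= k)%N -> 0 < l (x' k).2) -> (forall k, (1 <= k)%N -> 0 < (x' k).1) ->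
  (forall m, 0 <= u m) -> (forall m, 0 <= v m) -> (forall m, 0 <= v' m) ->
  (forall i, (1 <= i < k)%N -> D i = D' i) -> (forall i, (1 <= i < k)%N -> x i = x' i) ->
  (forall m, (m < offset D k)%N -> v m = v' m) ->
  cycle_queue l D x u v k = cycle_queue l D' x' u v' k.
Proof.
move=> D1 D1' lx mx lx' mx' u0 v0 v0' DD xx vv.
rewrite /cycle_queue; case: leqP => // k2.
have k1 : (1 <= k)%N by exact: ltnW.
have ok : offset D k = offset D' k by exact: offset_ext.
have oi i : (i < k)%N -> offset D i = offset D' i.
  by move=> ik; apply: offset_ext => h /andP[h1 hi]; apply: DD; rewrite h1 (ltn_trans hi).
congr (#|` fset_set _|); apply/seteqP.
have aj' : (offset D k <= offset D' k)%N by rewrite ok.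
have P := @arrival_phase _ l D D' x x' u v v' lx mx lx' mx' u0 v0 v0' k _ k1 xx oi
  (leqnn _) aj' vv k2.
have ct : cycle_time l D x u v k = cycle_time l D' x' u v' k.
  rewrite /cycle_time /service_start -ok.
  by rewrite (@customer_at_causal _ l D D' x x' u v v' k _ k1 xx oi (leqnn _) aj' vv).
rewrite -ct -ok; split => m /= [km Am]; split=> //; move: Am; rewrite /cycle_time.
  by case: (P m km) => [[<-]//|[h _]]; rewrite leNgt h.
by case: (P m km) => [[<-]//|[_ h]]; rewrite leNgt h.
Qed.

(** Inside a busy period of the first system the difference grows by at most [e * (s n + t n)] per
    step. The potential [W + 2 X] grows by exactly [s n + t n], since [W] gains [s - t] and [X]
    gains [t]; at the end of a busy period the difference is at most 0. *)
Lemma lindley_cmp {R : realType} (W X W' s t s' t' : nat -> R) (e : R) N :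
  0 <= e -> W 0%N <= W' 0%N -> (forall n, 0 <= W n) -> (forall n, 0 <= X n) ->
  (forall n, 0 <= W' n) ->
  (forall n, (n < N)%N -> W n.+1 = Num.max 0 (W n + s n - t n)) ->
  (forall n, (n < N)%N -> W' n.+1 = Num.max 0 (W' n + s' n - t' n)) ->
  (forall n, (n < N)%N -> X n.+1 = if 0 < W n.+1 then X n + t n else 0) ->
  (forall n, (n < N)%N -> s n - s' n <= e * s n) ->
  (forall n, (n < N)%N -> t' n - t n <= e * t n) ->
  forall n, (n <= N)%N -> W n - W' n <= e * (W n + 2 * X n).
Proof.
move=> e0 WW0 Wge Xge Wge' WS WS' XS ss tt; elim=> [_|n IH nN].
  rewrite (@le_trans _ _ 0) ?subr_le0// mulr_ge0// addr_ge0 ?Wge// mulr_ge0//.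
have [W0|W0] := leP (W n.+1) 0.
  rewrite (@le_trans _ _ 0)//; first by rewrite subr_le0 (le_trans W0).
  by rewrite mulr_ge0// addr_ge0// mulr_ge0.
have W1 : W n.+1 = W n + s n - t n.
  by move: W0; rewrite WS// lt_max ltxx /= => /ltW/max_r.
have W1' : W' n + s' n - t' n <= W' n.+1 by rewrite WS'// le_max lexx orbT.
have X1 : X n.+1 = X n + t n by rewrite XS// W0.
have := IH (ltnW nN); have := ss n nN; have := tt n nN.
rewrite X1 W1; lra.
Qed.

(* Comparison of cycle k with the continuation of cycle k-1: the primed system
   keeps the policy of cycle k-1 in force until customer [offset D k.+1]. *)
Lemma cycle_compare {R : realType} (l : R -> R) (D D' : nat -> nat)
    (x x' : nat -> R * R) (u v : nat -> R) k (e : R) :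
  (forall k, (1 <= k)%N -> (1 <= D k)%N) -> (forall k, (1 <= k)%N -> (1 <= D' k)%N) ->
  (forall k, (1 <= k)%N -> 0 < l (x k).2) -> (forall k, (1 <= k)%N -> 0 < (x k).1) ->
  (forall k, (1 <= k)%N -> 0 < l (x' k).2) -> (forall k, (1 <= k)%N -> 0 < (x' k).1) ->
  (forall m, 0 <= u m) -> (forall m, 0 <= v m) -> (1 <= k)%N ->
  (forall i, (1 <= i < k)%N -> D i = D' i) -> D' k = (D k + D k.+1)%N ->
  (forall i, (1 <= i <= k)%N -> x i = x' i) ->
  0 <= e ->
  `|(x k.+1).1^-1 - (x k).1^-1| <= e * (x k.+1).1^-1 ->
  `|(x k.+1).1^-1 - (x k).1^-1| <= e * (x k).1^-1 ->
  `|(l (x k.+1).2)^-1 - (l (x k).2)^-1| <= e * (l (x k.+1).2)^-1 ->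
  `|(l (x k.+1).2)^-1 - (l (x k).2)^-1| <= e * (l (x k).2)^-1 ->
  let c := customer_at l D x u v in let c' := customer_at l D' x' u v in
  forall n m, (n <= D k.+1)%N -> m = (offset D k.+1 + n)%N ->
  `|wait (c m) - wait (c' m)| <=
    e * (wait (c m) + 2 * busy (c m) + (wait (c' m) + 2 * busy (c' m))).
Proof.
move=> D1 D1' lx mx lx' mx' u0 v0 k1 DD Dk xx e0 h1 h2 h3 h4 c c' n m nD mE.
set a := offset D k.+1 in mE *.
have oi i : (i < k.+1)%N -> offset D i = offset D' i.
  move=> ik; apply: offset_ext => h /andP[h1' hi]; apply: DD.
  by rewrite h1' (leq_trans hi).
have o'k1 : offset D' k.+1 = (a + D k.+1)%N.
  by rewrite offsetS// Dk -oi// addnA /a (offsetS D k1).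
have aj' : (a <= offset D' k.+1)%N by rewrite o'k1 leq_addr.
have P := @arrival_phase _ l D D' x x' u v v lx mx lx' mx' u0 v0 v0 k.+1 a isT xx oi
  (leqnn _) aj' (fun _ _ => erefl) k1.
have C := @customer_at_causal _ l D D' x x' u v v k.+1 a isT xx oi (leqnn _) aj' (fun _ _ => erefl).
have PC := @price_cycle_causal _ l D D' x x' u v v mx mx' v0 v0 k.+1 a isT xx oi
  (leqnn _) aj' (fun _ _ => erefl).
have PL := @price_cycle_lt_causal _ l D x u v mx v0 k.+1 a (leqnn _) k1.
have rng i : (i < D k.+1)%N -> (offset D k.+1 <= a + i < offset D k.+2)%N.
  by move=> iD; rewrite leq_addr /= (offsetS D (ltn0Sn k)) ltn_add2l.
have rng' i : (i < D k.+1)%N -> (offset D' k <= a + i < offset D' k.+1)%N.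
  move=> iD; rewrite o'k1 ltn_add2l iD andbT -oi//.
  by rewrite (leq_trans (offset_mono D (leqnSn k)))// leq_addr.
have Sv i : (i < D k.+1)%N ->
    svc D x v (a + i) = v (a + i)%N / (x k.+1).1 /\ svc D' x' v (a + i) = v (a + i)%N / (x k).1.
  move=> iD; rewrite /svc (service_cycleE D1 (ltn0Sn k) (rng _ iD)).
  by rewrite (service_cycleE D1' k1 (rng' _ iD)) -xx// k1 leqnn.
(* By [arrival_phase]: before the start of cycle [k.+1] both systems charge the same old prices;
   after it the gaps run at the prices of cycles [k.+1] and [k]. *)
have G i : (i < D k.+1)%N ->
    gap l D x u v (a + i) = gap l D' x' u v (a + i) \/
    (gap l D x u v (a + i) = u (a + i)%N / l (x k.+1).2 /\
     gap l D' x' u v (a + i) = u (a + i)%N / l (x k).2).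
  move=> iD; case: (P (a + i)%N (leq_addr _ _)) => [[eA le]|[h h']].
    left; rewrite /gap -PC// xx// price_cycle_ge1/= -ltnS; exact: PL.
  right; rewrite /gap (price_cycle_eq D1 _ (rng _ iD))//.
  rewrite (price_cycle_eq D1' k1 (rng' _ iD)) -?(xx k) ?k1 ?leqnn//.
  apply: le_lt_trans h'.
  have -> : service_start (customer_at l D x u v) a = service_start (customer_at l D' x' u v) a.
    by rewrite /service_start C.
  by rewrite -oi// B_mono// /a offset_mono.
have key1 (z p p' : R) : 0 <= z -> `|p - p'| <= e * p -> `|p - p'| <= e * p' ->
    [/\ z * p - z * p' <= e * (z * p), z * p' - z * p <= e * (z * p'),
        z * p' - z * p <= e * (z * p) & z * p - z * p' <= e * (z * p')].
  move=> z0 /ler_normlP[q1 q2] /ler_normlP[q3 q4].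
  by split; rewrite -mulrBr mulrCA ler_wpM2l//; lra.
have S2 i iD := let: conj q1 q2 := Sv i iD in (q1, q2).
have Gs i : (i < D k.+1)%N ->
    gap l D' x' u v (a + i) - gap l D x u v (a + i) <= e * gap l D x u v (a + i) /\
    gap l D x u v (a + i) - gap l D' x' u v (a + i) <= e * gap l D' x' u v (a + i).
  move=> iD; case: (G i iD) => [->|[-> ->]].
    by rewrite subrr mulr_ge0// gap_ge0.
  by have [] := key1 _ _ _ (u0 (a + i)%N) h3 h4.
have Ss i : (i < D k.+1)%N ->
    svc D x v (a + i) - svc D' x' v (a + i) <= e * svc D x v (a + i) /\
    svc D' x' v (a + i) - svc D x v (a + i) <= e * svc D' x' v (a + i).
  by move=> iD; rewrite !S2//; have [] := key1 _ _ _ (v0 (a + i)%N) h1 h2.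
have c_a : c a = c' a by exact: C.
subst m; set m := (a + n)%N.
have L : wait (c m) - wait (c' m) <= e * (wait (c m) + 2 * busy (c m)).
  apply: (@lindley_cmp _ (fun i => wait (c (a + i)%N)) (fun i => busy (c (a + i)%N))
   (fun i => wait (c' (a + i)%N)) (fun i => svc D x v (a + i)) (fun i => gap l D x u v (a + i))
   (fun i => svc D' x' v (a + i)) (fun i => gap l D' x' u v (a + i)) e (D k.+1)) => //.
  - by rewrite addn0 c_a.
  - by move=> i; exact: W_ge0.
  - by move=> i; exact: X_ge0.
  - by move=> i; exact: W_ge0.
  - by move=> i _; rewrite addnS [in LHS]/c WS.
  - by move=> i _; rewrite addnS [in LHS]/c' WS.
  - by move=> i _; rewrite addnS [in LHS]/c XS.
  - by move=> i /Ss[].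
  - by move=> i /Gs[].
have L' : wait (c' m) - wait (c m) <= e * (wait (c' m) + 2 * busy (c' m)).
  apply: (@lindley_cmp _ (fun i => wait (c' (a + i)%N)) (fun i => busy (c' (a + i)%N))
   (fun i => wait (c (a + i)%N)) (fun i => svc D' x' v (a + i)) (fun i => gap l D' x' u v (a + i))
   (fun i => svc D x v (a + i)) (fun i => gap l D x u v (a + i)) e (D k.+1)) => //.
  - by rewrite addn0 c_a.
  - by move=> i; exact: W_ge0.
  - by move=> i; exact: X_ge0.
  - by move=> i; exact: W_ge0.
  - by move=> i _; rewrite addnS [in LHS]/c' WS.
  - by move=> i _; rewrite addnS [in LHS]/c WS.
  - by move=> i _; rewrite addnS [in LHS]/c' XS.
  - by move=> i /Ss[].
  - by move=> i /Gs[].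
have := X_ge0 D v lx u0 m; have := X_ge0 D' v lx' u0 m.
have := W_ge0 l D x u v m; have := W_ge0 l D' x' u v m.
rewrite -/c -/c' => w1 w2 y1 y2.
have p1 : 0 <= e * (wait (c m) + 2 * busy (c m)) by rewrite mulr_ge0//; lra.
have p2 : 0 <= e * (wait (c' m) + 2 * busy (c' m)) by rewrite mulr_ge0//; lra.
by rewrite ler_norml; apply/andP; split; rewrite mulrDr; lra.
Qed.

(** * Independence of the primitives *)

Section independence.
Context {R : realType} {d : measure_display} {Om : measurableType d}.
Variables (P : probability Om R) (U V : nat -> {RV P >-> R}).
Hypothesis hUV : primitives_ok U V.
Implicit Types (S : set nat) (B C : nat -> set R) (E : set Om).

Let iU : iid U. Proof. by case: hUV. Qed.
Let iV : iid V. Proof. by case: hUV. Qed.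

Lemma prim_meas (Z : {RV P >-> R}) (B : set R) : measurable B -> measurable (Z @^-1` B).
Proof. by move=> mB; rewrite -[X in measurable X]setTI; exact: measurable_funP. Qed.

Definition cylinder B C : set Om :=
  (\bigcap_j (U j @^-1` B j)) `&` (\bigcap_j (V j @^-1` C j)).

(** The bound [N] makes the event finite-dimensional, so that its probability is a finite product
    even when the index sets are infinite. *)
Definition is_cyl S1 S2 E := exists N B C,
  [/\ forall j, measurable (B j), forall j, measurable (C j),
      forall j, ~ (S1 j /\ (j < N)%N) -> B j = setT,
      forall j, ~ (S2 j /\ (j < N)%N) -> C j = setT & E = cylinder B C].

(* Null events are included because the number in queue is determined by the
   past only up to the null event that no further arrival ever occurs. *)
Definition info S1 S2 : set (set Om) :=
  <<s [set E | is_cyl S1 S2 E \/ (measurable E /\ P E = 0%E)] >>.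

Lemma bigcap_cyl (Z : nat -> {RV P >-> R}) B N : (forall j, (N <= j)%N -> B j = setT) ->
  \bigcap_j (Z j @^-1` B j) = \bigcap_(j in [set` iota 0 N]) (Z j @^-1` B j).
Proof.
move=> BN; apply/seteqP; split => o h j.
  by move=> _; exact: h.
move=> _; case: (ltnP j N) => jN; first by apply: h; rewrite /= mem_iota.
by rewrite BN.
Qed.

Lemma iid_cyl (Z : nat -> {RV P >-> R}) B N : iid Z -> (forall j, measurable (B j)) ->
  (forall j, (N <= j)%N -> B j = setT) ->
  P (\bigcap_j (Z j @^-1` B j)) = (\prod_(j < N) P (Z j @^-1` B j))%E.
Proof.
move=> [_ iZ] mB BN; rewrite (bigcap_cyl _ BN) iZ ?iota_uniq//.
by rewrite -(big_mkord xpredT (fun j => P (Z j @^-1` B j))) /index_iota subn0.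
Qed.

Lemma sigma_of_cyl (Z : nat -> {RV P >-> R}) B : (forall j, measurable (B j)) ->
  sigma_of (range (fun n => Z n : Om -> R)) (\bigcap_j (Z j @^-1` B j)).
Proof.
move=> mB; have [h0 hC hU] := smallest_sigma_algebra setT
   (\bigcup_(Y in range (fun n => Z n : Om -> R)) preimage_set_system setT Y measurable).
have -> : \bigcap_j (Z j @^-1` B j) = setT `\` \bigcup_j (setT `\` Z j @^-1` B j).
  by rewrite setTD setC_bigcup; apply: eq_bigcapr => i _; rewrite setTD setCK.
apply: (hC); apply: hU => n; apply: (hC); apply: sub_sigma_algebra.
exists (Z n : Om -> R); first by exists n.
by exists (B n) => //; rewrite setTI.
Qed.

Lemma cylinder_prob B C N : (forall j, measurable (B j)) -> (forall j, measurable (C j)) ->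
  (forall j, (N <= j)%N -> B j = setT) -> (forall j, (N <= j)%N -> C j = setT) ->
  P (cylinder B C) =
    (\prod_(j < N) P (U j @^-1` B j) * \prod_(j < N) P (V j @^-1` C j))%E.
Proof.
move=> mB mC BN CN; case: hUV => _ _ iUV _ _.
by rewrite /cylinder iUV ?(iid_cyl _ _ BN) ?(iid_cyl _ _ CN)//; exact: sigma_of_cyl.
Qed.

Lemma bigcap_measurableZ (Z : nat -> {RV P >-> R}) B : (forall j, measurable (B j)) ->
  measurable (\bigcap_j (Z j @^-1` B j)).
Proof. by move=> mB; apply: bigcap_measurableType => j _; exact: prim_meas. Qed.

Lemma cyl_measurable S1 S2 E : is_cyl S1 S2 E -> measurable E.
Proof.
move=> [N [B [C [mB mC _ _ ->]]]].
by apply: measurableI; exact: bigcap_measurableZ.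
Qed.

Lemma info_measurable S1 S2 : info S1 S2 `<=` measurable.
Proof.
apply: smallest_sub; first exact: sigma_algebra_measurable.
by move=> E [/cyl_measurable|[]].
Qed.

Lemma info_sigma S1 S2 : sigma_algebra setT (info S1 S2).
Proof. exact: smallest_sigma_algebra. Qed.

Lemma info_null S1 S2 E : measurable E -> P E = 0%E -> info S1 S2 E.
Proof. by move=> mE E0; apply: sub_sigma_algebra; right. Qed.

Lemma is_cylS S1 S2 S1' S2' E : S1 `<=` S1' -> S2 `<=` S2' ->
  is_cyl S1 S2 E -> is_cyl S1' S2' E.
Proof.
move=> h1 h2 [N [B [C [mB mC hB hC ->]]]]; exists N, B, C; split=> //.
  by move=> j hj; apply: hB => -[? ?]; apply: hj; split=> //; exact: h1.
by move=> j hj; apply: hC => -[? ?]; apply: hj; split=> //; exact: h2.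
Qed.

Lemma infoS S1 S2 S1' S2' : S1 `<=` S1' -> S2 `<=` S2' -> info S1 S2 `<=` info S1' S2'.
Proof.
move=> h1 h2; apply: smallest_sub; first exact: info_sigma.
move=> E [cE|[mE E0]]; apply: sub_sigma_algebra; [left|by right].
exact: is_cylS cE.
Qed.

Lemma infoU S1 S2 j (B : set R) : S1 j -> measurable B -> info S1 S2 (U j @^-1` B).
Proof.
move=> Sj mB; apply: sub_sigma_algebra; left.
exists j.+1, (fun i => if i == j then B else setT), (fun=> setT); split=> //.
- by move=> i; case: ifP.
- by move=> i h; case: eqP => // e; exfalso; apply: h; rewrite e.
- rewrite /cylinder; apply/seteqP; split=> o /=.
    by move=> h; split=> i _ //=; case: eqP => // ->.
  by move=> [/(_ j Logic.I)/=]; rewrite eqxx.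
Qed.

Lemma infoV S1 S2 j (B : set R) : S2 j -> measurable B -> info S1 S2 (V j @^-1` B).
Proof.
move=> Sj mB; apply: sub_sigma_algebra; left.
exists j.+1, (fun=> setT), (fun i => if i == j then B else setT); split=> //.
- by move=> i; case: ifP.
- by move=> i h; case: eqP => // e; exfalso; apply: h; rewrite e.
- rewrite /cylinder; apply/seteqP; split=> o /=.
    by move=> h; split=> i _ //=; case: eqP => // ->.
  by move=> [_ /(_ j Logic.I)/=]; rewrite eqxx.
Qed.

(** The events independent of a fixed event form a Dynkin system; closure under increasing unions is
    continuity from below. *)
Lemma lambda_indep E : measurable E ->
  lambda_system setT [set A | measurable A /\ P (A `&` E) = (P A * P E)%E].
Proof.
move=> mE; split.
- by move=> A _; exact: subsetT.
- by split=> //; rewrite setTI probability_setT mul1e.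
- move=> A B BA [mA hA] [mB hB]; split; first exact: measurableD.
  have -> : (A `\` B) `&` E = (A `&` E) `\` (B `&` E).
    apply/seteqP; split=> o /=; first by move=> [[? ?] ?]; split=> // -[].
    by move=> [[? ?] h]; split=> //; split=> // ?; exact: h.
  have mD X Y : measurable X -> measurable Y -> P (X `\` Y) = (P X - P (X `&` Y))%E.
    by move=> mX mY; apply: measureD => //; rewrite -ge0_fin_numE ?fin_num_measure.
  have mAE : measurable (A `&` E) by exact: measurableI.
  have mBE : measurable (B `&` E) by exact: measurableI.
  have e1 : (A `&` E) `&` (B `&` E) = B `&` E by rewrite setIACA setIid (setIidr BA).
  rewrite (mD _ _ mAE mBE) e1 (mD _ _ mA mB) (setIidr BA) hA hB muleBl//.
    by rewrite fin_num_measure.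
  by rewrite fin_num_adde_defr// fin_num_measure.
- move=> F ndF FG.
  have mF i : measurable (F i) by case: (FG i).
  have mUF : measurable (\bigcup_i F i) by exact: bigcup_measurable.
  split=> //.
  have c1 : (P \o F) @ \oo --> P (\bigcup_i F i) by exact: nondecreasing_cvg_mu.
  have c2 : (P \o (fun i => F i `&` E)) @ \oo --> P ((\bigcup_i F i) `&` E).
    rewrite setI_bigcupl; apply: nondecreasing_cvg_mu => //.
    - by move=> i; exact: measurableI.
    - by apply: bigcup_measurable => i _; exact: measurableI.
    - by move=> m n mn; apply/subsetPset; apply: setSI; exact/subsetPset/ndF.
  apply: (cvg_unique _ c2) => //.
  have -> : P \o (fun i => F i `&` E) = (fun i => P (F i) * P E)%E.
    by apply/funext => i /=; case: (FG i).
  by apply: cvgeZr => //; rewrite fin_num_measure.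
Qed.

(** In factor [m] one of the two sets is trivial, so the probability of the intersection is a
    product there; all other factors are unchanged. *)
Lemma prod_prob_setI (Z : nat -> {RV P >-> R}) B (C : set R) m N :
  (m < N)%N -> B m = setT \/ C = setT ->
  (\prod_(j < N) P (Z j @^-1` (if j == m :> nat then B j `&` C else B j)) =
   \prod_(j < N) P (Z j @^-1` B j) * P (Z m @^-1` C))%E.
Proof.
move=> mN h; rewrite (bigD1 (Ordinal mN))//= [in RHS](bigD1 (Ordinal mN))//= eqxx.
rewrite muleAC; congr (_ * _)%E.
  by case: h => ->; rewrite ?setTI ?setIT preimage_setT probability_setT ?mul1e ?mule1.
apply: eq_bigr => j jm; rewrite ifF//.
by apply/negbTE; apply: contra jm => /eqP e; apply/eqP/val_inj.
Qed.

Lemma null_setI X Y : measurable X -> measurable Y -> P X = 0%E -> P (X `&` Y) = 0%E.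
Proof.
move=> mX mY X0; apply/eqP; rewrite eq_le measure_ge0 andbT -X0.
by rewrite le_measure ?inE//; exact: measurableI.
Qed.

Lemma info_gen_setI S1 S2 :
  setI_closed [set E | is_cyl S1 S2 E \/ (measurable E /\ P E = 0%E)].
Proof.
move=> X Y [cX|[mX X0]] [cY|[mY Y0]]; last first.
- by right; split; [exact: measurableI|exact: null_setI].
- have mY := cyl_measurable cY.
  by right; split; [exact: measurableI|exact: null_setI].
- have mX := cyl_measurable cX.
  by right; rewrite setIC; split; [exact: measurableI|exact: null_setI].
left; case: cX cY => N [B [C [mB mC hB hC ->]]] [N' [B' [C' [mB' mC' hB' hC' ->]]]].
exists (maxn N N'), (fun j => B j `&` B' j), (fun j => C j `&` C' j); split.
- by move=> j; exact: measurableI.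
- by move=> j; exact: measurableI.
- move=> j h; rewrite hB ?hB' ?setTI// => -[Sj jN]; apply: h; split=> //;
    by rewrite (leq_trans jN)// ?leq_maxl ?leq_maxr.
- move=> j h; rewrite hC ?hC' ?setTI// => -[Sj jN]; apply: h; split=> //;
    by rewrite (leq_trans jN)// ?leq_maxl ?leq_maxr.
- rewrite /cylinder; apply/seteqP; split=> o /=.
    by move=> [[h1 h2] [h3 h4]]; split=> j _; split;
      [exact: h1|exact: h3|exact: h2|exact: h4].
  move=> [h1 h2]; split; split=> j _; by [case: (h1 j Logic.I)|case: (h2 j Logic.I)].
Qed.

(** By the pi-lambda theorem it suffices to treat cylinders and null events, and for cylinders both
    sides are finite products. Allowing [B] or [C] to be [setT] for an index that lies in the
    information lets one statement serve for [U] and for [V]. *)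
Lemma info_indep S1 S2 m m' (B C : set R) : measurable B -> measurable C ->
  (S1 m -> B = setT) -> (S2 m' -> C = setT) ->
  forall A, info S1 S2 A -> P (A `&` (U m @^-1` B `&` V m' @^-1` C)) =
     (P A * P (U m @^-1` B `&` V m' @^-1` C))%E.
Proof.
move=> mB mC hB hC A IA.
set E := U m @^-1` B `&` V m' @^-1` C.
have mE : measurable E by apply: measurableI; exact: prim_meas.
suff: info S1 S2 `<=` [set A | measurable A /\ P (A `&` E) = (P A * P E)%E].
  by move=> /(_ _ IA)[].
apply: lambda_system_subset => //; last first.
  move=> X [|]; last first.
    by move=> [mX X0]; split=> //; rewrite X0 mul0e null_setI.
  move=> cX; split; first exact: cyl_measurable cX.
  case: cX => N [B' [C' [mB' mC' hB' hC' ->]]].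
  pose N' := maxn N (maxn m.+1 m'.+1).
  have NN' : (N <= N')%N by rewrite leq_maxl.
  have mN' : (m < N')%N by rewrite /N' !leq_max leqnn ?orbT.
  have m'N' : (m' < N')%N by rewrite /N' !leq_max leqnn ?orbT.
  have BN j : (N' <= j)%N -> B' j = setT.
    by move=> jN; apply: hB' => -[_]; rewrite ltnNge (leq_trans NN').
  have CN j : (N' <= j)%N -> C' j = setT.
    by move=> jN; apply: hC' => -[_]; rewrite ltnNge (leq_trans NN').
  have oB : B' m = setT \/ B = setT.
    case: (pselect (S1 m)) => [/hB ->|nS]; first by right.
    by left; apply: hB' => -[].
  have oC : C' m' = setT \/ C = setT.
    case: (pselect (S2 m')) => [/hC ->|nS]; first by right.
    by left; apply: hC' => -[].
  have -> : cylinder B' C' `&` E =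
     cylinder (fun j => if j == m then B' j `&` B else B' j)
              (fun j => if j == m' then C' j `&` C else C' j).
    apply/seteqP; split=> o /=.
      move=> [[h1 h2] [h3 h4]]; split=> j _ /=.
        by case: eqP => [->|_]; [split=> //|]; exact: h1.
      by case: eqP => [->|_]; [split=> //|]; exact: h2.
    move=> [h1 h2]; split; [split=> j _|split].
    - by have := h1 j Logic.I; case: eqP => //= _ [].
    - by have := h2 j Logic.I; case: eqP => //= _ [].
    - by have := h1 m Logic.I; rewrite /= eqxx => -[].
    - by have := h2 m' Logic.I; rewrite /= eqxx => -[].
  have PE : P E = (P (U m @^-1` B) * P (V m' @^-1` C))%E.
    case: hUV => _ _ iUV _ _; apply: iUV; apply: sub_sigma_algebra.
      by exists (U m : Om -> R); [exists m|exists B; rewrite ?setTI].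
    by exists (V m' : Om -> R); [exists m'|exists C; rewrite ?setTI].
  rewrite (@cylinder_prob _ _ N').
  - rewrite (@cylinder_prob _ _ N')// PE.
    by rewrite (prod_prob_setI _ mN' oB) (prod_prob_setI _ m'N' oC) muleACA.
  - by move=> j; case: ifP => // _; exact: measurableI.
  - by move=> j; case: ifP => // _; exact: measurableI.
  - by move=> j jN; rewrite BN//; case: eqP jN => // ->; rewrite leqNgt mN'.
  - by move=> j jN; rewrite CN//; case: eqP jN => // ->; rewrite leqNgt m'N'.
- exact: lambda_indep.
- exact: info_gen_setI.
Qed.

End independence.

(** * Integrating out a variable independent of the past *)

Section freeze.
Local Open Scope ereal_scope.
Context {R : realType} {d d1 d2 : measure_display} {Om : measurableType d}.
Context {T1 : measurableType d1} {T2 : measurableType d2}.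
Variables (P : probability Om R) (Y : Om -> T1) (Z Z' : Om -> T2).
Hypothesis mY : measurable_fun setT Y.
Hypothesis mZ : measurable_fun setT Z.
Hypothesis mZ' : measurable_fun setT Z'.
Hypothesis ind : forall A B, measurable A -> measurable B ->
  P (Y @^-1` A `&` Z @^-1` B) = P (Y @^-1` A) * P (Z' @^-1` B).

Let Y_ : {mfun Om >-> T1} := HB.pack Y (isMeasurableFun.Build _ _ _ _ _ mY).
Let Z'_ : {mfun Om >-> T2} := HB.pack Z' (isMeasurableFun.Build _ _ _ _ _ mZ').
Let mYZ : measurable_fun setT (fun o => (Y o, Z o)).
Proof. exact: measurable_fun_pair. Qed.
Let YZ_ : {mfun Om >-> (T1 * T2)%type} := HB.pack (fun o => (Y o, Z o)) (isMeasurableFun.Build _ _ _ _ _ mYZ).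

(** The joint law of [Y] and [Z] is the product of the laws of [Y] and [Z'], by uniqueness of the
    product measure; Tonelli then splits the integral. The copy [Z'] is kept separate from [Z] so
    that later steps can always refer to the primitive of index 0. *)
Lemma freeze (f : T1 * T2 -> \bar R) : measurable_fun [set: T1 * T2] f -> (forall z, 0 <= f z) ->
  \int[P]_o f (Y o, Z o) = \int[P]_o \int[P]_o' f (Y o, Z' o').
Proof.
move=> mf f0.
pose Q : {measure set (T1 * T2)%type -> \bar R} := distribution P YZ_.
pose QY : {sigma_finite_measure set T1 -> \bar R} := distribution P Y_.
pose QZ : {sigma_finite_measure set T2 -> \bar R} := distribution P Z'_.
transitivity (\int[Q]_z f z).
  by rewrite ge0_integral_pushforward// => z _; exact: f0.
have F1 := @fubini_tonelli1 _ _ _ _ _ QY QZ f mf f0.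
transitivity (\int[QY]_x fubini_F QZ f x).
  rewrite -F1; apply: eq_measure_integral => A mA _; apply/esym.
  exact: (@product_measure_unique _ _ _ _ _ QY QZ Q).
have mF := @measurable_fun_fubini_tonelli_F _ _ _ _ _ QZ f mf f0.
rewrite (@ge0_integral_pushforward _ _ _ _ _ Y mY P setT (fubini_F QZ f) measurableT mF); last first.
  by move=> z _; apply: integral_ge0.
rewrite preimage_setT; apply: eq_integral => o _ /=.
rewrite /fubini_F ge0_integral_pushforward//.
exact: measurableT_comp.
Qed.

End freeze.

Section freeze_primitives.
Local Open Scope ereal_scope.
Context {R : realType} {d d1 : measure_display} {Om : measurableType d} {T : measurableType d1}.
Variables (P : probability Om R) (U V : nat -> {RV P >-> R}).
Hypothesis hUV : primitives_ok U V.

Definition info_fun {d1} {T : measurableType d1} S1 S2 (Y : Om -> T) :=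
  forall A, measurable A -> info U V S1 S2 (Y @^-1` A).

Lemma info_fun_measurable S1 S2 (Y : Om -> T) : info_fun S1 S2 Y -> measurable_fun setT Y.
Proof.
move=> h _ A mA; rewrite setTI.
exact: (info_measurable (h _ mA)).
Qed.

Lemma freezeU S1 S2 m (Y : Om -> T) (f : T * R -> \bar R) :
  ~ S1 m -> info_fun S1 S2 Y -> measurable_fun setT f -> (forall z, 0 <= f z) ->
  \int[P]_o f (Y o, U m o) = \int[P]_o \int[P]_o' f (Y o, U 0%N o').
Proof.
move=> Sm hY mf f0; apply: freeze => //; first exact: info_fun_measurable hY.
move=> A B mA mB.
have := @info_indep _ _ _ P U V hUV S1 S2 m 0%N B setT mB measurableT _ _ _ (hY A mA).
rewrite preimage_setT setIT => -> //.
by case: hUV => -[+ _] _ _ _ _ => ->.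
Qed.

Lemma freezeV S1 S2 m (Y : Om -> T) (f : T * R -> \bar R) :
  ~ S2 m -> info_fun S1 S2 Y -> measurable_fun setT f -> (forall z, 0 <= f z) ->
  \int[P]_o f (Y o, V m o) = \int[P]_o \int[P]_o' f (Y o, V 0%N o').
Proof.
move=> Sm hY mf f0; apply: freeze => //; first exact: info_fun_measurable hY.
move=> A B mA mB.
have := @info_indep _ _ _ P U V hUV S1 S2 0%N m setT B measurableT mB _ _ _ (hY A mA).
rewrite preimage_setT setTI => -> //.
by case: hUV => _ [+ _] _ _ _ => ->.
Qed.

End freeze_primitives.

Section freeze_pair.
Local Open Scope ereal_scope.
Context {R : realType} {d d1 : measure_display} {Om : measurableType d} {T : measurableType d1}.
Variables (P : probability Om R) (U V : nat -> {RV P >-> R}).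
Hypothesis hUV : primitives_ok U V.

(** Turns information into ordinary measurability for the sigma-algebra [info], so that all closure
    lemmas for measurable functions apply to it. *)
Lemma info_fun_gP {d2} {T2 : measurableType d2} S1 S2 (Y : Om -> T2) :
  info_fun U V S1 S2 Y <->
  measurable_fun setT (Y : g_sigma_algebraType (info U V S1 S2) -> T2).
Proof.
have E : <<s info U V S1 S2 >> = info U V S1 S2 by rewrite sigma_algebra_id//; exact: info_sigma.
split=> [h _ A mA|h A mA].
  by rewrite setTI /measurable/= E; exact: h.
by have := h measurableT A mA; rewrite setTI /measurable/= E.
Qed.

Lemma info_fun_pair {d2 d3} {T2 : measurableType d2} {T3 : measurableType d3} S1 S2
    (Y : Om -> T2) (Z : Om -> T3) :
  info_fun U V S1 S2 Y -> info_fun U V S1 S2 Z -> info_fun U V S1 S2 (fun o => (Y o, Z o)).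
Proof.
move=> /info_fun_gP hY /info_fun_gP hZ; apply/info_fun_gP.
exact: measurable_fun_pair.
Qed.

Lemma info_funS {d2} {T2 : measurableType d2} S1 S2 S1' S2' (Y : Om -> T2) :
  S1 `<=` S1' -> S2 `<=` S2' -> info_fun U V S1 S2 Y -> info_fun U V S1' S2' Y.
Proof. by move=> h1 h2 hY A mA; apply: (infoS h1 h2); exact: hY. Qed.

(** [V m] is frozen with the pair of [Y] and [U m] as the past, then [U m] with [Y] as the past.
    Finally the double integral over [U 0] and [V 0] is joined into one, because these two are
    independent themselves. *)
Lemma freeze_pair S1 S2 m (Y : Om -> T) (f : T * (R * R) -> \bar R) :
  ~ S1 m -> ~ S2 m -> info_fun U V S1 S2 Y ->
  measurable_fun setT f -> (forall z, 0 <= f z) ->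
  \int[P]_o f (Y o, (U m o, V m o)) =
  \int[P]_o \int[P]_o' f (Y o, (U 0%N o', V 0%N o')).
Proof.
move=> n1 n2 hY mf f0.
pose g := fun z : (T * R) * R => f (z.1.1, (z.1.2, z.2)).
have mg : measurable_fun setT g.
  apply: measurableT_comp => //; apply: measurable_fun_pair => /=.
    exact: measurableT_comp measurable_fst measurable_fst.
  apply: measurable_fun_pair => //.
  exact: measurableT_comp measurable_snd measurable_fst.
pose S1' := S1 `|` [set m].
have hYU : info_fun U V S1' S2 (fun o => (Y o, U m o)).
  apply: info_fun_pair; first by apply: info_funS hY => // ?; left.
  by move=> A mA; apply: infoU => //; right.
transitivity (\int[P]_o \int[P]_o' g ((Y o, U m o), V 0%N o')).
  exact: (@freezeV _ _ _ _ _ P U V hUV S1' S2 m (fun o => (Y o, U m o)) g n2 hYU mg (fun z => f0 _)).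
pose h := fun z : T * R => \int[P]_o' g (z, V 0%N o').
have mh : measurable_fun setT h.
  apply: (@measurable_fun_fubini_tonelli_F _ _ (T * R)%type Om R P
     (fun z => g (z.1, V 0%N z.2))); last by move=> z; exact: f0.
  apply: measurableT_comp => //; apply: measurable_fun_pair => //.
  by apply: measurableT_comp => //; exact: measurable_snd.
rewrite (@freezeU _ _ _ _ _ P U V hUV S1 S2 m Y h n1 hY mh); last first.
  by move=> z; apply: integral_ge0 => o _; exact: f0.
apply: eq_integral => o _.
pose gy := fun z : R * R => f (Y o, (z.1, z.2)).
have mgy : measurable_fun setT gy.
  apply: measurableT_comp => //; apply: measurable_fun_pair => //.
  by apply: measurable_fun_pair; [exact: measurable_fst|exact: measurable_snd].
apply/esym; apply: (@freezeV _ _ _ _ _ P U V hUV [set 0%N] set0 0%N (U 0%N) gy) => //; last by move=> z; exact: f0.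
by move=> A mA; exact: infoU.
Qed.

End freeze_pair.

(** * Measurability *)

Section measurable_misc.
Context {R : realType} {d : measure_display} {T : measurableType d}.

Lemma measurable_fun_invr (f : T -> R) : measurable_fun setT f -> (forall o, 0 <= f o) ->
  measurable_fun setT (fun o => (f o)^-1).
Proof.
move=> mf f0; rewrite (_ : (fun o => _) = (@powR R ^~ (-1)) \o f).
  by apply: measurableT_comp => //; exact: measurable_powR.
by apply/funext => o /=; rewrite powR_inv1.
Qed.

Lemma measurable_fun_natr (f : T -> nat) : measurable_fun setT f ->
  measurable_fun setT (fun o => (f o)%:R : R).
Proof. by move=> mf; apply: (measurableT_comp (f := fun n : nat => n%:R : R)). Qed.

Lemma measurable_nat_le (f : T -> nat) :
  (forall i, measurable [set o | (f o <= i)%N]) -> measurable_fun setT f.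
Proof.
move=> mf _ B _; rewrite setTI.
rewrite (_ : f @^-1` B = \bigcup_n (if n \in B then f @^-1` [set n] else set0)); last first.
  apply/seteqP; split=> o /=.
    by move=> Bo; exists (f o) => //; rewrite mem_set.
  by move=> [n _]; case: ifPn => [/set_mem Bn /= ->//|].
apply: bigcup_measurable => n _; case: ifP => // _.
case: n => [|n].
  rewrite (_ : f @^-1` _ = [set o | (f o <= 0)%N])//.
  by apply/seteqP; split=> o /=; rewrite leqn0 => /eqP.
rewrite (_ : f @^-1` _ = [set o | (f o <= n.+1)%N] `\` [set o | (f o <= n)%N]).
  exact: measurableD.
apply/seteqP; split=> o /=; first by move=> ->; rewrite leqnn ltnn.
by move=> [h1 /negP]; rewrite -ltnNge => h2; apply/eqP; rewrite eqn_leq h1.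
Qed.

Lemma measurable_set_le (f g : T -> R) : measurable_fun setT f -> measurable_fun setT g ->
  measurable [set o | f o <= g o].
Proof.
move=> mf mg; rewrite (_ : [set o | _] = setT `&` (fun o => f o <= g o) @^-1` [set true]).
  exact: (measurable_fun_ler mf mg).
by rewrite setTI; apply/seteqP; split=> o.
Qed.

Lemma measurable_set_lt (f g : T -> R) : measurable_fun setT f -> measurable_fun setT g ->
  measurable [set o | f o < g o].
Proof.
move=> mf mg; rewrite (_ : [set o | _] = setT `&` (fun o => f o < g o) @^-1` [set true]).
  exact: (measurable_fun_ltr mf mg).
by rewrite setTI; apply/seteqP; split=> o.
Qed.

Lemma measurable_at_max (F : nat -> T -> R) (c : nat -> T -> bool) n :
  (forall k, (1 <= k)%N -> measurable_fun setT (F k)) ->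
  (forall k, (1 <= k <= n)%N -> measurable_fun setT (c k)) ->
  measurable_fun setT (fun o => F (maxn 1 (\max_(1 <= k < n.+1 | c k o) k)) o).
Proof.
move=> mF; elim: n => [|n IH] mc.
  by under eq_fun do rewrite big_geq//; exact: mF.
rewrite (_ : (fun o => _) = (fun o => if c n.+1 o then F n.+1 o else
    F (maxn 1 (\max_(1 <= k < n.+1 | c k o) k)) o)).
  apply: measurable_fun_ifT; [by apply: mc; rewrite /= leqnn|exact: mF|].
  by apply: IH => k /andP[k1 kn]; apply: mc; rewrite k1 (leq_trans kn).
apply/funext => o; rewrite big_mkcond big_nat_recr//= -big_mkcond.
have le : (\max_(1 <= k < n.+1 | c k o) k <= n)%N.
  by apply/bigmax_leqP_seq => i; rewrite mem_index_iota ltnS => /andP[].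
case: ifP => _; last by rewrite maxn0.
rewrite (maxn_idPr (leqW le)) (maxn_idPr _)//.
Qed.

End measurable_misc.

Section path_measurable.
Context {R : realType} {d : measure_display} {T : measurableType d}.
Variables (l : R -> R) (D : nat -> nat) (x : nat -> T -> R * R) (u v : nat -> T -> R).
Hypothesis mr : forall k, (1 <= k)%N -> measurable_fun setT (fun o => (l (x k o).2)^-1).
Hypothesis ms : forall k, (1 <= k)%N -> measurable_fun setT (fun o => (x k o).1^-1).
Variable N : nat.
Hypothesis mu : forall m, (m < N)%N -> measurable_fun setT (u m).
Hypothesis mv : forall m, (m < N)%N -> measurable_fun setT (v m).
Local Notation c o := (customer_at l D (x ^~ o) (u ^~ o) (v ^~ o)).

Lemma gap_svc_measurable m : (m < N)%N ->
  (forall i, (i <= m)%N -> measurable_fun setT (fun o => arrival (c o i)) /\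
     measurable_fun setT (fun o => wait (c o i))) ->
  measurable_fun setT (fun o => gap l D (x ^~ o) (u ^~ o) (v ^~ o) m) /\
  measurable_fun setT (fun o => svc D (x ^~ o) (v ^~ o) m).
Proof.
move=> mN IH; split; last first.
  apply: measurable_funM; first exact: mv.
  by apply: ms; exact: service_cycle_ge1.
apply: measurable_funM; first exact: mu.
apply: (@measurable_at_max _ _ _ (fun k o => (l (x k o).2)^-1)
  (fun k o => (offset D k <= m)%N &&
    (service_start (c o) (offset D k) < arrival (c o m)))) => //.
move=> k _; case: (leqP (offset D k) m) => km /=; last exact: measurable_cst.
apply: measurable_fun_ltr; last by case: (IH m).
by apply: measurable_funD; case: (IH _ km).
Qed.

Lemma path_measurable m : (m <= N)%N ->
  [/\ measurable_fun setT (fun o => arrival (c o m)),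
      measurable_fun setT (fun o => wait (c o m)) &
      measurable_fun setT (fun o => busy (c o m))].
Proof.
elim/ltn_ind: m => -[_ _|m IH mN].
  by split; exact: measurable_cst.
have IH' i : (i <= m)%N -> measurable_fun setT (fun o => arrival (c o i)) /\
     measurable_fun setT (fun o => wait (c o i)).
  by move=> im; case: (IH i) => //; exact: leq_trans (leqW im) mN.
have [mg msv] := gap_svc_measurable mN IH'.
have [mA mW mX] := IH m (ltnSn m) (ltnW mN).
have mW1 : measurable_fun setT (fun o => wait (c o m.+1)).
  under eq_fun do rewrite WS.
  apply: measurable_maxr => //.
  by apply: measurable_funB => //; exact: measurable_funD.
split => //.
  by under eq_fun do rewrite AS; exact: measurable_funD.
under eq_fun do rewrite XS.
apply: measurable_fun_ifT => //.
  exact: measurable_fun_ltr.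
exact: measurable_funD.
Qed.

End path_measurable.

Section queue_measurable.
Context {R : realType} {d : measure_display} {T : measurableType d}.
Variables (l : R -> R) (D : nat -> nat) (x : nat -> T -> R * R) (u v : nat -> T -> R).
Hypothesis mr : forall k, (1 <= k)%N -> measurable_fun setT (fun o => (l (x k o).2)^-1).
Hypothesis ms : forall k, (1 <= k)%N -> measurable_fun setT (fun o => (x k o).1^-1).
Hypothesis lx0 : forall k o, (1 <= k)%N -> 0 < l (x k o).2.
Hypothesis u0 : forall m o, 0 <= u m o.
Hypothesis mu : forall m, measurable_fun setT (u m).
Hypothesis mv : forall m, measurable_fun setT (v m).
Local Notation c o := (customer_at l D (x ^~ o) (u ^~ o) (v ^~ o)).

(** The second alternative is the default count 0 of an infinite queue; both alternatives are
    countable conditions on the path. *)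
Lemma cycle_queue_leE k i o : (2 <= k)%N ->
  (cycle_queue l D (x ^~ o) (u ^~ o) (v ^~ o) k <= i)%N <->
  (service_start (c o) (offset D k) < arrival (c o (offset D k + i)) \/
   forall m, arrival (c o m) <= service_start (c o) (offset D k)).
Proof.
move=> k2.
have [[m hm]|hall] := pselect (exists m, service_start (c o) (offset D k) < arrival (c o m)).
  have F := @cycle_queue_finite _ l D (x ^~ o) (u ^~ o) (v ^~ o)
    (fun k => lx0 o (k := k)) (fun m => u0 m o) k m k2 hm i.
  rewrite leqNgt F -ltNge; split; first by left.
  by case=> // h; move: (h m); rewrite leNgt hm.
have h m : arrival (c o m) <= service_start (c o) (offset D k).
  by rewrite leNgt; apply/negP => hm; apply: hall; exists m.
split=> [_|_]; first by right.
by rewrite (@cycle_queue_infinite _ l D (x ^~ o) (u ^~ o) (v ^~ o) k k2 h).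
Qed.

Lemma cycle_queue_measurable k :
  measurable_fun setT (fun o => cycle_queue l D (x ^~ o) (u ^~ o) (v ^~ o) k).
Proof.
case: (leqP k 1) => k2.
  by rewrite /cycle_queue k2; exact: measurable_cst.
have mp m : [/\ measurable_fun setT (fun o => arrival (c o m)),
      measurable_fun setT (fun o => wait (c o m)) &
      measurable_fun setT (fun o => busy (c o m))].
  exact: (@path_measurable _ _ _ l D x u v mr ms m (fun i _ => mu i) (fun i _ => mv i) m (leqnn m)).
have mB m : measurable_fun setT (fun o => service_start (c o) m).
  by case: (mp m) => *; exact: measurable_funD.
have mA m : measurable_fun setT (fun o => arrival (c o m)) by case: (mp m).
apply: measurable_nat_le => i.
rewrite (_ : [set o | _] =
  [set o | service_start (c o) (offset D k) < arrival (c o (offset D k + i))] `|`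
  \bigcap_m [set o | arrival (c o m) <= service_start (c o) (offset D k)]).
  apply: measurableU; first exact: measurable_set_lt.
  by apply: bigcap_measurableType => m _; exact: measurable_set_le.
apply/seteqP; split=> o /=.
  by move=> /(cycle_queue_leE i o k2)h; case: h => h; [left; exact: h|right=> m _; exact: h].
move=> h; apply/(cycle_queue_leE i o k2).
by case: h => [?|h]; [left|right => m; exact: h].
Qed.

End queue_measurable.

(** * Bounds and measurability on the policy box *)

Section model_facts.
Context {R : realType}.
Variable (q : queue_model R).
Hypothesis hq : model_ok q.
Hypothesis hmono : {in `[p_lo q, p_hi q] &, {homo lam q : r s /~ r <= s}}.

Lemma box_mu_gt0 z : box q z -> 0 < z.1.
Proof. by case: hq => /andP[m0 _] _ _ _ [h _ _ _]; exact: lt_le_trans h. Qed.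

Lemma box_price z : box q z -> z.2 \in `[p_lo q, p_hi q].
Proof. by case=> _ _ h1 h2; rewrite in_itv/= h1. Qed.

Lemma box_lam_gt0 z : box q z -> 0 < lam q z.2.
Proof. by move=> /box_price h; case: hq => _ _ _; exact. Qed.

Lemma box_lo : box q (mu_lo q, p_lo q).
Proof. by case: hq => /andP[_ /ltW m0] /andP[_ /ltW p0] _ _; split=> /=. Qed.

Lemma box_lam_le z : box q z -> lam q z.2 <= lam q (p_lo q).
Proof.
move=> bz; have h1 := box_price bz; have /= h2 := box_price box_lo.
by apply: hmono => //; case: bz.
Qed.

Lemma p_hi_itv : p_hi q \in `[p_lo q, p_hi q].
Proof. by case: hq => _ /andP[_ /ltW p0] _ _; rewrite in_itv/= p0 lexx. Qed.

Lemma box_lam_ge z : box q z -> lam q (p_hi q) <= lam q z.2.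
Proof.
by move=> bz; have h := box_price bz; apply: hmono => //; [exact: p_hi_itv|case: bz].
Qed.

Context {d : measure_display} {T : measurableType d}.

(** [lam q] is controlled on the price interval only. Composing it with the projection onto that
    interval gives a monotone, hence measurable, function on the line which agrees with it along
    [X]. *)
Lemma box_lam_measurable (X : T -> R * R) : measurable_fun setT X ->
  (forall o, box q (X o)) -> measurable_fun setT (fun o => lam q (X o).2).
Proof.
move=> mX bX.
pose clamp p := Num.max (p_lo q) (Num.min p (p_hi q)).
have lohi : p_lo q <= p_hi q by case: hq => _ /andP[_ /ltW].
have clampP p : clamp p \in `[p_lo q, p_hi q].
  by rewrite in_itv/= /clamp le_max lexx ge_max lohi ge_min lexx orbT.
rewrite (_ : (fun o => _) = (lam q \o clamp) \o (fun o => (X o).2)).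
  apply: measurableT_comp; last exact: measurableT_comp.
  apply: nonincreasing_measurable => // r s rs /=; apply: hmono => //.
  by rewrite /clamp ge_max !le_max lexx /= le_min !ge_min rs lexx !orbT.
apply/funext => o /=; congr (lam q _); case: (bX o) => _ _ h1 h2.
by rewrite /clamp (min_idPl h2) (max_idPr h1).
Qed.

Lemma box_lamV_measurable (X : T -> R * R) : measurable_fun setT X ->
  (forall o, box q (X o)) -> measurable_fun setT (fun o => (lam q (X o).2)^-1).
Proof.
move=> mX bX; apply: measurable_fun_invr; first exact: box_lam_measurable.
by move=> o; rewrite ltW// box_lam_gt0.
Qed.

Lemma box_muV_measurable (X : T -> R * R) : measurable_fun setT X ->
  (forall o, box q (X o)) -> measurable_fun setT (fun o => (X o).1^-1).
Proof.
move=> mX bX; apply: measurable_fun_invr; first exact: measurableT_comp.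
by move=> o; rewrite ltW// box_mu_gt0.
Qed.

End model_facts.

(** * Measurability of admissible policies *)

Section policy_info.
Context {R : realType} {d : measure_display} {Om : measurableType d}.
Variables (P : probability Om R) (U V : nat -> {RV P >-> R}) (q : queue_model R).
Hypothesis hUV : primitives_ok U V.
Hypothesis hq : model_ok q.
Hypothesis hmono : {in `[p_lo q, p_hi q] &, {homo lam q : r s /~ r <= s}}.
Variables (D : nat -> nat) (x : nat -> Om -> R * R).
Hypothesis hx : policy_ok U V q D x.
Local Notation c o := (customer_at (lam q) D (x ^~ o) (U ^~ o) (V ^~ o)).
Local Notation QQ := (QQ U V q D x).
Local Notation history := (history U V q D x).

Lemma policy_D1 k : (1 <= k)%N -> (1 <= D k)%N.
Proof. by case/hx. Qed.
Lemma policy_box k o : (1 <= k)%N -> box q (x k o).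
Proof. by case/hx. Qed.
Lemma policy_hist k : (1 <= k)%N -> history_measurable U V q D x k (x k).
Proof. by case/hx. Qed.
Lemma policy_l0 o k : (1 <= k)%N -> 0 < lam q (x k o).2.
Proof. by move=> k1; exact/box_lam_gt0/policy_box. Qed.
Lemma policy_m0 o k : (1 <= k)%N -> 0 < (x k o).1.
Proof. by move=> k1; exact/box_mu_gt0/policy_box. Qed.
Lemma U_ge0 m o : 0 <= U m o. Proof. by case: hUV => _ _ _ /(_ m o)[]. Qed.
Lemma V_ge0 m o : 0 <= V m o. Proof. by case: hUV => _ _ _ /(_ m o)[]. Qed.

Definition lo_policy : R * R := (mu_lo q, p_lo q).
(** Only cycles before [k] and outcomes in [E] keep the given policy; a constant fills the rest. On
    [E] the queue at the start of cycle [k] is unchanged by causality, while measurability is needed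
    only for what has been kept. *)
Definition cut_policy k (E : set Om) (j : nat) (o : Om) : R * R :=
  if (1 <= j < k)%N && (o \in E) then x j o else lo_policy.

Lemma cut_policy_box k E j o : box q (cut_policy k E j o).
Proof.
rewrite /cut_policy; case: ifP => [/andP[/andP[j1 _] _]|_]; first exact: policy_box.
exact: box_lo.
Qed.
Lemma cut_l0 k E o j : 0 < lam q (cut_policy k E j o).2.
Proof. exact/box_lam_gt0/cut_policy_box. Qed.
Lemma cut_m0 k E o j : 0 < (cut_policy k E j o).1.
Proof. exact/box_mu_gt0/cut_policy_box. Qed.

Lemma cut_policyE k (E : set Om) o j : E o -> (1 <= j < k)%N -> x j o = cut_policy k E j o.
Proof. by move=> Eo jk; rewrite /cut_policy jk mem_set. Qed.

Lemma QQ_cut k (E : set Om) o : E o -> QQ k o =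
  cycle_queue (lam q) D ((cut_policy k E) ^~ o) (U ^~ o) (V ^~ o) k.
Proof.
move=> Eo; apply: cycle_queue_causal => //.
- exact: policy_D1.
- exact: policy_D1.
- by move=> j j1; exact: policy_l0.
- by move=> j j1; exact: policy_m0.
- by move=> j j1; exact: cut_l0.
- by move=> j j1; exact: cut_m0.
- by move=> m; exact: U_ge0.
- by move=> m; exact: V_ge0.
- by move=> m; exact: V_ge0.
- by move=> j jk; exact: cut_policyE.
Qed.

Lemma sigma_of_sub (S : set (Om -> R)) (G : set (set Om)) : sigma_algebra setT G ->
  (forall Z, S Z -> forall B, measurable B -> G (Z @^-1` B)) -> sigma_of S `<=` G.
Proof.
move=> sG h; apply: smallest_sub => //.
by move=> _ [Z SZ [B mB <-]]; rewrite setTI; exact: h.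
Qed.

Lemma cut_policy_measurable k j : (forall i, (1 <= i < k)%N -> measurable_fun setT (x i)) ->
  measurable_fun setT (cut_policy k setT j).
Proof.
move=> h; rewrite /cut_policy; case: (boolP (1 <= j < k)%N) => jk /=; last exact: measurable_cst.
by under eq_fun do rewrite in_setT; exact: h.
Qed.

Lemma history_sub k A : measurable_fun setT (QQ k) -> history k A -> measurable A.
Proof.
move=> mQ; suff : history k `<=` measurable by exact.
apply: sigma_of_sub; first exact: sigma_algebra_measurable.
move=> Z [[m _ [->|->]]|->|[n ->]] B mB; rewrite -[X in measurable X]setTI.
- exact: measurable_funP.
- exact: measurable_funP.
- by apply: measurable_fun_natr.
- apply: measurable_funM => //.
  apply: (measurable_fun_natr (f := fun o => (n.+1 < QQ k o)%N : nat)) => //.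
  by apply: (measurableT_comp (f := fun m : nat => (n.+1 < m)%N : nat)).
Qed.

(** The history of cycle [k] contains [QQ k], whose definition mentions the whole policy sequence.
    Cutting the policy at [k] leaves only earlier policies in it, and strong induction resolves the
    circularity. *)
Lemma policy_measurable k : (1 <= k)%N -> measurable_fun setT (x k).
Proof.
elim/ltn_ind: k => k IH k1.
have mc j : measurable_fun setT (cut_policy k setT j).
  by apply: cut_policy_measurable => i /andP[i1 ik]; exact: IH.
have mQ : measurable_fun setT (QQ k).
  rewrite (_ : QQ k = fun o => cycle_queue (lam q) D ((cut_policy k setT) ^~ o) (U ^~ o) (V ^~ o) k).
    apply: cycle_queue_measurable => //.
    - by move=> j _; apply: (box_lamV_measurable hq hmono) => // o; exact: cut_policy_box.
    - by move=> j _; apply: (box_muV_measurable hq) => // o; exact: cut_policy_box.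
    - by move=> j o _; exact: cut_l0.
    - by move=> m o; exact: U_ge0.
  by apply/funext => o; exact: QQ_cut.
move=> _ A mA; rewrite setTI.
exact: history_sub mQ (policy_hist k1 mA).
Qed.

Lemma QQ_measurable k : measurable_fun setT (QQ k).
Proof.
apply: cycle_queue_measurable => //.
- move=> j j1; apply: (box_lamV_measurable hq hmono); first exact: policy_measurable.
  by move=> o; exact: policy_box.
- move=> j j1; apply: (box_muV_measurable hq); first exact: policy_measurable.
  by move=> o; exact: policy_box.
- by move=> j o; exact: policy_l0.
- by move=> m o; exact: U_ge0.
Qed.

Lemma customer_measurable m :
  [/\ measurable_fun setT (fun o => arrival (c o m)),
      measurable_fun setT (fun o => wait (c o m)) &
      measurable_fun setT (fun o => busy (c o m))].
Proof.
apply: (@path_measurable _ _ _ (lam q) D x (fun m => U m : Om -> R) (fun m => V m : Om -> R) _ _ m) => //.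
- move=> j j1; apply: (box_lamV_measurable hq hmono); first exact: policy_measurable.
  by move=> o; exact: policy_box.
- move=> j j1; apply: (box_muV_measurable hq); first exact: policy_measurable.
  by move=> o; exact: policy_box.
Qed.

(** * Almost sure divergence of the arrival times *)

Section divergence.
Variables (th b : R).
Hypothesis th0 : 0 < th.
Hypothesis b1 : b < 1.
Hypothesis Ub : (\int[P]_o (expR (- th * U 0%N o))%:E <= b%:E)%E.

Definition stuck : set Om := [set o | ~ divergent (U ^~ o)].

Let S n o := \sum_(0 <= j < n) U j o.
Let mS n : measurable_fun setT (S n).
Proof. by rewrite /S; under eq_fun do rewrite big_mkord; apply: measurable_sum. Qed.

Lemma stuckE : stuck = \bigcup_(K : nat) \bigcap_n [set o | S n o <= K%:R].
Proof.
apply/seteqP; split=> o /=.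
  move=> /existsNP[K /forallNP hK].
  exists (Num.truncn `|K|).+1 => // n _ /=.
  have := hK n; move/negP; rewrite -leNgt => /le_trans; apply.
  by rewrite (le_trans (ler_norm _))// ltW// truncnS_gt.
move=> [K _ hK] /(_ K%:R)[n]; rewrite ltNge => /negP; apply.
exact: hK.
Qed.

Lemma stuck_measurable : measurable stuck.
Proof.
rewrite stuckE; apply: bigcup_measurable => K _; apply: bigcap_measurableType => n _.
by apply: measurable_set_le => //; exact: measurable_cst.
Qed.

Lemma laplace_sum n : (\int[P]_o (expR (- th * S n o))%:E <= (b ^+ n)%:E)%E.
Proof.
elim: n => [|n IH].
  under eq_integral do rewrite /S big_geq// mulr0 expR0.
  by rewrite integral_cst//= probability_setT mule1.
pose Y o := expR (- th * S n o).
(* The absolute value makes [f] nonnegative on the whole plane, as [freezeU] demands; along [Y] it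
   changes nothing. *)
pose f (z : R * R) : \bar R := (`|z.1| * expR (- th * z.2))%:E.
have mf : measurable_fun setT f.
  apply/measurable_EFinP; apply: measurable_funM.
    by apply: measurableT_comp => //; exact: measurable_fst.
  apply: measurableT_comp => //; apply: measurable_funM => //; exact: measurable_snd.
have iY : info_fun U V `I_n set0 Y.
  apply/info_fun_gP; apply: measurableT_comp => //; apply: measurable_funM => //.
  have -> : S n = (fun o => \sum_(j < n) U j o) by apply/funext => o; rewrite /S big_mkord.
  apply: measurable_sum => i.
  by apply/info_fun_gP => B mB; apply: infoU => /=.
have nn : ~ `I_n n by rewrite /= ltnn.
have f0 z : (0 <= f z)%E by rewrite lee_fin mulr_ge0 ?expR_ge0.
have E := freezeU hUV nn iY mf f0.
rewrite (_ : \int[P]_o _ = \int[P]_o f (Y o, U n o))%E; last first.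
  apply: eq_integral => o _; rewrite /f /Y /= ger0_norm ?expR_ge0// -expRD.
  by rewrite /S big_nat_recr//= mulrDr.
rewrite E.
have -> : (\int[P]_o \int[P]_o' f (Y o, U 0%N o') =
   \int[P]_o ((Y o)%:E * \int[P]_o' (expR (- th * U 0%N o'))%:E))%E.
  apply: eq_integral => o _; rewrite -ge0_integralZl//.
  - apply: eq_integral => o' _.
    by rewrite /f/= ger0_norm ?expR_ge0// EFinM.
  - apply/measurable_EFinP; apply: measurableT_comp => //; exact: measurable_funM.
  - by rewrite lee_fin expR_ge0.
have mY : measurable_fun setT (fun o => (Y o)%:E).
  by apply/measurable_EFinP; apply: measurableT_comp => //; exact: measurable_funM.
rewrite ge0_integralZr//; last 2 first.
  by move=> o _; rewrite lee_fin expR_ge0.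
  by apply: integral_ge0 => o _; rewrite lee_fin expR_ge0.
rewrite exprSr EFinM lee_pmul//.
  by apply: integral_ge0 => o _; rewrite lee_fin expR_ge0.
by apply: integral_ge0 => o _; rewrite lee_fin expR_ge0.
Qed.

(** Chernoff bound: the first [n] interarrival times sum to at most [K] with probability at most
    exp(th K) b^n, which tends to 0. The bad event is a countable union over [K]. *)
Lemma stuck_null : P stuck = 0%E.
Proof.
have b0 : 0 <= b.
  rewrite -lee_fin; apply: le_trans Ub.
  by apply: integral_ge0 => o _; rewrite lee_fin expR_ge0.
suff: P.-negligible stuck by move/measure_negligible; apply; exact: stuck_measurable.
rewrite stuckE; apply: negligible_bigcup => K;
have mB : measurable (\bigcap_n [set o | S n o <= K%:R]).
  apply: bigcap_measurableType => n _.
  by apply: measurable_set_le => //; exact: measurable_cst.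
exists (\bigcap_n [set o | S n o <= K%:R]); split=> //.
set B := \bigcap_n _ in mB *.
have PB n : fine (P B) <= expR (th * K%:R) * b ^+ n.
  rewrite -lee_fin fineK ?fin_num_measure//.
  apply: (@le_trans _ _ (\int[P]_o ((expR (th * K%:R))%:E * (expR (- th * S n o))%:E))%E).
    rewrite -(setIT B) -integral_indic//.
    apply: ge0_le_integral => //.
    - by apply/measurable_EFinP; exact: measurable_indic.
    - apply/measurable_EFinP; apply: measurable_funM => //.
      by apply: measurableT_comp => //; exact: measurable_funM.
    move=> o _; rewrite -EFinM lee_fin indicE; case: (boolP (o \in B)) => oB /=; last first.
      by rewrite mulr_ge0 ?expR_ge0.
    rewrite -expRD -[leLHS]expR0 ler_expR.
    have /= : S n o <= K%:R by move/set_mem: oB; exact.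
    by rewrite -(ler_pM2l th0); lra.
  rewrite ge0_integralZl_EFin ?expR_ge0//.
  - by rewrite EFinM lee_pmul2l ?lte_fin ?expR_gt0// laplace_sum.
  - by apply/measurable_EFinP; apply: measurableT_comp => //; exact: measurable_funM.
have cv : (fun n => expR (th * K%:R) * b ^+ n) @ \oo --> (0 : R).
  rewrite -[X in _ --> X](mulr0 (expR (th * K%:R))); apply: cvgMr.
  by apply: cvg_expr; rewrite ger0_norm.
have : fine (P B) <= 0 by rewrite -(cvg_lim _ cv)//; apply: limr_ge; [exact: cvgP cv|exact: nearW].
rewrite -lee_fin fineK ?fin_num_measure// => h.
by apply/eqP; rewrite eq_le h measure_ge0.
Qed.

End divergence.
End policy_info.

(** * Which primitives the history of a cycle involves *)

Section history_info.
Context {R : realType} {d : measure_display} {Om : measurableType d}.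
Variables (P : probability Om R) (U V : nat -> {RV P >-> R}) (q : queue_model R).
Hypothesis hUV : primitives_ok U V.
Hypothesis hq : model_ok q.
Hypothesis hmono : {in `[p_lo q, p_hi q] &, {homo lam q : r s /~ r <= s}}.
Hypothesis stuck0 : P (stuck U) = 0%E.
Variables (D : nat -> nat) (x : nat -> Om -> R * R).
Hypothesis hx : policy_ok U V q D x.
Local Notation c o := (customer_at (lam q) D (x ^~ o) (U ^~ o) (V ^~ o)).
Local Notation QQ := (QQ U V q D x).
Local Notation history := (history U V q D x).
Local Notation cut := (cut_policy q x).
Let D1 := policy_D1 hx.
Let l0 o := policy_l0 hq hx o.
Let m0 o := policy_m0 hq hx o.
Let u0 o m := U_ge0 hUV m o.
Let v0 o m := V_ge0 hUV m o.

Lemma divergent_arrival o : divergent (U ^~ o) -> forall K, exists m, K < arrival (c o m).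
Proof.
move=> h; apply: (divergent_A D (V ^~ o) (fun k => l0 o (k := k)) (u0 o)) => //.
exists (lam q (p_lo q)) => k k1; apply: (box_lam_le hq hmono).
exact: (policy_box hx o k1).
Qed.

Lemma QQ_lt o k i : divergent (U ^~ o) -> (2 <= k)%N ->
  (i < QQ k o)%N = (arrival (c o (offset D k + i)) <= service_start (c o) (offset D k)).
Proof.
move=> h k2; have [m hm] := divergent_arrival h (service_start (c o) (offset D k)).
exact: (cycle_queue_finite (fun k => l0 o (k := k)) (u0 o) k2 hm).
Qed.

Lemma QQ1 o k : (k <= 1)%N -> QQ k o = 0%N.
Proof. by move=> k1; rewrite /Defs.QQ /cycle_queue k1. Qed.

(** [offset D j + QQ j o] is, for [j >= 2], the first customer to arrive after the start of cycle
    [j], and cycle starts are nondecreasing. *)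
Lemma QQ_mono o j k : divergent (U ^~ o) -> (1 <= j <= k)%N ->
  (offset D j + QQ j o <= offset D k + QQ k o)%N.
Proof.
move=> h /andP[j1]; rewrite leq_eqVlt => /predU1P[->//|jk].
have [j2|j2] := leqP j 1.
  by rewrite QQ1// addn0 (leq_trans (offset_mono D (ltnW jk)))// leq_addr.
rewrite -leq_subRL; last by rewrite (leq_trans (offset_mono D (ltnW jk)))// leq_addr.
rewrite leqNgt QQ_lt// subnKC; last by rewrite (leq_trans (offset_mono D (ltnW jk)))// leq_addr.
rewrite -ltNge (@le_lt_trans _ _ (service_start (c o) (offset D k)))//.
  apply: (B_mono (lam q) D (U ^~ o) (fun k => m0 o (k := k)) (v0 o)).
  exact: offset_mono (ltnW jk).
by rewrite ltNge -QQ_lt ?ltnn// (leq_trans j2 (ltnW jk)).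
Qed.

(* The event that the information collected before cycle k does not involve the
   interarrival times with index at least a. *)
Definition early k a : set Om :=
  [set o | divergent (U ^~ o) /\ (offset D k + QQ k o <= a)%N].

Lemma early_sub j k a : (1 <= j <= k)%N -> early k a `<=` early j a.
Proof. by move=> jk o [h hk]; split=> //; apply: leq_trans hk; exact: QQ_mono. Qed.

Lemma divergent_info S1 S2 : info U V S1 S2 [set o | divergent (U ^~ o)].
Proof.
have -> : [set o | divergent (U ^~ o)] = setT `\` stuck U.
  by apply/seteqP; split=> o /=; [move=> ?; split=> // /(_ _)|case=> _ /contrapT].
have [_ hC _] := info_sigma U V S1 S2; apply: hC; apply: info_null => //.
exact: stuck_measurable.
Qed.

Section info_space.
Variables (S1 S2 : set nat).
Local Notation G := (info U V S1 S2).
Local Notation TG := (g_sigma_algebraType G).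

Lemma infoE (A : set TG) : measurable A <-> G A.
Proof. by rewrite /measurable/= sigma_algebra_id//; exact: info_sigma. Qed.

Lemma infoI A B : G A -> G B -> G (A `&` B).
Proof. by move=> /infoE a /infoE b; apply/infoE; exact: measurableI. Qed.
Lemma infoD A B : G A -> G B -> G (A `\` B).
Proof. by move=> /infoE a /infoE b; apply/infoE; exact: measurableD. Qed.
Lemma infoUn A B : G A -> G B -> G (A `|` B).
Proof. by move=> /infoE a /infoE b; apply/infoE; exact: measurableU. Qed.
Lemma info_bigcup (F : nat -> set Om) : (forall n, G (F n)) -> G (\bigcup_n F n).
Proof. by move=> h; have [_ _] := info_sigma U V S1 S2; exact. Qed.
Lemma infoT : G setT.
Proof. by apply/infoE; exact: measurableT. Qed.
Lemma info0 : G set0.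
Proof. by apply/infoE; exact: measurable0. Qed.

Lemma cut_info k (E : set Om) : G E ->
  (forall j A, (1 <= j < k)%N -> measurable A -> G ((x j @^-1` A) `&` E)) ->
  forall j, measurable_fun setT (cut k E j : TG -> R * R).
Proof.
move=> GE h j _ A mA; rewrite setTI; apply/infoE.
case: (boolP (1 <= j < k)%N) => jk; last first.
  rewrite /cut_policy (negbTE jk) /=.
  have [i|i] := pselect (A (lo_policy q)).
    by rewrite (_ : _ @^-1` _ = setT); [exact: infoT|apply/seteqP; split=> o].
  by rewrite (_ : _ @^-1` _ = set0); [exact: info0|apply/seteqP; split=> o].
have -> : cut k E j @^-1` A =
   ((x j @^-1` A) `&` E) `|` ((if lo_policy q \in A then setT else set0) `\` E).
  apply/seteqP; split=> o /=; rewrite /cut_policy jk /=.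
    case: (boolP (o \in E)) => [/set_mem Eo Ao|nE Ao]; first by left.
    right; split; last by move=> /mem_set; rewrite (negbTE nE).
    by rewrite mem_set.
  move=> [[Ao Eo]|[Ao Eo]]; first by rewrite mem_set.
  have -> : (o \in E) = false by apply/negP => /set_mem.
  by move: Ao; case: ifP => // /set_mem.
apply: infoUn; first exact: h.
by apply: infoD => //; case: ifP => _; [exact: infoT|exact: info0].
Qed.

Lemma cut_path_info k N (E : set Om) vh : G E ->
  (forall j A, (1 <= j < k)%N -> measurable A -> G ((x j @^-1` A) `&` E)) ->
  (forall j, (j < N)%N -> S1 j) ->
  (forall m, (m < N)%N -> measurable_fun setT (vh m : TG -> R)) ->
  forall m, (m <= N)%N ->
  measurable_fun setT ((fun o => arrival (customer_at (lam q) D ((cut k E) ^~ o) (U ^~ o) (vh ^~ o) m)) : TG -> R) /\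
  measurable_fun setT ((fun o => wait (customer_at (lam q) D ((cut k E) ^~ o) (U ^~ o) (vh ^~ o) m)) : TG -> R).
Proof.
move=> GE h hS mvh m mN.
have mc := cut_info GE h.
have bc j o : box q (cut k E j o) by exact: (cut_policy_box hq hx).
have [//|//|i iN|h1 h2 _] := @path_measurable _ _ TG (lam q) D (cut k E)
   (fun m => U m : Om -> R) vh _ _ N _ mvh m mN; last by split.
- by move=> j _; exact: (box_lamV_measurable hq hmono).
- by move=> j _; exact: (box_muV_measurable hq).
- by apply/info_fun_gP => B mB; apply: infoU => //; exact: hS.
Qed.

End info_space.

(** Strong induction on [k], since membership in [early k a] depends on the earlier policies, which
    are known only on earlier events of this kind. On [early k.-1 b] the cut policies are known, so
    the path up to customer [b] is a function of the allowed primitives. The history is then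
    examined separately on each event that fixes [QQ k]. *)
Lemma early_history k : (1 <= k)%N -> forall S1 S2 a,
  (offset D k <= a)%N -> (forall j, (j < a)%N -> S1 j) ->
  (forall j, (j < offset D k)%N -> S2 j) ->
  info U V S1 S2 (early k a) /\
  forall A, history k A -> info U V S1 S2 (A `&` early k a).
Proof.
elim/ltn_ind: k => k IH k1 S1 S2 a ka hS1 hS2.
have first b : (offset D k <= b)%N -> (b <= a)%N -> info U V S1 S2 (early k b).
  move=> kb ba; have hS1' j : (j < b)%N -> S1 j by move=> jb; apply: hS1; exact: leq_trans ba.
  have [k2|k2] := leqP k 1.
    have -> : early k b = [set o | divergent (U ^~ o)].
      by apply/seteqP; split=> o /=; [case|move=> h; split=> //; rewrite QQ1// addn0].
    exact: divergent_info.
  have okk j : (j <= k)%N -> (offset D j <= b)%N.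
    by move=> jk; apply: leq_trans kb; exact: offset_mono.
  have k11 : (1 <= k.-1)%N by rewrite -ltnS prednK.
  have kk : (k.-1 < k)%N by rewrite prednK.
  pose E := early k.-1 b.
  have GE : info U V S1 S2 E.
    have [] // := IH _ kk k11 S1 S2 b (okk _ (ltnW kk)) hS1' _.
    by move=> j jo; apply: hS2; apply: (leq_trans jo); apply: offset_mono; exact: ltnW.
  have GA j A : (1 <= j < k)%N -> measurable A -> info U V S1 S2 ((x j @^-1` A) `&` E).
    move=> /andP[j1 jk] mA.
    have hS2' i : (i < offset D j)%N -> S2 i.
      by move=> io; apply: hS2; apply: (leq_trans io); apply: offset_mono; exact: ltnW.
    have [_ h] := IH _ jk j1 S1 S2 b (okk _ (ltnW jk)) hS1' hS2'.
    have sE : E `<=` early j b by apply: early_sub; rewrite j1 -ltnS prednK.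
    have -> : (x j @^-1` A) `&` E = ((x j @^-1` A) `&` early j b) `&` E.
      by rewrite -setIA (setIidr sE).
    by apply: infoI => //; apply: h; exact: (policy_hist hx j1 mA).
  (* Services from cycle [k] on are outside [S2] and are set to 0. By [arrival_phase] this does not
     affect whether customer [b] arrives after the start of cycle [k]. *)
  pose vh m o := if (m < offset D k)%N then V m o else 0.
  have mvh m : (m < b)%N -> measurable_fun setT (vh m : g_sigma_algebraType (info U V S1 S2) -> R).
    move=> _; rewrite /vh; case: (ltnP m (offset D k)) => mo; last exact: measurable_cst.
    by apply/info_fun_gP => B mB; apply: infoV => //; exact: hS2.
  have [mA _] := cut_path_info GE GA hS1' mvh (leqnn b).
  have [mA' mW'] := cut_path_info GE GA hS1' mvh kb.
  pose ch o := customer_at (lam q) D ((cut k E) ^~ o) (U ^~ o) (vh ^~ o).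
  have -> : early k b = E `&`
      [set o | service_start (ch o) (offset D k) < arrival (ch o b)].
    have key o : E o -> (offset D k + QQ k o <= b)%N =
        (service_start (ch o) (offset D k) < arrival (ch o b)).
      move=> Eo; have [hd _] := Eo.
      have xx i : (1 <= i < k)%N -> x i o = cut k E i o by exact: cut_policyE.
      have vv m : (m < offset D k)%N -> V m o = vh m o by rewrite /vh => ->.
      have vh0 m : 0 <= vh m o by rewrite /vh; case: ifP => // _; exact: v0.
      have Pa := @arrival_phase _ (lam q) D D (x ^~ o) ((cut k E) ^~ o) (U ^~ o)
        (V ^~ o) (vh ^~ o) (fun i => l0 o (k := i)) (fun i => m0 o (k := i))
        (fun i _ => cut_l0 hq hx k E o i) (fun i _ => cut_m0 hq hx k E o i)
        (u0 o) (v0 o) vh0 k (offset D k) k1 xx (fun _ _ => erefl) (leqnn _) (leqnn _) vv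
        k2 b kb.
      have Ca := @customer_at_causal _ (lam q) D D (x ^~ o) ((cut k E) ^~ o) (U ^~ o)
        (V ^~ o) (vh ^~ o) k (offset D k) k1 xx (fun _ _ => erefl) (leqnn _) (leqnn _) vv
        (offset D k) (leqnn _).
      rewrite -leq_subRL// leqNgt QQ_lt// subnKC// -ltNge.
      have -> : service_start (ch o) (offset D k) = service_start (c o) (offset D k).
        by rewrite /service_start /ch -Ca.
      case: Pa => [[<-//]|[-> h2]].
      by rewrite /ch h2.
    apply/seteqP; split=> o.
      move=> Ek; have Eo : E o by apply: early_sub Ek; rewrite k11 leq_pred.
      by split=> //=; rewrite -key//; case: Ek.
    by move=> [Eo /= h]; split; [case: Eo|rewrite key].
  apply: infoI => //; apply/infoE; apply: measurable_set_lt => //.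
  exact: measurable_funD.
split; first exact: first.
(* The events fixing the queue length are differences of two consecutive [early] events, which is
   why [first] was proved for every [b] up to [a]. *)
pose Qset i : set Om := [set o | divergent (U ^~ o) /\ QQ k o = i].
have GQ i : (offset D k + i <= a)%N -> info U V S1 S2 (Qset i).
  move=> ia; case: i ia => [|i] ia.
    have -> : Qset 0%N = early k (offset D k).
      apply/seteqP; split=> o /=; first by move=> [h Q0]; split=> //; rewrite Q0 addn0.
      by move=> [h]; rewrite -[leqRHS]addn0 leq_add2l leqn0 => /eqP.
    by apply: first => //; rewrite addn0 in ia.
  have -> : Qset i.+1 = early k (offset D k + i.+1) `\` early k (offset D k + i).
    apply/seteqP; split=> o.
      move=> [h Qi]; rewrite /early/= !leq_add2l Qi leqnn; split=> // -[_].
      by rewrite ltnn.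
    move=> [[h]]; rewrite leq_add2l => h1 h2; split=> //.
    apply/eqP; rewrite eqn_leq h1 /= ltnNge; apply/negP => h3; apply: h2; split=> //.
    by rewrite leq_add2l.
  by apply: infoD; apply: first; rewrite ?leq_addr//; apply: leq_trans ia; rewrite leq_add2l.
have red A : (forall i, (offset D k + i <= a)%N -> info U V S1 S2 (A `&` Qset i)) ->
    info U V S1 S2 (A `&` early k a).
  move=> h.
  have -> : A `&` early k a =
     \bigcup_i (if (offset D k + i <= a)%N then A `&` Qset i else set0).
    apply/seteqP; split=> o.
      by move=> [Ao [h1 h2]]; exists (QQ k o) => //; rewrite h2.
    move=> [i _]; case: ifP => // hi [Ao [h1 h2]]; split=> //; split=> //.
    by rewrite h2.
  apply: info_bigcup => i; case: ifP => hi; [exact: h|exact: info0].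
suff sub : history k `<=` [set A | info U V S1 S2 (A `&` early k a)] by exact: sub.
apply: sigma_of_sub.
  split=> /=.
  - by rewrite set0I; exact: info0.
  - move=> A hA; have -> : (setT `\` A) `&` early k a = early k a `\` (A `&` early k a).
      apply/seteqP; split=> o; first by move=> [[_ nA] Eo]; split=> // -[].
      by move=> [Eo nA]; split=> //; split=> // Ao; apply: nA.
    by apply: infoD => //; exact: first.
  - by move=> F hF; rewrite setI_bigcupl; exact: info_bigcup.
have const B (r : R) A : A = (if r \in B then setT else set0) ->
    info U V S1 S2 A.
  by move=> ->; case: ifP => _; [exact: infoT|exact: info0].
move=> Z [[m mo [->|->]]|->|[n ->]] B mB.
- apply: infoI; last exact: first.
  by apply: infoU => //; apply: hS1; exact: leq_trans ka.
- apply: infoI; last exact: first.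
  by apply: infoV => //; exact: hS2.
- apply: red => i ia.
  have -> : (fun o => (QQ k o)%:R) @^-1` B `&` Qset i =
      (if i%:R \in B then setT else set0) `&` Qset i.
    apply/seteqP; split=> o [] /= Ao [h Qi]; split=> //; move: Ao; rewrite Qi.
      by move=> ?; rewrite mem_set.
    by case: ifP => // /set_mem.
  by apply: infoI; [exact: const|exact: GQ].
- apply: red => i ia.
  have -> : (fun o => U (offset D k + n)%N o * (n.+1 < QQ k o)%:R) @^-1` B `&` Qset i =
      (if (n.+1 < i)%N then U (offset D k + n)%N @^-1` B else
        if (0 : R) \in B then setT else set0) `&` Qset i.
    apply/seteqP; split=> o [] /= Ao [h Qi]; split=> //; move: Ao; rewrite Qi.
      case: ifP => _; first by rewrite mulr1.
      by rewrite mulr0 => ?; rewrite mem_set.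
    case: ifP => _; first by rewrite mulr1.
    by rewrite mulr0; case: ifP => // /set_mem.
  apply: infoI; last exact: GQ.
  case: ifP => ni; last exact: const.
  apply: infoU => //; apply: hS1; apply: leq_trans ia; rewrite ltn_add2l.
  exact: leq_trans ni.
Qed.

Lemma history_info_fun {d'} {T : measurableType d'} (Y : Om -> T) (y0 : T) j k S1 S2 a :
  (1 <= j <= k)%N -> (forall A, measurable A -> history j (Y @^-1` A)) ->
  (offset D k <= a)%N -> (forall i, (i < a)%N -> S1 i) ->
  (forall i, (i < offset D k)%N -> S2 i) ->
  info_fun U V S1 S2 (fun o => if o \in early k a then Y o else y0).
Proof.
move=> /andP[j1 jk] hY ka hS1 hS2 A mA.
have k1 : (1 <= k)%N by exact: leq_trans jk.
have [Gk _] := early_history k1 ka hS1 hS2.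
have ja : (offset D j <= a)%N by apply: leq_trans ka; exact: offset_mono.
have hS2' i : (i < offset D j)%N -> S2 i.
  by move=> io; apply: hS2; apply: leq_trans io _; exact: offset_mono.
have [_ hj] := early_history j1 ja hS1 hS2'.
have -> : (fun o => if o \in early k a then Y o else y0) @^-1` A =
   ((Y @^-1` A `&` early j a) `&` early k a) `|`
   ((if y0 \in A then setT else set0) `\` early k a).
  apply/seteqP; split=> o /=.
    case: (boolP (o \in early k a)) => [/set_mem Eo Ao|nE Ao].
      by left; split=> //; split=> //; apply: early_sub Eo; rewrite j1 jk.
    right; split; last by move=> /mem_set; rewrite (negbTE nE).
    by rewrite mem_set.
  move=> [[[Ao _] Eo]|[Ao Eo]]; first by rewrite mem_set.
  have -> : (o \in early k a) = false by apply/negP => /set_mem.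
  by move: Ao; case: ifP => // /set_mem.
apply: infoUn; first by apply: infoI => //; apply: hj; exact: hY.
by apply: infoD => //; case: ifP => _; [exact: infoT|exact: info0].
Qed.

(** On the early event the policies of cycles up to [k] are known from primitives below [a], and
    customers up to the end of cycle [k] see no others. Hence the path may be computed with the
    policy cut at [k.+1]. *)
Lemma wait_info_fun k S1 S2 a m : (1 <= k)%N -> (offset D k <= a)%N -> (a <= m)%N ->
  (m <= offset D k.+1)%N ->
  (forall i, (i < m)%N -> S1 i) -> (forall i, (i < m)%N -> S2 i) ->
  info_fun U V S1 S2 (fun o => if o \in early k a then wait (c o m) else 0).
Proof.
move=> k1 ka am mk hS1 hS2.
have hS1' i : (i < a)%N -> S1 i by move=> ia; apply: hS1; exact: leq_trans am.
have hS2' i : (i < offset D k)%N -> S2 i.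
  by move=> io; apply: hS2; exact: leq_trans (leq_trans ka am).
pose E := early k a.
have [GE _] := early_history k1 ka hS1' hS2'.
have GA j A : (1 <= j < k.+1)%N -> measurable A -> info U V S1 S2 ((x j @^-1` A) `&` E).
  move=> /andP[j1 jk] mA.
  have hS2'' i : (i < offset D j)%N -> S2 i.
    by move=> io; apply: hS2'; apply: (leq_trans io); apply: offset_mono; rewrite -ltnS.
  have ja : (offset D j <= a)%N by apply: leq_trans ka; apply: offset_mono; rewrite -ltnS.
  have [_ h] := early_history j1 ja hS1' hS2''.
  have sE : E `<=` early j a by apply: early_sub; rewrite j1 -ltnS.
  have -> : (x j @^-1` A) `&` E = ((x j @^-1` A) `&` early j a) `&` E.
    by rewrite -setIA (setIidr sE).
  by apply: infoI => //; apply: h; exact: (policy_hist hx j1 mA).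
have mv i : (i < m)%N -> measurable_fun setT ((V i : Om -> R) : g_sigma_algebraType (info U V S1 S2) -> R).
  by move=> im; apply/info_fun_gP => B mB; apply: infoV => //; exact: hS2.
have [_ mW] := @cut_path_info S1 S2 k.+1 m E (fun i => V i : Om -> R) GE GA hS1 mv m (leqnn m).
apply/info_fun_gP.
rewrite (_ : (fun o => _) = (fun o : g_sigma_algebraType (info U V S1 S2) =>
  if o \in E then wait (customer_at (lam q) D ((cut k.+1 E) ^~ o) (U ^~ o) (V ^~ o) m) else 0)).
  apply: measurable_fun_ifT => //.
  apply: (measurable_fun_bool true); rewrite setTI.
  have -> : [eta mem E] @^-1` [set true] = E.
    by apply/seteqP; split=> o /=; [move=> /set_mem|move=> /mem_set].
  exact/infoE.
apply/funext => o; case: ifP => // /set_mem Eo; congr (wait _).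
apply: (@customer_at_causal _ (lam q) D D (x ^~ o) ((cut k.+1 E) ^~ o) (U ^~ o)
        (V ^~ o) (V ^~ o) k.+1 m) => //.
by move=> i ik; exact: cut_policyE.
Qed.

End history_info.

(** * The stationary waiting time *)

Ltac mfun_step := cbv beta; lazymatch goal with
  | |- measurable_fun _ (fun o => ((@?f o)%:E)%E) => apply/measurable_EFinP; change (measurable_fun setT f)
  | |- measurable_fun _ (fun o => (@?f o + - @?g o)%R) => apply: (@measurable_funB _ _ _ _ f g)
  | |- measurable_fun _ (fun o => (- @?f o)%R) => apply: (@measurable_funN _ _ _ _ f)
  | |- measurable_fun _ (fun o => (@?f o + @?g o)%R) => apply: (@measurable_funD _ _ _ _ f g)
  | |- measurable_fun _ (fun o => (@?f o * @?g o)%R) => apply: (@measurable_funM _ _ _ _ f g)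
  | |- measurable_fun _ (fun o => (@?f o ^+ ?n)%R) => apply: (@measurable_funX _ _ _ _ f n)
  | |- measurable_fun _ (fun o => Num.max (@?f o) (@?g o)) => apply: (@measurable_maxr _ _ _ _ f g)
  | |- measurable_fun _ (fun o => Num.min (@?f o) (@?g o)) => apply: (@measurable_minr _ _ _ _ f g)
  | |- measurable_fun _ (fun o => expR (@?f o)) => apply: (@measurableT_comp _ _ _ _ _ _ (@expR _) _ f (@measurable_expR _))
  | |- measurable_fun _ (fun o => `|@?f o|%R) => apply: (measurableT_comp (@normr_measurable _ setT))
  | |- measurable_fun _ (fun o => fst (@?f o)) => apply: (@measurableT_comp _ _ _ _ _ _ fst _ f measurable_fst)
  | |- measurable_fun _ (fun o => snd (@?f o)) => apply: (@measurableT_comp _ _ _ _ _ _ snd _ f measurable_snd)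
  | |- measurable_fun _ (fun _ => ?r) => apply: measurable_cst
  | |- measurable_fun _ (fun o => o) => apply: measurable_id
  | |- measurable_fun _ _ => first [assumption | done]
  end.
Ltac mfun := repeat mfun_step.

Section nonneg_integrals.
Local Open Scope ereal_scope.
Context {R : realType} {d : measure_display} {T : measurableType d} (m : probability T R).

Lemma integral_cstP (r : R) : \int[m]_o r%:E = r%:E.
Proof. by rewrite integral_cst//= probability_setT mule1. Qed.

Lemma integral_affine (a k : R) (f : T -> \bar R) : (0 <= a)%R -> (0 <= k)%R ->
  measurable_fun setT f -> (forall o, 0 <= f o) ->
  \int[m]_o (a%:E + k%:E * f o) = a%:E + k%:E * \int[m]_o f o.
Proof.
move=> a0 k0 mf f0; rewrite ge0_integralD//.
- by rewrite integral_cstP ge0_integralZl_EFin.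
- by move=> o _; rewrite mule_ge0.
- exact: measurable_funeM.
Qed.

Lemma le_int (f g : T -> \bar R) : measurable_fun setT f -> measurable_fun setT g ->
  (forall o, 0 <= f o) -> (forall o, f o <= g o) -> \int[m]_o f o <= \int[m]_o g o.
Proof. by move=> mf mg f0 fg; apply: ge0_le_integral. Qed.

End nonneg_integrals.

(** * Elementary inequalities for the exponential *)

Section real_exp.
Context {R : realType}.
Implicit Types (a b t y z : R).

Lemma expR_tangent a b : expR a * (1 + b) <= expR (a + b).
Proof. by rewrite expRD; apply: ler_wpM2l; [exact: expR_ge0|exact: expR_ge1Dx]. Qed.

(** Convexity between the points 0 and [y]: both values lie above the tangent at [a * y], and the
    linear parts cancel with weights [a] and [1 - a]. *)
Lemma expR_convex a y : 0 <= a <= 1 -> expR (a * y) <= a * expR y + (1 - a).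
Proof.
move=> /andP[a0 a1]; set E := expR (a * y).
have h1 : E * (1 + (1 - a) * y) <= expR y.
  rewrite [X in _ <= expR X](_ : y = a * y + (1 - a) * y); last by ring.
  exact: expR_tangent.
have h2 : E * (1 - a * y) <= 1.
  rewrite [leRHS](_ : _ = expR (a * y + - (a * y))); first exact: expR_tangent.
  by rewrite subrr expR0.
have h3 : a * (E * (1 + (1 - a) * y)) <= a * expR y by rewrite ler_wpM2l.
have h4 : (1 - a) * (E * (1 - a * y)) <= (1 - a) * 1 by rewrite ler_wpM2l// subr_ge0.
have : E = a * (E * (1 + (1 - a) * y)) + (1 - a) * (E * (1 - a * y)) by ring.
by move=> ->; rewrite -[in leRHS](mulr1 (1 - a)) lerD.
Qed.

Lemma expR_max t y : 0 <= t -> expR (t * Num.max 0 y) = Num.max 1 (expR (t * y)).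
Proof.
move=> t0; case: (leP 0 y) => y0.
  by rewrite max_r// -[leLHS]expR0 ler_expR mulr_ge0.
by rewrite max_l ?mulr0 ?expR0// -[leRHS]expR0 ler_expR mulr_ge0_le0// ltW.
Qed.

Lemma max1_lip a b : `|Num.max 1 a - Num.max 1 b| <= `|a - b|.
Proof.
wlog ab : a b / b <= a.
  move=> h; case/orP: (le_total b a) => ab; first exact: h.
  by rewrite distrC (distrC a); exact: h.
rewrite (ger0_norm (_ : 0 <= a - b)) ?subr_ge0//.
have mm : Num.max 1 b <= Num.max 1 a by rewrite ge_max !le_max lexx ab orbT.
rewrite ger0_norm ?subr_ge0//.
by case: (leP 1 a); case: (leP 1 b); lra.
Qed.

Lemma expR_dist a b : `|expR a - expR b| <= `|a - b| * expR (Num.max a b).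
Proof.
wlog ab : a b / b <= a.
  move=> h; case/orP: (le_total b a) => ab; first exact: h.
  by rewrite distrC (distrC a) maxC; exact: h.
rewrite (max_idPl ab) ger0_norm ?subr_ge0 ?ler_expR// ger0_norm ?subr_ge0//.
have : expR a * (1 + (b - a)) <= expR b.
  rewrite [X in _ <= expR X](_ : b = a + (b - a)); last by ring.
  exact: expR_tangent.
lra.
Qed.

(** On the nonnegative axis exp(t y) has slope at least [t], and the map max(1, .) produced by the
    truncation at 0 is a contraction. *)
Lemma max0_dist t y z : 0 < t ->
  `|Num.max 0 y - Num.max 0 z| <= `|expR (t * y) - expR (t * z)| / t.
Proof.
move=> t0; rewrite ler_pdivlMr//.
apply: (@le_trans _ _ (`|expR (t * Num.max 0 y) - expR (t * Num.max 0 z)|)); last first.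
  by rewrite !(expR_max _ (ltW t0)); exact: max1_lip.
have : 0 <= Num.max 0 y by rewrite le_max lexx.
have : 0 <= Num.max 0 z by rewrite le_max lexx.
move: (Num.max 0 y) (Num.max 0 z) => a b.
wlog ab : a b / b <= a.
  move=> h b0 a0; case/orP: (le_total b a) => ab; first exact: h.
  by rewrite distrC (distrC (expR _)); exact: h.
move=> b0 a0; have tab : t * b <= t * a by rewrite ler_pM2l.
rewrite ger0_norm ?subr_ge0// ger0_norm ?subr_ge0 ?ler_expR//.
have h1 : expR (t * b) * (1 + (t * a - t * b)) <= expR (t * a).
  rewrite [X in _ <= expR X](_ : t * a = t * b + (t * a - t * b)); last by ring.
  exact: expR_tangent.
have h2 : 1 <= expR (t * b) by rewrite -[leLHS]expR0 ler_expR mulr_ge0// ltW.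
have h3 : 0 <= t * a - t * b by lra.
nra.
Qed.

End real_exp.

(** * Exponential contraction of the waiting time recursion *)

Section queue_kernel.
Local Open Scope ereal_scope.
Context {R : realType} {d : measure_display} {Om : measurableType d}.
Variables (P : probability Om R) (U V : {RV P >-> R}).
Hypothesis U0 : forall o, (0 <= U o)%R.
Hypothesis V0 : forall o, (0 <= V o)%R.

(* One step of the waiting time recursion; the parameters are the mean service
   time [w.1.2.1] and the mean interarrival time [w.1.2.2]. *)
Definition step (w : (R * (R * R)) * (R * R)) : R :=
  Num.max 0%R (w.1.1 + w.2.2 * w.1.2.1 - w.2.1 * w.1.2.2)%R.

Lemma step_measurable : measurable_fun setT step.
Proof.
have m1 : measurable_fun setT (fun w : (R * (R * R)) * (R * R) => w.1.1).
  exact: (measurableT_comp measurable_fst measurable_fst).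
have m2 : measurable_fun setT (fun w : (R * (R * R)) * (R * R) => w.1.2).
  exact: (measurableT_comp measurable_snd measurable_fst).
have m3 : measurable_fun setT (fun w : (R * (R * R)) * (R * R) => w.2.1).
  exact: (measurableT_comp measurable_fst measurable_snd).
have m4 : measurable_fun setT (fun w : (R * (R * R)) * (R * R) => w.2.2).
  exact: (measurableT_comp measurable_snd measurable_snd).
rewrite /step; apply: measurable_maxr => //; apply: measurable_funB.
  apply: measurable_funD => //; apply: measurable_funM => //.
  exact: (measurableT_comp measurable_fst m2).
by apply: measurable_funM => //; exact: (measurableT_comp measurable_snd m2).
Qed.

Lemma step_ge0 w : (0 <= step w)%R. Proof. by rewrite /step le_max lexx. Qed.

(** Mean waiting time after [n] fresh customers, started from the waiting time [w.1] under the fixed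
    parameters [w.2]. The maximum in the base case makes it nonnegative for every real start. *)
Fixpoint Fn n (w : R * (R * R)) : \bar R :=
  if n is n'.+1 then \int[P]_o Fn n' (step (w, (U o, V o)), w.2)
  else (Num.max 0%R w.1)%:E.

Lemma Fn_ge0 n w : 0 <= Fn n w.
Proof.
elim: n w => [|n IH] w /=; first by rewrite lee_fin le_max lexx.
by apply: integral_ge0 => o _; exact: IH.
Qed.

Lemma Fn_step_measurable (f : R * (R * R) -> \bar R) : measurable_fun setT f ->
  measurable_fun setT (fun z : (R * (R * R)) * Om => f (step (z.1, (U z.2, V z.2)), z.1.2)).
Proof.
move=> mf; apply: measurableT_comp => //; apply: measurable_fun_pair.
  apply: measurableT_comp; first exact: step_measurable.
  apply: measurable_fun_pair; first exact: measurable_fst.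
  by apply: measurable_fun_pair; apply: measurableT_comp => //; exact: measurable_snd.
by apply: measurableT_comp; [exact: measurable_snd|exact: measurable_fst].
Qed.

Lemma Fn_measurable n : measurable_fun setT (Fn n).
Proof.
elim: n => [|n IH] /=.
  by apply/measurable_EFinP; mfun.
apply: (@measurable_fun_fubini_tonelli_F _ _ (R * (R * R))%type Om R P
  (fun z => Fn n (step (z.1, (U z.2, V z.2)), z.1.2))).
  exact: Fn_step_measurable.
by move=> z; exact: Fn_ge0.
Qed.

Lemma Fn_measurable1 n z : measurable_fun setT (fun y => Fn n (y, z)).
Proof. by apply: measurableT_comp; [exact: Fn_measurable|exact: pair2_measurable]. Qed.

Lemma Fn_measurable_o n w z : measurable_fun setT (fun o => Fn n (step (w, (U o, V o)), z)).
Proof.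
apply: (measurableT_comp (Fn_measurable1 n z)).
apply: (measurableT_comp step_measurable).
by apply: measurable_fun_pair => //; exact: measurable_fun_pair.
Qed.

Variables (th be : R).
Hypothesis th0 : (0 < th)%R.
Hypothesis be01 : (0 < be < 1)%R.
Variables (s1 rho0 : R).
Hypothesis rho00 : (0 < rho0)%R.
Definition par (z : R * R) := [/\ (0 <= z.1)%R, (z.1 <= s1)%R & (rho0 <= z.2)%R].
(** With this exponent the interarrival part of [texp z * (V * z.1 - U * z.2)] is [- th * U]
    whatever the parameter. *)
Definition texp (z : R * R) : R := (th / z.2)%R.
Hypothesis drift : forall z, par z ->
  \int[P]_o (expR (texp z * (V o * z.1 - U o * z.2)))%:E <= be%:E.

Lemma par2_gt0 z : par z -> (0 < z.2)%R.
Proof. by case=> _ _; exact: lt_le_trans. Qed.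
Lemma texp_gt0 z : par z -> (0 < texp z)%R.
Proof. by move=> /par2_gt0 h; rewrite divr_gt0. Qed.

Lemma expR_step t w : (0 <= t)%R -> expR (t * step w) =
  Num.max 1%R (expR (t * w.1.1) * expR (t * (w.2.2 * w.1.2.1 - w.2.1 * w.1.2.2)))%R.
Proof. by move=> t0; rewrite /step expR_max// -expRD -mulrDr addrA. Qed.

Lemma drift_meas z : measurable_fun setT
  (fun o => (expR (texp z * (V o * z.1 - U o * z.2)))%:E).
Proof. by mfun. Qed.

(** Two paths driven by the same primitives multiply their exponentials by the same factor, of mean
    at most [be], and the truncation at 0 does not increase the distance. No order between [y] and
    [y'] is imposed, so the bound can be used in both directions. *)
Lemma Fn_contract n z y y' : par z ->
  Fn n (y', z) <= Fn n (y, z) +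
    (be ^+ n / texp z * `|expR (texp z * y) - expR (texp z * y')|)%:E.
Proof.
move=> pz; have t0 := texp_gt0 pz.
have [b0 b1] := andP be01.
elim: n y y' => [|n IH] y y' /=.
  rewrite expr0 div1r -EFinD lee_fin -lerBlDl.
  apply: le_trans (ler_norm _) _; rewrite distrC mulrC.
  exact: max0_dist.
set k := (be ^+ n / texp z)%R.
have k0 : (0 <= k)%R by rewrite divr_ge0 ?exprn_ge0// ltW.
set dd := `|expR (texp z * y) - expR (texp z * y')|%R.
have kd0 : (0 <= k * dd)%R by rewrite mulr_ge0// /dd normr_ge0.
apply: (@le_trans _ _ (\int[P]_o (Fn n (step ((y, z), (U o, V o)), z) +
   (k * dd)%:E * (expR (texp z * (V o * z.1 - U o * z.2)))%:E))).
  apply: le_int.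
  - exact: Fn_measurable_o.
  - apply: emeasurable_funD; first exact: Fn_measurable_o.
    by apply: measurable_funeM; exact: drift_meas.
  - by move=> o; exact: Fn_ge0.
  move=> o; apply: le_trans (IH (step ((y, z), (U o, V o))) _) _.
  rewrite leeD2l// -EFinM lee_fin -/k -(mulrA k); apply: ler_wpM2l => //.
  rewrite !(expR_step _ (ltW t0)) /=; apply: le_trans (max1_lip _ _) _.
  by rewrite -mulrBl normrM (ger0_norm (expR_ge0 _)).
rewrite (ge0_integralD _ measurableT); last 4 first.
- by move=> o _; exact: Fn_ge0.
- exact: Fn_measurable_o.
- by move=> o _; apply: mule_ge0; rewrite lee_fin ?expR_ge0.
- by apply: measurable_funeM; exact: drift_meas.
rewrite leeD2l// (ge0_integralZl_EFin _ measurableT); last 3 first.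
- by move=> o _; rewrite lee_fin expR_ge0.
- exact: drift_meas.
- by [].
apply: (@le_trans _ _ ((k * dd)%:E * be%:E)).
  by apply: lee_wpmul2l; [rewrite lee_fin|exact: drift].
rewrite -EFinM lee_fin /k exprSr le_eqVlt; apply/orP; left; apply/eqP; ring.
Qed.

End queue_kernel.

(** * Exponential moment of the stationary law and speed of convergence *)

Section stationary.
Local Open Scope ereal_scope.
Context {R : realType} {d : measure_display} {Om : measurableType d}.
Variables (P : probability Om R) (U V : {RV P >-> R}).
Hypothesis U0 : forall o, (0 <= U o)%R.
Hypothesis V0 : forall o, (0 <= V o)%R.
Variables (th be s1 rho0 : R).
Hypothesis th0 : (0 < th)%R.
Hypothesis be01 : (0 < be < 1)%R.
Hypothesis rho00 : (0 < rho0)%R.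
Local Notation par := (par s1 rho0).
Local Notation tt := (texp th).
Local Notation Fn := (Fn U V).
Hypothesis drift : forall z, par z ->
  \int[P]_o (expR (tt z * (V o * z.1 - U o * z.2)))%:E <= be%:E.

Definition stationary z (pi : probability R R) := forall A : set R, measurable A ->
  pi A = \int[pi]_y P [set o | A (step ((y, z), (U o, V o)))].

Let Cbe : R := (1 - be)^-1.
Let Cbe0 : (0 <= Cbe)%R. Proof. by rewrite invr_ge0 subr_ge0; case/andP: be01 => _ /ltW. Qed.

Section one_law.
Variables (z : R * R) (pi : probability R R).
Hypothesis pz : par z.
Hypothesis sz : stationary z pi.
Let t := tt z.
Let t0 : (0 < t)%R. Proof. exact: (texp_gt0 th0 rho00 pz). Qed.

Definition stepz (w : R * Om) : R := step ((w.1, z), (U w.2, V w.2)).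

Lemma stepz_measurable : measurable_fun setT stepz.
Proof.
apply: (measurableT_comp (@step_measurable R)); apply: measurable_fun_pair.
  by apply: measurable_fun_pair => //.
by apply: measurable_fun_pair; apply: measurableT_comp => //; exact: measurable_snd.
Qed.

Lemma stationary_integral (f : R -> \bar R) : measurable_fun setT f -> (forall y, 0 <= f y) ->
  \int[pi]_y f y = \int[pi]_y \int[P]_o f (step ((y, z), (U o, V o))).
Proof.
move=> mf f0.
pose QP : {sigma_finite_measure set R -> \bar R} := pi.
pose PP : {sigma_finite_measure set Om -> \bar R} := P.
have ms := stepz_measurable.
have F1 := @fubini_tonelli1 _ _ _ _ _ QP PP (f \o stepz) (measurableT_comp mf ms) (fun w => f0 (stepz w)).
transitivity (\int[QP]_x fubini_F PP (f \o stepz) x); last by [].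
rewrite -F1 -[in RHS](preimage_setT stepz).
rewrite -(@ge0_integral_pushforward _ _ _ _ _ stepz ms _ setT f measurableT mf); last by move=> y _; exact: f0.
apply: eq_measure_integral => A mA _.
apply: (etrans (sz mA)); apply: eq_integral => y _ /=; congr (P _).
by apply/seteqP; split=> o /=; rewrite /xsection/= in_setE.
Qed.

Lemma stationary_lt0 : pi [set y | (y < 0)%R] = 0.
Proof.
have m0 : measurable [set y : R | (y < 0)%R].
  by apply: measurable_set_lt; [exact: measurable_id|exact: measurable_cst].
rewrite sz//; under eq_integral => y _.
  rewrite (_ : [set o | _] = set0) ?measure0; first by over.
  by apply/seteqP; split=> o //=; rewrite ltNge step_ge0.
by rewrite integral_cst//= mul0e.
Qed.

Let g (y : R) : R := expR (t * y).
Let mg : measurable_fun setT g. Proof. by rewrite /g; mfun. Qed.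

Lemma drift_step y : \int[P]_o (g (step ((y, z), (U o, V o))))%:E <= (1 + be * g y)%:E.
Proof.
apply: (@le_trans _ _ (\int[P]_o (1%:E + (g y)%:E * (expR (t * (V o * z.1 - U o * z.2)))%:E))).
  apply: le_int.
  - apply/measurable_EFinP; apply: (measurableT_comp mg).
    apply: (measurableT_comp (@step_measurable R)); apply: measurable_fun_pair => //.
    exact: measurable_fun_pair.
  - by apply: emeasurable_funD => //; apply: measurable_funeM; exact: (drift_meas _ _ _ z).
  - by move=> o; rewrite lee_fin expR_ge0.
  move=> o; rewrite -EFinM -EFinD lee_fin /g (expR_step _ (ltW t0)) /=.
  by rewrite ge_max lerDl lerDr ler01 andbT; apply: mulr_ge0; exact: expR_ge0.
rewrite (integral_affine P); last 4 first.
- by [].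
- exact: expR_ge0.
- exact: (drift_meas _ _ _ z).
- by move=> o; rewrite lee_fin expR_ge0.
rewrite EFinD leeD2l// mulrC EFinM lee_wpmul2l ?lee_fin ?expR_ge0//.
exact: drift.
Qed.

(** Formally, stationarity and [drift_step] give E g <= 1 + be E g, but E g could be infinite and
    may not be subtracted. The inequality is therefore proved for truncations at level [N], followed
    by monotone convergence. *)
Lemma stationary_exp : \int[pi]_y (g y)%:E <= Cbe%:E.
Proof.
pose B (N : nat) : set R := [set y | g y <= N%:R]%R.
have mB N : measurable (B N) by apply: measurable_set_le => //; exact: measurable_cst.
pose f (N : nat) (y : R) := (Num.min (g y) N%:R)%R.
pose f' (N : nat) (y : R) := (Num.min (1 + be * g y) N%:R)%R.
have [b0 b1] := andP be01.
have f0 N y : (0 <= f N y)%R by rewrite le_min expR_ge0 ler0n.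
have f'0 N y : (0 <= f' N y)%R.
  by rewrite le_min ler0n andbT addr_ge0// mulr_ge0 ?expR_ge0// ltW.
have mf N : measurable_fun setT (f N) by rewrite /f; mfun.
have mf' N : measurable_fun setT (f' N) by rewrite /f'; mfun.
have ff' N : \int[pi]_y (f N y)%:E <= \int[pi]_y (f' N y)%:E.
  rewrite (stationary_integral (f := fun y => (f N y)%:E)); last 2 first.
  - exact/measurable_EFinP.
  - by move=> y; rewrite lee_fin.
  apply: le_int.
  - apply: (@measurable_fun_fubini_tonelli_F _ _ R Om R P (fun w => (f N (stepz w))%:E)).
      by apply/measurable_EFinP; apply: (measurableT_comp (mf N)); exact: stepz_measurable.
    by move=> w; rewrite lee_fin.
  - exact/measurable_EFinP.
  - by move=> y; apply: integral_ge0 => o _; rewrite lee_fin.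
  move=> y; rewrite /f' EFin_min le_min; apply/andP; split.
    apply: le_trans (drift_step y); apply: le_int.
    - apply/measurable_EFinP; apply: (measurableT_comp (mf N)).
      apply: (measurableT_comp (@step_measurable R)); apply: measurable_fun_pair => //.
      exact: measurable_fun_pair.
    - apply/measurable_EFinP; apply: (measurableT_comp mg).
      apply: (measurableT_comp (@step_measurable R)); apply: measurable_fun_pair => //.
      exact: measurable_fun_pair.
    - by move=> o; rewrite lee_fin.
    - by move=> o; rewrite lee_fin /f ge_min lexx.
  rewrite -[leRHS](integral_cstP P); apply: le_int => //.
  - apply/measurable_EFinP; apply: (measurableT_comp (mf N)).
    apply: (measurableT_comp (@step_measurable R)); apply: measurable_fun_pair => //.
    exact: measurable_fun_pair.
  - by move=> o; rewrite lee_fin.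
  - by move=> o; rewrite lee_fin /f ge_min lexx orbT.
pose h (N : nat) (y : R) := (g y * \1_(B N) y)%R.
have mh N : measurable_fun setT (h N) by apply: measurable_funM => //; exact: measurable_indic.
have h0 N y : (0 <= h N y)%R by rewrite mulr_ge0 ?expR_ge0.
have hN N : \int[pi]_y (h N y)%:E <= Cbe%:E.
  have i1 : \int[pi]_y (f N y)%:E <= N%:R%:E.
    rewrite -[leRHS](integral_cstP pi); apply: le_int => //.
    - exact/measurable_EFinP.
    - by move=> o; rewrite lee_fin.
    - by move=> o; rewrite lee_fin /f ge_min lexx orbT.
  (* Pointwise: where [g y <= N] the left side is at most 1 + be g + (1 - be) g, and elsewhere at
     most [N]. Since the integral of [f N] is finite, it can then be cancelled against [ff']. *)
  have i2 : \int[pi]_y (f' N y)%:E + (1 - be)%:E * \int[pi]_y (h N y)%:E <=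
      1 + \int[pi]_y (f N y)%:E.
    have b10 : (0 <= 1 - be)%R by rewrite subr_ge0 ltW.
    rewrite -(@ge0_integralZl_EFin _ _ _ pi setT measurableT (EFin \o h N) _ _ _ b10); last 2 first.
    - by move=> y _; rewrite lee_fin.
    - exact/measurable_EFinP.
    rewrite -(ge0_integralD _ measurableT); last 4 first.
    - by move=> y _; rewrite lee_fin.
    - exact/measurable_EFinP.
    - by move=> y _; rewrite mule_ge0 ?lee_fin.
    - by apply: measurable_funeM; exact/measurable_EFinP.
    have := @integral_affine _ _ _ pi 1 1 (EFin \o f N) ler01 ler01; rewrite mul1e => <-; last 2 first.
    - exact/measurable_EFinP.
    - by move=> y; rewrite lee_fin.
    apply: le_int.
    - apply: emeasurable_funD; first exact/measurable_EFinP.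
      by apply: measurable_funeM; exact/measurable_EFinP.
    - by apply: emeasurable_funD => //; apply: measurable_funeM; exact/measurable_EFinP.
    - by move=> y; rewrite adde_ge0 ?mule_ge0 ?lee_fin.
    move=> y; rewrite mul1e /= -EFinM -!EFinD lee_fin /h /f /f' indicE.
    have gy : (0 <= g y)%R by exact: expR_ge0.
    case: (boolP (y \in B N)) => [/set_mem gN|gN].
      rewrite mulr1 (min_idPl gN).
      have : (Num.min (1 + be * g y) N%:R <= 1 + be * g y)%R by rewrite ge_min lexx.
      by move: (Num.min _ _) => ?; lra.
    have {}gN : (N%:R <= g y)%R.
      by rewrite leNgt; apply/negP => /ltW hh; move/negP: gN; apply; rewrite inE.
    rewrite mulr0 mulr0 addr0 (min_idPr gN).
    have : (Num.min (1 + be * g y) N%:R <= N%:R)%R by rewrite ge_min lexx orbT.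
    by move: (Num.min _ _) => ?; lra.
  have fin : \int[pi]_y (f N y)%:E \is a fin_num.
    rewrite ge0_fin_numE ?(le_lt_trans i1) ?ltry//.
    by apply: integral_ge0 => y _; rewrite lee_fin.
  have i3 : (1 - be)%:E * \int[pi]_y (h N y)%:E <= 1.
    have := le_trans (leeD2r _ (ff' N)) i2.
    by rewrite [leRHS]addeC leeD2lE.
  rewrite -[leRHS]mule1 lee_pdivlMl//; last by rewrite subr_gt0.
have cv : (fun N => \int[pi]_y (h N y)%:E) @ \oo --> \int[pi]_y (g y)%:E.
  have -> : \int[pi]_y (g y)%:E = \int[pi]_y limn (fun N => (h N y)%:E).
    apply: eq_integral => y _; apply/esym/cvg_lim => //.
    apply: cvg_near_cst; exists (Num.truncn (g y)).+1 => // N /= Ng.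
    rewrite /h indicE mem_set ?mulr1//= /B/=.
    by rewrite ltW// (lt_le_trans (truncnS_gt _))// ler_nat.
  apply: cvg_monotone_convergence => //.
  - by move=> N; exact/measurable_EFinP.
  - by move=> N y _; rewrite lee_fin.
  move=> y _ N M NM; rewrite lee_fin /h ler_wpM2l ?expR_ge0// !indicE.
  rewrite ler_nat; case: (boolP (y \in B N)) => // /set_mem yN.
  by rewrite mem_set//; apply: (le_trans yN); rewrite ler_nat.
rewrite -(cvg_lim _ cv)//; apply: lime_le; first by apply/cvg_ex; eexists; exact: cv.
exact: nearW.
Qed.

(** The positive part keeps the integrand nonnegative and equal to [Fn 0]; by [stationary_lt0] it
    changes the integrand on a null set only. *)
Definition wbar : \bar R := \int[pi]_y (Num.max 0%R y)%:E.

Lemma stationary_Fn n : \int[pi]_y Fn n (y, z) = wbar.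
Proof.
elim: n => [//|n <-].
by rewrite [RHS](stationary_integral (Fn_measurable1 U V n z))// => y; exact: Fn_ge0.
Qed.

Lemma wbar_ge0 : 0 <= wbar.
Proof. by apply: integral_ge0 => y _; rewrite lee_fin le_max lexx. Qed.

Lemma wbar_le : wbar <= (Cbe / t)%:E.
Proof.
apply: (@le_trans _ _ (\int[pi]_y (t^-1%:E * (g y)%:E))).
  apply: le_int.
  - by mfun.
  - by apply: measurable_funeM; exact/measurable_EFinP.
  - by move=> y; rewrite lee_fin le_max lexx.
  move=> y; rewrite -EFinM lee_fin ler_pdivlMl//.
  have : (0 <= Num.max 0 y)%R by rewrite le_max lexx.
  have := expR_ge1Dx (t * y); have := expR_ge0 (t * y); rewrite -/(g y).
  by case: (leP 0%R y); nra.
rewrite ge0_integralZl_EFin//; last 3 first.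
- by move=> y _; rewrite lee_fin expR_ge0.
- exact/measurable_EFinP.
- by rewrite invr_ge0 ltW.
rewrite [leRHS](_ : _ = t^-1%:E * Cbe%:E); last by rewrite -EFinM mulrC.
by apply: lee_wpmul2l; [rewrite lee_fin invr_ge0 ltW|exact: stationary_exp].
Qed.

Lemma wbar_fin : wbar \is a fin_num.
Proof. by rewrite ge0_fin_numE ?wbar_ge0// (le_lt_trans wbar_le)// ltry. Qed.

Lemma dist_exp_integral y : \int[pi]_y' (`|g y - g y'|)%:E <= (g y + Cbe)%:E.
Proof.
apply: (@le_trans _ _ (\int[pi]_y' ((g y)%:E + 1%:E * (g y')%:E))).
  apply: le_int.
  - by mfun.
  - by apply: emeasurable_funD => //; apply: measurable_funeM; exact/measurable_EFinP.
  - by move=> y'; rewrite lee_fin.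
  move=> y'; rewrite mul1e -EFinD lee_fin (le_trans (ler_normB _ _))//.
  by rewrite !ger0_norm ?expR_ge0.
rewrite (integral_affine pi) ?expR_ge0//; last 2 first.
- exact/measurable_EFinP.
- by move=> y'; rewrite lee_fin expR_ge0.
by rewrite mul1e EFinD leeD2l// stationary_exp.
Qed.

Let k n : R := (be ^+ n / t)%R.
Let k0 n : (0 <= k n)%R.
Proof. by rewrite divr_ge0 ?exprn_ge0 ?ltW//; case/andP: be01. Qed.

Lemma k_dist_integral n y :
  \int[pi]_y' ((k n * `|g y - g y'|)%:E) <= (k n * (g y + Cbe))%:E.
Proof.
under eq_integral => y' _ do rewrite (EFinM (k n)).
rewrite ge0_integralZl_EFin//; last by mfun.
by rewrite [leRHS]EFinM; apply: lee_wpmul2l; [rewrite lee_fin|exact: dist_exp_integral].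
Qed.

(** Integrate the contraction over a second starting point drawn from [pi]; from there the mean
    after [n] steps is exactly [wbar]. *)
Lemma Fn_le_wbar n y : Fn n (y, z) <= wbar + (k n * (g y + Cbe))%:E.
Proof.
apply: (@le_trans _ _ (\int[pi]_y' (Fn n (y', z) + (k n * `|g y - g y'|)%:E))).
  rewrite -[leLHS](mule1) -(probability_setT pi) -integral_cst//.
  apply: le_int.
  - exact: measurable_cst.
  - by apply: emeasurable_funD; [exact: Fn_measurable1|mfun].
  - by move=> y'; exact: Fn_ge0.
  move=> y'; rewrite distrC; exact: (Fn_contract th0 be01 rho00 drift).
rewrite (ge0_integralD _ measurableT); last 4 first.
- by move=> y' _; exact: Fn_ge0.
- exact: Fn_measurable1.
- by move=> y' _; rewrite lee_fin mulr_ge0.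
- by mfun.
by rewrite stationary_Fn leeD2l// k_dist_integral.
Qed.

Lemma wbar_le_Fn n y : wbar <= Fn n (y, z) + (k n * (g y + Cbe))%:E.
Proof.
have [Fy|] := boolP (Fn n (y, z) \is a fin_num); last first.
  rewrite ge0_fin_numE ?Fn_ge0// -leNgt leye_eq => /eqP ->.
  by rewrite addye// leey.
rewrite -(stationary_Fn n).
apply: (@le_trans _ _ (\int[pi]_y' ((fine (Fn n (y, z)))%:E + 1%:E * (k n * `|g y - g y'|)%:E))).
  apply: le_int.
  - exact: Fn_measurable1.
  - by apply: emeasurable_funD => //; apply: measurable_funeM; mfun.
  - by move=> y'; exact: Fn_ge0.
  by move=> y'; rewrite fineK// mul1e; exact: (Fn_contract th0 be01 rho00 drift).
rewrite (integral_affine pi); last 4 first.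
- exact/fine_ge0/Fn_ge0.
- by [].
- by mfun.
- by move=> y'; rewrite lee_fin mulr_ge0.
by rewrite fineK// mul1e leeD2l// k_dist_integral.
Qed.

End one_law.
End stationary.

Lemma le_geometric {R : realType} (be a b c : R) : 0 <= be < 1 ->
  (forall N, a <= b + be ^+ N * c) -> a <= b.
Proof.
move=> /andP[b0 b1] h.
have cv : (fun N => b + be ^+ N * c) @ \oo --> b.
  rewrite -[X in _ --> X]addr0 -[X in _ --> _ + X](mul0r c).
  apply: cvgD; first exact: cvg_cst.
  by apply: cvgMl; apply: cvg_expr; rewrite ger0_norm.
by rewrite -(cvg_lim _ cv)//; apply: limr_ge; [exact: cvgP cv|exact: nearW].
Qed.

(** * Lipschitz dependence of the stationary mean on the parameters *)

Section lipschitz.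
Local Open Scope ereal_scope.
Context {R : realType} {d : measure_display} {Om : measurableType d}.
Variables (P : probability Om R) (U V : {RV P >-> R}).
Hypothesis U0 : forall o, (0 <= U o)%R.
Hypothesis V0 : forall o, (0 <= V o)%R.
Variables (th be s1 rho0 : R).
Hypothesis th0 : (0 < th)%R.
Hypothesis be01 : (0 < be < 1)%R.
Hypothesis rho00 : (0 < rho0)%R.
Local Notation par := (par s1 rho0).
Local Notation tt := (texp th).
Local Notation Fn := (Fn U V).
Local Notation stationary := (stationary U V).
Hypothesis drift : forall z, par z ->
  \int[P]_o (expR (tt z * (V o * z.1 - U o * z.2)))%:E <= be%:E.
Variable C1 : R.
Hypothesis mom : \int[P]_o ((U o + V o) * expR (th * (s1 / rho0) * V o))%:E <= C1%:E.
Local Notation Cbe := ((1 - be)^-1)%R.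

Section ordered.
Variables (z z' : R * R) (pi pi' : probability R R).
Hypothesis pz : par z.
Hypothesis pz' : par z'.
Hypothesis zz' : (z'.2 <= z.2)%R.
Hypothesis sz : stationary z pi.
Hypothesis sz' : stationary z' pi'.
Let t := tt z.
Let t0 : (0 < t)%R. Proof. exact: (texp_gt0 th0 rho00 pz). Qed.
Let Del : R := (`|z.1 - z'.1| + `|z.2 - z'.2|)%R.
Let Del0 : (0 <= Del)%R. Proof. by rewrite addr_ge0. Qed.
Let g (y : R) : R := expR (t * y).
Let mg : measurable_fun setT g. Proof. by rewrite /g; mfun. Qed.
Let xi (z : R * R) o : R := (V o * z.1 - U o * z.2)%R.
Let k n : R := (be ^+ n / t)%R.
Let k0 n : (0 <= k n)%R.
Proof. by rewrite divr_ge0 ?exprn_ge0 ?ltW//; case/andP: be01. Qed.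
Let Cbe0 : (0 <= Cbe)%R. Proof. by rewrite invr_ge0 subr_ge0; case/andP: be01 => _ /ltW. Qed.
Let C10 : (0 <= C1)%R.
Proof.
rewrite -lee_fin; apply: le_trans mom; apply: integral_ge0 => o _.
by rewrite lee_fin mulr_ge0 ?expR_ge0// addr_ge0.
Qed.

Let mxi y : measurable_fun setT (xi y). Proof. by rewrite /xi; mfun. Qed.

Let mm : measurable_fun setT (fun o => ((U o + V o) * expR (th * (s1 / rho0) * V o))%:E).
Proof. by mfun. Qed.

(** The exponential is Lipschitz with the larger endpoint as constant, and both exponents are at
    most [th * (s1 / rho0) * V] once the negative interarrival part is dropped; this is the
    exponential in [mom]. *)
Lemma increment_dist :
  \int[P]_o (`|expR (t * xi z o) - expR (t * xi z' o)|)%:E <= (t * Del * C1)%:E.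
Proof.
have tD0 : (0 <= t * Del)%R by rewrite mulr_ge0// ltW.
apply: (@le_trans _ _ (\int[P]_o ((t * Del)%:E * ((U o + V o) * expR (th * (s1 / rho0) * V o))%:E))).
  apply: le_int.
  - by mfun.
  - exact: measurable_funeM.
  - by move=> o; rewrite lee_fin.
  move=> o; rewrite -EFinM lee_fin; apply: le_trans (expR_dist _ _) _.
  rewrite [leRHS]mulrA; apply: ler_pM; [by []|exact: expR_ge0| |].
    rewrite -mulrBr normrM (gtr0_norm t0) -[leRHS]mulrA ler_pM2l//.
    have -> : (xi z o - xi z' o = V o * (z.1 - z'.1) - U o * (z.2 - z'.2))%R by rewrite /xi; ring.
    apply: le_trans (ler_normB _ _) _; rewrite !normrM (ger0_norm (V0 o)) (ger0_norm (U0 o)).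
    have := normr_ge0 (z.1 - z'.1)%R; have := normr_ge0 (z.2 - z'.2)%R.
    by have := U0 o; have := V0 o; rewrite /Del; nra.
  have key y : par y -> (t * xi y o <= th * (s1 / rho0) * V o)%R.
    move=> [y1 ys y2]; rewrite /xi.
    have p2 := par2_gt0 rho00 pz.
    have h1 : (t <= th / rho0)%R.
      by rewrite /t /texp ler_pM2l// lef_pV2 ?posrE//; case: pz.
    have h2 : (0 <= U o * y.2)%R by rewrite mulr_ge0// (le_trans (ltW rho00)).
    have h3 : (V o * y.1 <= V o * s1)%R by rewrite ler_wpM2l.
    have h4 : (0 <= V o * s1)%R by rewrite mulr_ge0// (le_trans y1).
    have h5 : (t * (V o * y.1 - U o * y.2) <= t * (V o * s1))%R by rewrite ler_pM2l//; lra.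
    apply: (le_trans h5).
    have -> : (th * (s1 / rho0) * V o = th / rho0 * (V o * s1))%R by ring.
    by rewrite ler_wpM2r.
  by rewrite ler_expR ge_max !key.
rewrite (ge0_integralZl_EFin _ measurableT)//.
  by rewrite [leRHS]EFinM; apply: lee_wpmul2l => //; rewrite lee_fin.
by move=> o _; rewrite lee_fin mulr_ge0 ?expR_ge0// addr_ge0.
Qed.

Lemma g_step_dist y o :
  (`|g (step ((y, z), (U o, V o))) - g (step ((y, z'), (U o, V o)))| <=
   g y * `|expR (t * xi z o) - expR (t * xi z' o)|)%R.
Proof.
rewrite /g !(expR_step _ (ltW t0)) /=; apply: le_trans (max1_lip _ _) _.
by rewrite -mulrBr normrM (ger0_norm (expR_ge0 _)).
Qed.

Let mstep y w : measurable_fun setT (fun o => g (step ((y, w), (U o, V o)))).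
Proof.
apply: (measurableT_comp mg); apply: (measurableT_comp (@step_measurable R)).
by apply: measurable_fun_pair => //; exact: measurable_fun_pair.
Qed.

Lemma perturb_integral n y : \int[P]_o (k n * `|g (step ((y, z), (U o, V o))) -
    g (step ((y, z'), (U o, V o)))|)%:E <= (be ^+ n * Del * C1 * g y)%:E.
Proof.
apply: (@le_trans _ _ (\int[P]_o ((k n * g y)%:E *
    (`|expR (t * xi z o) - expR (t * xi z' o)|)%:E))).
  apply: le_int.
  - have m1 := mstep y z; have m2 := mstep y z'.
    apply/measurable_EFinP; apply: measurable_funM; first exact: measurable_cst.
    apply: (measurableT_comp (@normr_measurable _ setT)).
    exact: measurable_funB.
  - by apply: measurable_funeM; mfun.
  - by move=> o; rewrite lee_fin mulr_ge0.
  - by move=> o; rewrite -EFinM lee_fin -[leRHS]mulrA ler_wpM2l//; exact: g_step_dist.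
rewrite (ge0_integralZl_EFin _ measurableT); last 3 first.
- by move=> o _; rewrite lee_fin.
- by mfun.
- by rewrite mulr_ge0// expR_ge0.
have -> : (be ^+ n * Del * C1 * g y = (k n * g y) * (t * Del * C1))%R.
  by rewrite /k; field; rewrite gt_eqF.
rewrite [leRHS]EFinM; apply: lee_wpmul2l; last exact: increment_dist.
by rewrite lee_fin mulr_ge0// expR_ge0.
Qed.

Lemma perturb_up n y : \int[P]_o Fn n (step ((y, z'), (U o, V o)), z) <=
  Fn n.+1 (y, z) + (be ^+ n * Del * C1 * g y)%:E.
Proof.
have mk : measurable_fun setT (fun o => (k n * `|g (step ((y, z), (U o, V o))) -
    g (step ((y, z'), (U o, V o)))|)%:E).
  have m1 := mstep y z; have m2 := mstep y z'.
  apply/measurable_EFinP; apply: measurable_funM; first exact: measurable_cst.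
  by apply: (measurableT_comp (@normr_measurable _ setT)); exact: measurable_funB.
apply: (@le_trans _ _ (\int[P]_o (Fn n (step ((y, z), (U o, V o)), z) +
  (k n * `|g (step ((y, z), (U o, V o))) - g (step ((y, z'), (U o, V o)))|)%:E))).
  apply: le_int.
  - exact: Fn_measurable_o.
  - by apply: emeasurable_funD => //; exact: Fn_measurable_o.
  - by move=> o; exact: Fn_ge0.
  - by move=> o; exact: (Fn_contract th0 be01 rho00 drift).
rewrite (ge0_integralD _ measurableT)//; last 3 first.
- by move=> o _; exact: Fn_ge0.
- exact: Fn_measurable_o.
- by move=> o _; rewrite lee_fin mulr_ge0.
by rewrite leeD2l// perturb_integral.
Qed.

Lemma perturb_down n y : Fn n.+1 (y, z) <=
  \int[P]_o Fn n (step ((y, z'), (U o, V o)), z) + (be ^+ n * Del * C1 * g y)%:E.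
Proof.
have mk : measurable_fun setT (fun o => (k n * `|g (step ((y, z), (U o, V o))) -
    g (step ((y, z'), (U o, V o)))|)%:E).
  have m1 := mstep y z; have m2 := mstep y z'.
  apply/measurable_EFinP; apply: measurable_funM; first exact: measurable_cst.
  by apply: (measurableT_comp (@normr_measurable _ setT)); exact: measurable_funB.
apply: (@le_trans _ _ (\int[P]_o (Fn n (step ((y, z'), (U o, V o)), z) +
  (k n * `|g (step ((y, z), (U o, V o))) - g (step ((y, z'), (U o, V o)))|)%:E))).
  apply: le_int.
  - exact: Fn_measurable_o.
  - by apply: emeasurable_funD => //; exact: Fn_measurable_o.
  - by move=> o; exact: Fn_ge0.
  - by move=> o; rewrite distrC; exact: (Fn_contract th0 be01 rho00 drift).
rewrite (ge0_integralD _ measurableT)//; last 3 first.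
- by move=> o _; exact: Fn_ge0.
- exact: Fn_measurable_o.
- by move=> o _; rewrite lee_fin mulr_ge0.
by rewrite leeD2l// perturb_integral.
Qed.

(** Here the order [zz'] enters: it makes [t] at most the exponent of [z'], for which [pi'] has an
    exponential moment. The summand 1 covers negative [y]. *)
Lemma other_exp : \int[pi']_y (g y)%:E <= (1 + Cbe)%:E.
Proof.
have mg' : measurable_fun setT (fun y => (expR (tt z' * y))%:E).
  by mfun.
apply: (@le_trans _ _ (\int[pi']_y (1%:E + 1%:E * (expR (tt z' * y))%:E))).
  apply: le_int.
  - exact/measurable_EFinP.
  - by apply: emeasurable_funD => //; exact: measurable_funeM.
  - by move=> y; rewrite lee_fin expR_ge0.
  move=> y; rewrite mul1e -EFinD lee_fin /g.
  have tt' : (t <= tt z')%R.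
    by rewrite /t /texp ler_pM2l// lef_pV2 ?posrE ?(par2_gt0 rho00 pz) ?(par2_gt0 rho00 pz').
  have [y0|y0] := leP 0%R y.
    by rewrite (@le_trans _ _ (expR (tt z' * y)))// ?lerDr// ler_expR ler_wpM2r.
  rewrite (@le_trans _ _ 1%R)//; last by rewrite lerDl expR_ge0.
  by rewrite -[leRHS]expR0 ler_expR mulr_ge0_le0// ltW.
rewrite (integral_affine pi'); last 4 first.
- by [].
- by [].
- by [].
- by move=> y; rewrite lee_fin expR_ge0.
rewrite mul1e EFinD leeD2l//.
exact: (stationary_exp th0 be01 rho00 drift pz' sz').
Qed.

Let K := (Del * C1 * (1 + Cbe))%R.
Let K0 : (0 <= K)%R. Proof. by rewrite !mulr_ge0// addr_ge0. Qed.

Lemma scaled_other_exp n : \int[pi']_y (be ^+ n * Del * C1 * g y)%:E <= (be ^+ n * K)%:E.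
Proof.
have c0 : (0 <= be ^+ n * Del * C1)%R.
  by rewrite !mulr_ge0// exprn_ge0//; case/andP: be01 => /ltW.
under eq_integral => y _ do rewrite EFinM.
rewrite (ge0_integralZl_EFin _ measurableT); last 3 first.
- by move=> y _; rewrite lee_fin expR_ge0.
- exact/measurable_EFinP.
- by [].
have -> : (be ^+ n * K = be ^+ n * Del * C1 * (1 + Cbe))%R by rewrite /K; ring.
by rewrite [leRHS]EFinM; apply: lee_wpmul2l; [rewrite lee_fin|exact: other_exp].
Qed.

Let mFint n : measurable_fun setT (fun y => \int[P]_o Fn n (step ((y, z'), (U o, V o)), z)).
Proof.
apply: (@measurable_fun_fubini_tonelli_F _ _ R Om R P (fun w => Fn n (stepz U V z' w, z))).
  apply: (measurableT_comp (Fn_measurable1 U V n z)); exact: stepz_measurable.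
by move=> w; exact: Fn_ge0.
Qed.

Let mgn n : measurable_fun setT (fun y => (be ^+ n * Del * C1 * g y)%:E).
Proof. by mfun. Qed.

Lemma shift_up n : \int[pi']_y Fn n (y, z) <= \int[pi']_y Fn n.+1 (y, z) + (be ^+ n * K)%:E.
Proof.
rewrite (stationary_integral sz' (Fn_measurable1 U V n z)); last by move=> y; exact: Fn_ge0.
apply: (@le_trans _ _ (\int[pi']_y (Fn n.+1 (y, z) + (be ^+ n * Del * C1 * g y)%:E))).
  apply: le_int => //.
  - by apply: emeasurable_funD => //; exact: Fn_measurable1.
  - by move=> y; apply: integral_ge0 => o _; exact: Fn_ge0.
  - by move=> y; exact: perturb_up.
rewrite (ge0_integralD _ measurableT)//; last 3 first.
- by move=> o _; exact: Fn_ge0.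
- exact: (Fn_measurable1 U V n.+1 z).
- move=> y _; rewrite lee_fin !mulr_ge0 ?expR_ge0// exprn_ge0//.
  by case/andP: be01 => /ltW.
by rewrite leeD2l// scaled_other_exp.
Qed.

Lemma shift_down n : \int[pi']_y Fn n.+1 (y, z) <= \int[pi']_y Fn n (y, z) + (be ^+ n * K)%:E.
Proof.
rewrite (stationary_integral sz' (Fn_measurable1 U V n z)); last by move=> y; exact: Fn_ge0.
apply: (@le_trans _ _ (\int[pi']_y (\int[P]_o Fn n (step ((y, z'), (U o, V o)), z)
    + (be ^+ n * Del * C1 * g y)%:E))).
  apply: le_int => //.
  - exact: (Fn_measurable1 U V n.+1 z).
  - by apply: emeasurable_funD.
  - by move=> y; exact: Fn_ge0.
  - by move=> y; exact: perturb_down.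
rewrite (ge0_integralD _ measurableT)//; last 2 first.
- by move=> y _; apply: integral_ge0 => o _; exact: Fn_ge0.
- move=> y _; rewrite lee_fin !mulr_ge0 ?expR_ge0// exprn_ge0//.
  by case/andP: be01 => /ltW.
by rewrite leeD2l// scaled_other_exp.
Qed.

Let geo N : (K * (1 - be ^+ N) * Cbe + be ^+ N * K = K * (1 - be ^+ N.+1) * Cbe)%R.
Proof.
have b1 : (1 - be != 0)%R by rewrite gt_eqF// subr_gt0; case/andP: be01.
by rewrite exprSr; field.
Qed.

(** The integrals of [Fn N (., z)] against [pi'] interpolate between the two stationary means: at
    [N = 0] the value is [wbar pi'], and it approaches [wbar pi] as [N] grows. Each step replaces
    one transition with parameter [z'] by one with [z] and costs [be ^+ N * K], so the costs sum
    geometrically. *)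
Lemma telescope_up N :
  wbar pi' <= \int[pi']_y Fn N (y, z) + (K * (1 - be ^+ N) * Cbe)%:E.
Proof.
elim: N => [|N IH]; first by rewrite expr0 subrr mulr0 mul0r adde0.
apply: (le_trans IH); rewrite -geo EFinD [X in _ <= _ + X]addeC addeA.
exact: leeD2r (shift_up N).
Qed.

Lemma telescope_down N :
  \int[pi']_y Fn N (y, z) <= wbar pi' + (K * (1 - be ^+ N) * Cbe)%:E.
Proof.
elim: N => [|N IH]; first by rewrite expr0 subrr mulr0 mul0r adde0.
apply: (le_trans (shift_down N)).
by rewrite -geo EFinD addeA leeD2r.
Qed.

Let Kle N : (K * (1 - be ^+ N) * Cbe <= K * Cbe)%R.
Proof.
rewrite ler_wpM2r//; apply: ler_piMr => //.
by rewrite gerBl exprn_ge0//; case/andP: be01 => /ltW.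
Qed.

Let wf := wbar_fin th0 be01 rho00 drift pz sz.
Let wf' := wbar_fin th0 be01 rho00 drift pz' sz'.
Let E := ((1 + Cbe + Cbe) / t)%R.

Let mk N : measurable_fun setT (fun y => (k N * (g y + Cbe))%:E).
Proof. by mfun. Qed.

Let int_k N : \int[pi']_y (k N * (g y + Cbe))%:E <= (be ^+ N * E)%:E.
Proof.
have e0 : \int[pi']_y (k N * (g y + Cbe))%:E =
    (k N * Cbe)%:E + (k N)%:E * \int[pi']_y (g y)%:E.
  rewrite -(integral_affine pi' (mulr_ge0 (k0 N) Cbe0) (k0 N)); last 2 first.
  - exact/measurable_EFinP.
  - by move=> y; rewrite lee_fin expR_ge0.
  by apply: eq_integral => y _; rewrite -EFinM -EFinD; congr EFin; ring.
have -> : (be ^+ N * E = k N * Cbe + k N * (1 + Cbe))%R by rewrite /E /k; move: Cbe => cb; field; rewrite gt_eqF.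
rewrite e0 EFinD leeD2l// [leRHS]EFinM; apply: lee_wpmul2l; last exact: other_exp.
by rewrite lee_fin.
Qed.

Let intF_le N : \int[pi']_y Fn N (y, z) <= wbar pi + (be ^+ N * E)%:E.
Proof.
apply: (@le_trans _ _ (\int[pi']_y ((fine (wbar pi))%:E + 1%:E * (k N * (g y + Cbe))%:E))).
  apply: le_int.
  - exact: Fn_measurable1.
  - by apply: emeasurable_funD => //; exact: measurable_funeM.
  - by move=> y; exact: Fn_ge0.
  move=> y; rewrite mul1e fineK//.
  exact: (Fn_le_wbar th0 be01 rho00 drift pz sz).
rewrite (integral_affine pi'); last 4 first.
- by apply: fine_ge0; exact: wbar_ge0.
- by [].
- exact: mk.
- by move=> y; rewrite lee_fin mulr_ge0// addr_ge0// expR_ge0.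
by rewrite fineK// mul1e leeD2l.
Qed.

Let intF_ge N : wbar pi <= \int[pi']_y Fn N (y, z) + (be ^+ N * E)%:E.
Proof.
apply: (@le_trans _ _ (\int[pi']_y (Fn N (y, z) + (k N * (g y + Cbe))%:E))).
  rewrite -[leLHS](fineK wf) -[leLHS](integral_cstP pi').
  apply: le_int.
  - exact: measurable_cst.
  - by apply: emeasurable_funD => //; exact: Fn_measurable1.
  - by move=> y; rewrite lee_fin; apply: fine_ge0; exact: wbar_ge0.
  move=> y; rewrite fineK//.
  exact: (wbar_le_Fn th0 be01 rho00 drift pz sz).
rewrite (ge0_integralD _ measurableT)//; last 3 first.
- by move=> o _; exact: Fn_ge0.
- exact: (Fn_measurable1 U V N z).
- by move=> y _; rewrite lee_fin mulr_ge0// addr_ge0// expR_ge0.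
by rewrite leeD2l.
Qed.

Lemma wbar_lip_ordered : (`|fine (wbar pi) - fine (wbar pi')| <= Del * (C1 * (1 + Cbe) * Cbe))%R.
Proof.
have [b0 b1] := andP be01.
have -> : (Del * (C1 * (1 + Cbe) * Cbe) = K * Cbe)%R by rewrite /K; ring.
have b01 : (0 <= be < 1)%R by rewrite ltW.
rewrite ler_distlC; apply/andP; split; last first.
  apply: (le_geometric b01 (c := E)) => N.
  rewrite -lee_fin fineK//; apply: (le_trans (telescope_up N)).
  rewrite [leRHS](_ : _ = (fine (wbar pi) + be ^+ N * E)%:E + (K * Cbe)%:E); last first.
    by rewrite -EFinD addrAC.
  apply: leeD; last by rewrite lee_fin; exact: Kle.
  by apply: (le_trans (intF_le N)); rewrite [leRHS]EFinD fineK.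
rewrite lerBlDr; apply: (le_geometric b01 (c := E)) => N.
rewrite -lee_fin fineK//; apply: (le_trans (intF_ge N)).
rewrite [leRHS]EFinD; apply: leeD => //; apply: (le_trans (telescope_down N)).
by rewrite [leRHS]EFinD fineK// leeD2l// lee_fin.
Qed.

End ordered.

Lemma wbar_lip (z z' : R * R) (pi pi' : probability R R) : par z -> par z' ->
  stationary z pi -> stationary z' pi' ->
  (`|fine (wbar pi) - fine (wbar pi')| <=
    (`|z.1 - z'.1| + `|z.2 - z'.2|) * (C1 * (1 + Cbe) * Cbe))%R.
Proof.
move=> pz pz' sz sz'; case/orP: (le_total z'.2 z.2) => h.
  exact: wbar_lip_ordered.
rewrite distrC (distrC z.1%R) (distrC z.2%R); exact: wbar_lip_ordered.
Qed.

End lipschitz.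

(** * Consequences of the light-tail assumption *)

Section light_tail_facts.
Local Open Scope ereal_scope.
Context {R : realType} {d : measure_display} {Om : measurableType d}.
Variables (P : probability Om R) (U V : nat -> {RV P >-> R}) (q : queue_model R).
Variables (eta gamma : R).
Hypothesis hUV : primitives_ok U V.
Hypothesis hq : model_ok q.
Hypothesis hmono : {in `[p_lo q, p_hi q] &, {homo lam q : r s /~ (r <= s)%R}}.
Hypothesis hlam : (lam q (p_lo q) < mu_lo q)%R.

Lemma mgfE (Z : Om -> R) t : 'M_P Z t = \int[P]_o (expR (t * Z o))%:E.
Proof.
rewrite /mmt_gen_fun unlock; apply: eq_integral => o _ /=.
by congr (expR _)%:E; rewrite /= mulrC.
Qed.

Lemma log_mgf_lt (Z : {RV P >-> R}) t c : log_mgf P Z t < c%:E ->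
  \int[P]_o (expR (t * Z o))%:E <= (expR c)%:E.
Proof.
rewrite /log_mgf mgfE; set I := (\int[P]_o _).
have : 0 <= I by apply: integral_ge0 => o _; rewrite lee_fin expR_ge0.
case: I => [r| |]//; rewrite lee_fin => r0.
case: (ltgtP 0%R r) r0 => // [rp _|<- _].
  by rewrite lne_EFin// lte_fin lee_fin => h; rewrite -(lnK rp) ler_expR ltW.
by rewrite lee_fin expR_ge0.
Qed.

Definition smax : R := (mu_lo q)^-1.
Definition rmin : R := (lam q (p_lo q))^-1.
Definition zq (x : R * R) : R * R := (x.1^-1, (lam q x.2)^-1)%R.

Let ml0 : (0 < mu_lo q)%R. Proof. exact: (box_mu_gt0 hq (box_lo hq)). Qed.
Let rh0 : (0 < lam q (p_lo q))%R. Proof. exact: (box_lam_gt0 hq (box_lo hq)). Qed.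

Lemma rmin_gt0 : (0 < rmin)%R. Proof. by rewrite invr_gt0. Qed.

Lemma par_zq x : box q x -> par smax rmin (zq x).
Proof.
move=> bx; have m0 := box_mu_gt0 hq bx; have l0 := box_lam_gt0 hq bx.
split; rewrite /zq /=.
- by rewrite invr_ge0 ltW.
- by rewrite lef_pV2 ?posrE//; case: bx.
- by rewrite lef_pV2 ?posrE//; exact: (box_lam_le hq hmono).
Qed.

Lemma texp_zq th x : box q x -> texp th (zq x) = (th * lam q x.2)%R.
Proof. by move=> bx; rewrite /texp /zq/= invrK. Qed.

Lemma U0_ge0 o : (0 <= U 0%N o)%R. Proof. exact: U_ge0 hUV 0%N o. Qed.
Lemma V0_ge0 o : (0 <= V 0%N o)%R. Proof. exact: V_ge0 hUV 0%N o. Qed.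

Lemma integral_prod_UV (f g : R -> R) : measurable_fun setT f -> measurable_fun setT g ->
  (forall y, 0 <= f y)%R -> (forall y, 0 <= g y)%R ->
  \int[P]_o (f (U 0%N o) * g (V 0%N o))%:E =
  \int[P]_o (f (U 0%N o))%:E * \int[P]_o (g (V 0%N o))%:E.
Proof.
move=> mf mg f0 g0.
pose h (z : R * R) : \bar R := (f z.1 * g z.2)%:E.
have mh : measurable_fun setT h.
  apply/measurable_EFinP; apply: measurable_funM.
    exact: (measurableT_comp mf measurable_fst).
  exact: (measurableT_comp mg measurable_snd).
have iU : info_fun U V [set 0%N] set0 (U 0%N) by move=> B mB; exact: infoU.
have h0 z : 0 <= h z by rewrite lee_fin mulr_ge0.
have nn : ~ (set0 : set nat) 0%N by [].
transitivity (\int[P]_o h (U 0%N o, V 0%N o)); first by [].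
rewrite (freezeV hUV nn iU mh h0).
have mgV : measurable_fun setT (fun o => (g (V 0%N o))%:E).
  by apply/measurable_EFinP; exact: measurableT_comp.
have mfU : measurable_fun setT (fun o => (f (U 0%N o))%:E).
  by apply/measurable_EFinP; exact: measurableT_comp.
rewrite -ge0_integralZr//; last 2 first.
- by move=> o _; rewrite lee_fin.
- by apply: integral_ge0 => o _; rewrite lee_fin.
apply: eq_integral => o _; rewrite /h/=.
by under eq_integral do rewrite EFinM; rewrite ge0_integralZl_EFin// => o' _; rewrite lee_fin.
Qed.

Lemma integral_U0 : \int[P]_o (U 0%N o)%:E = 1.
Proof. by case: hUV => _ _ _ _ /(_ 0%N)[+ _]; rewrite unlock. Qed.

Section constants.
Variables (th a : R).
Hypothesis th_eta : (0 < th < eta / (2 * mu_hi q))%R.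
Hypothesis ha : (0 < a < (mu_lo q - lam q (p_lo q)) / (mu_lo q + lam q (p_lo q)))%R.
Hypothesis hU : log_mgf P (U 0%N) (- th) < (- (1 - a) * th - gamma)%:E.
Hypothesis hV : log_mgf P (V 0%N) th < ((1 + a) * th - gamma)%:E.
Hypothesis gamma0 : (0 < gamma)%R.
Let be := expR (- gamma).
Let th0 : (0 < th)%R. Proof. by case/andP: th_eta. Qed.

Lemma be01 : (0 < be < 1)%R.
Proof. by rewrite expR_gt0/= expR_lt1 oppr_lt0. Qed.

Lemma a_lt1 : (a < 1)%R.
Proof.
case/andP: ha => _ h; apply: (lt_le_trans h).
by rewrite ler_pdivrMr ?addr_gt0//; have := rh0; lra.
Qed.

Lemma laplace_U : \int[P]_o (expR (- th * U 0%N o))%:E <= (expR (- (1 - a) * th - gamma))%:E.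
Proof. exact: log_mgf_lt. Qed.
Lemma mgf_V : \int[P]_o (expR (th * V 0%N o))%:E <= (expR ((1 + a) * th - gamma))%:E.
Proof. exact: log_mgf_lt. Qed.

Lemma no_stuck : P (stuck U) = 0.
Proof.
apply: (stuck_null hUV th0 (b := expR (- (1 - a) * th - gamma))); last exact: laplace_U.
rewrite expR_lt1; have := a_lt1 => a1.
have h : (0 < (1 - a) * th)%R by rewrite mulr_gt0// subr_gt0.
by rewrite mulNr -opprD oppr_lt0 addr_gt0.
Qed.

Let B := ((1 + a) * th - gamma)%R.
Lemma B_ge0 : (0 <= B)%R.
Proof.
have : (1%:E <= (expR B)%:E).
  apply: le_trans mgf_V; rewrite -[leLHS](integral_cstP P); apply: le_int => //.
  - by mfun.
  - by move=> o; rewrite lee_fin -[leLHS]expR0 ler_expR; apply: mulr_ge0; [exact: ltW|exact: V0_ge0].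
by rewrite lee_fin -[X in (X <= _)%R]expR0 ler_expR.
Qed.

(** Jensen's inequality for the power [kap], obtained by integrating [expR_convex] at the point
    [th * V - B], whose exponential has mean at most 1. *)
Lemma mgf_V_power kap : (0 <= kap <= 1)%R ->
  \int[P]_o (expR (th * kap * V 0%N o))%:E <= (expR (kap * B))%:E.
Proof.
move=> /andP[k0 k1].
have m1 : measurable_fun setT (fun o => (expR (th * V 0%N o - B))%:E) by mfun.
apply: (@le_trans _ _ (\int[P]_o ((expR (kap * B))%:E *
   ((1 - kap)%:E + kap%:E * (expR (th * V 0%N o - B))%:E)))).
  apply: le_int.
  - by mfun.
  - by apply: measurable_funeM; apply: emeasurable_funD => //; exact: measurable_funeM.
  - by move=> o; rewrite lee_fin expR_ge0.
  move=> o; rewrite -(EFinM kap) -(EFinD (1 - kap)) -EFinM lee_fin.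
  have -> : (th * kap * V 0%N o = kap * B + kap * (th * V 0%N o - B))%R by ring.
  rewrite expRD; apply: ler_wpM2l; first exact: expR_ge0.
  by rewrite [leRHS]addrC; apply: expR_convex; rewrite k0.
have k1' : (0 <= 1 - kap)%R by rewrite subr_ge0.
rewrite (ge0_integralZl_EFin _ measurableT); last 3 first.
- by move=> o _; rewrite adde_ge0 ?mule_ge0 ?lee_fin ?expR_ge0.
- by apply: emeasurable_funD => //; exact: measurable_funeM.
- exact: expR_ge0.
rewrite (integral_affine P k1' k0 m1); last by move=> o; rewrite lee_fin expR_ge0.
rewrite -[leRHS]mule1; apply: lee_wpmul2l; first by rewrite lee_fin expR_ge0.
have i1 : \int[P]_o (expR (th * V 0%N o - B))%:E <= 1.
  have -> : \int[P]_o (expR (th * V 0%N o - B))%:E =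
     (expR (- B))%:E * \int[P]_o (expR (th * V 0%N o))%:E.
    rewrite -(ge0_integralZl_EFin _ measurableT).
    - by apply: eq_integral => o _; rewrite -EFinM -expRD addrC.
    - by move=> o _; rewrite lee_fin expR_ge0.
    - by mfun.
    - exact: expR_ge0.
  apply: (@le_trans _ _ ((expR (- B))%:E * (expR B)%:E)).
    by apply: lee_wpmul2l; [rewrite lee_fin expR_ge0|exact: mgf_V].
  by rewrite -EFinM -expRD addrC subrr expR0.
apply: (@le_trans _ _ ((1 - kap)%:E + kap%:E * 1)).
  by apply: leeD2l; apply: lee_wpmul2l.
by rewrite mule1 -EFinD lee_fin; lra.
Qed.

Let kmax := (smax / rmin)%R.
Lemma kmaxE : kmax = (lam q (p_lo q) / mu_lo q)%R.
Proof. by rewrite /kmax /smax /rmin invrK mulrC. Qed.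
Lemma kmax_ge0 : (0 <= kmax)%R.
Proof. by rewrite kmaxE divr_ge0// ltW. Qed.
Lemma kmax_lt1 : (kmax < 1)%R.
Proof. by rewrite kmaxE ltr_pdivrMr// mul1r. Qed.
(** A rearrangement of the upper bound on [a]: this is where the fraction (mu - lam) / (mu + lam) in
    the assumption comes from. *)
Lemma kmax_a : ((1 + a) * kmax <= 1 - a)%R.
Proof.
rewrite kmaxE mulrA ler_pdivrMr//.
case/andP: ha => _; rewrite ltr_pdivlMr ?addr_gt0//; have := rh0; have := ml0; lra.
Qed.

(** The factor of U has logarithm at most -(1 - a) th - gamma. The factor of V carries the traffic
    intensity [kap <= kmax] as a power, so its logarithm is at most kmax (1 + a) th <= (1 - a) th.
    What remains is -gamma. *)
Lemma drift_be z : par smax rmin z ->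
  \int[P]_o (expR (texp th z * (V 0%N o * z.1 - U 0%N o * z.2)))%:E <= be%:E.
Proof.
move=> pz; have z20 := par2_gt0 rmin_gt0 pz.
pose kap := (z.1 / z.2)%R.
have kk : (0 <= kap <= kmax)%R.
  case: pz => h1 h2 h3; apply/andP; split; first by rewrite /kap divr_ge0// ltW.
  rewrite /kap /kmax; apply: ler_pM => //; first by rewrite invr_ge0 ltW.
  by rewrite lef_pV2 ?posrE ?rmin_gt0.
have [k0 k1] := andP kk.
have kap1 : (0 <= kap <= 1)%R by rewrite k0 (le_trans k1)// ltW// kmax_lt1.
have E o : (expR (texp th z * (V 0%N o * z.1 - U 0%N o * z.2)) =
    expR (- th * U 0%N o) * expR (th * kap * V 0%N o))%R.
  by rewrite -expRD /texp /kap; congr expR; field; rewrite gt_eqF.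
under eq_integral do rewrite E.
rewrite (integral_prod_UV (f := fun y => expR (- th * y)) (g := fun y => expR (th * kap * y))); last 4 first.
- by mfun.
- by mfun.
- by move=> y; exact: expR_ge0.
- by move=> y; exact: expR_ge0.
apply: (@le_trans _ _ ((expR (- (1 - a) * th - gamma))%:E * (expR (kap * B))%:E)).
  apply: lee_pmul.
  - by apply: integral_ge0 => o _; rewrite lee_fin expR_ge0.
  - by apply: integral_ge0 => o _; rewrite lee_fin expR_ge0.
  - exact: laplace_U.
  - exact: mgf_V_power.
rewrite -EFinM -expRD lee_fin ler_expR.
have h1 : (kap * B <= kmax * B)%R by rewrite ler_wpM2r// B_ge0.
have h2 : (kmax * B <= kmax * ((1 + a) * th))%R by rewrite ler_wpM2l ?kmax_ge0// /B gerBl ltW.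
have h3 : ((1 + a) * kmax * th <= (1 - a) * th)%R by rewrite ler_wpM2r ?kmax_a// ltW.
have h4 : (kmax * ((1 + a) * th) = (1 + a) * kmax * th)%R by ring.
have h5 : (kap * B <= (1 - a) * th)%R by rewrite (le_trans h1)// (le_trans h2)// h4.
rewrite mulNr; move: (kap * B)%R ((1 - a) * th)%R h5 => ? ?; lra.
Qed.

(** The gap [e] between [th] and [th * kmax] absorbs the factor V, by e V <= exp(e V); the factor U
    is independent of the exponential and has mean 1. *)
Lemma mom_fin : exists C1 : R,
  \int[P]_o ((U 0%N o + V 0%N o) * expR (th * (smax / rmin) * V 0%N o))%:E <= C1%:E.
Proof.
pose e := (th * (1 - kmax))%R.
have e0 : (0 < e)%R by rewrite mulr_gt0// subr_gt0 kmax_lt1.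
exists (expR (kmax * B) + e^-1 * expR B)%R.
have kk : (0 <= kmax <= 1)%R by rewrite kmax_ge0 ltW// kmax_lt1.
have mV : measurable_fun setT (fun o => (expR (th * V 0%N o))%:E) by mfun.
apply: (@le_trans _ _ (\int[P]_o ((U 0%N o * expR (th * kmax * V 0%N o))%:E +
    e^-1%:E * (expR (th * V 0%N o))%:E))).
  apply: le_int.
  - by mfun.
  - by apply: emeasurable_funD; [mfun|exact: measurable_funeM].
  - by move=> o; rewrite lee_fin mulr_ge0 ?expR_ge0// addr_ge0// ?U0_ge0 ?V0_ge0.
  move=> o; rewrite -EFinM -EFinD lee_fin mulrDl lerD2l ler_pdivlMl//.
  have -> : (th * V 0%N o = e * V 0%N o + th * kmax * V 0%N o)%R by rewrite /e; ring.
  rewrite expRD [leLHS]mulrA; apply: ler_wpM2r; first exact: expR_ge0.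
  by apply: le_trans (expR_ge1Dx _); rewrite lerDr.
rewrite (ge0_integralD _ measurableT); last 4 first.
- by move=> o _; rewrite lee_fin mulr_ge0 ?expR_ge0// U0_ge0.
- by mfun.
- by move=> o _; apply: mule_ge0; rewrite lee_fin ?expR_ge0// invr_ge0 ltW.
- exact: measurable_funeM.
rewrite EFinD; apply: leeD.
  pose f (y : R) := Num.max 0%R y.
  have fU o : (U 0%N o = f (U 0%N o))%R by rewrite /f max_r// U0_ge0.
  under eq_integral do rewrite fU.
  rewrite (integral_prod_UV (g := fun y => expR (th * kmax * y))); last 4 first.
  - by rewrite /f; mfun.
  - by mfun.
  - by move=> y; rewrite /f le_max lexx.
  - by move=> y; exact: expR_ge0.
  rewrite -[leRHS]mul1e; apply: lee_pmul.
  - by apply: integral_ge0 => o _; rewrite lee_fin /f le_max lexx.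
  - by apply: integral_ge0 => o _; rewrite lee_fin expR_ge0.
  - by under eq_integral do rewrite -fU; rewrite integral_U0.
  - exact: mgf_V_power.
rewrite (ge0_integralZl_EFin _ measurableT); last 3 first.
- by move=> o _; rewrite lee_fin expR_ge0.
- exact: mV.
- by rewrite invr_ge0 ltW.
by rewrite [leRHS]EFinM; apply: lee_wpmul2l; [rewrite lee_fin invr_ge0 ltW|exact: mgf_V].
Qed.

Lemma texp_lt x : box q x -> (texp th (zq x) < eta / 2)%R.
Proof.
move=> bx; rewrite texp_zq//.
have mh0 : (0 < mu_hi q)%R by case: hq => /andP[_ h] _ _ _; exact: lt_trans h.
have h1 : (lam q x.2 < mu_hi q)%R.
  apply: (le_lt_trans (box_lam_le hq hmono bx)); apply: (lt_trans hlam).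
  by case: hq => /andP[_ h].
case/andP: th_eta => _; rewrite ltr_pdivlMr ?mulr_gt0// => h2.
rewrite ltr_pdivlMr//; apply: le_lt_trans h2.
by rewrite mulrA mulrAC ler_wpM2l ?mulr_ge0// ?ltW.
Qed.

End constants.
End light_tail_facts.

(** The continuous [g] is bounded by some [K] on the compact interval. One-sided quotients bounded
    by [K + 1] near each point give continuity of [f] up to the end points, and the mean value
    theorem then applies with derivative [g] inside. *)
Lemma C1_on_lipschitz {R : realType} (f : R -> R) (a b : R) : a < b -> C1_on f a b ->
  exists K, forall r s, r \in `[a, b] -> s \in `[a, b] -> `|f r - f s| <= K * `|r - s|.
Proof.
move=> ab [g [cg hg]].
have Q r e : r \in `[a, b] -> 0 < e -> exists2 dl, 0 < dl &
    forall s, s \in `[a, b] -> s != r -> `|r - s| < dl -> `|g r - (f s - f r) / (s - r)| < e.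
  rewrite in_itv/= => rab e0.
  have /cvgrPdist_lt/(_ e e0) := hg r rab.
  rewrite /within/= => /nbhs_ballP[dl /= dl0 hdl].
  by exists dl => // s sab sr rs; apply: hdl.
have [c1 c1P g1] := EVT_max (ltW ab) cg.
have [c2 c2P g2] := EVT_min (ltW ab) cg.
pose K := Num.max (g c1) (- g c2).
have gK r : r \in `[a, b] -> `|g r| <= K.
  move=> rab; rewrite ler_norml /K; apply/andP; split.
    by rewrite lerNl le_max lerN2 g2// orbT.
  by rewrite le_max g1.
have cf : {within `[a, b], continuous f}.
  apply/subspace_continuousP => r rab; apply/cvgrPdist_lt => e e0.
  have rab' : r \in `[a, b] by [].
  have [dl dl0 hdl] := Q r 1 rab' ltr01.
  have K1 : 0 < K + 1 by rewrite ltr_wpDl// (le_trans _ (gK r rab')).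
  rewrite /within/=; apply/nbhs_ballP; exists (Num.min dl (e / (K + 1))).
    by rewrite /= lt_min dl0 divr_gt0.
  move=> s /=; rewrite /ball/= lt_min => /andP[rs1 rs2] sab.
  have [->|sr] := eqVneq s r; first by rewrite subrr normr0.
  have h1 := hdl s sab sr rs1.
  have sr0 : 0 < `|s - r| by rewrite normr_gt0 subr_eq0.
  have h2 : `|(f s - f r) / (s - r)| < K + 1.
    have := ler_normD (g r) ((f s - f r) / (s - r) - g r).
    rewrite [X in `|X| <= _ -> _](_ : _ = (f s - f r) / (s - r)); last by ring.
    by have := gK r rab'; rewrite (distrC _ (g r)); lra.
  rewrite normrM normfV ltr_pdivrMr// in h2.
  rewrite distrC (lt_trans h2)// mulrC -ltr_pdivlMr//.
  by rewrite distrC.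
exists K => r s.
wlog rs : r s / r < s.
  move=> h rab sab; case: (ltgtP r s) => rs; first exact: h.
    by rewrite distrC (distrC r); exact: h.
  by rewrite rs !subrr normr0 mulr0.
move=> rab sab; have := rab; have := sab; rewrite !in_itv/= => /andP[as_ sb] /andP[ar rb].
have sub : `[r, s]%classic `<=` `[a, b]%classic.
  by move=> y /=; rewrite !in_itv/= => /andP[h1 h2]; rewrite (le_trans ar h1) (le_trans h2 sb).
have dv y : y \in `]r, s[ -> is_derive y 1 f (g y).
  rewrite in_itv/= => /andP[ry ys].
  have yab : y \in `[a, b] by rewrite in_itv/= (le_trans ar (ltW ry)) (le_trans (ltW ys) sb).
  have cv : h^-1 *: ((f \o shift y) (h *: 1) - f y) @[h --> 0^'] --> g y.
    rewrite (_ : (fun h => _) = (fun h => (f (h + y) - f y) / h)); last first.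
      by apply/funext => h; rewrite /= /GRing.scale/= mulr1 mulrC.
    apply/cvgrPdist_lt => e e0; have [dl dl0 hdl] := Q y e yab e0.
    rewrite /dnbhs/within/=; apply/nbhs_ballP.
    exists (Num.min dl (Num.min (y - r) (s - y))).
      by rewrite /= !lt_min dl0 !subr_gt0 ry.
    move=> h /=; rewrite /ball/= sub0r normrN !lt_min => /and3P[h1 h2 h3] h0.
    have := hdl (h + y); rewrite addrK; apply.
    - move: h2 h3; rewrite !ltr_norml in_itv/= => /andP[h21 h22] /andP[h31 h32].
      by apply/andP; split; lra.
    - by rewrite -subr_eq0 addrK.
    - by rewrite opprD addrCA subrr addr0 normrN.
  by split; [exact: cvgP cv|exact: cvg_lim cv].
have [c crs e] := MVT rs dv (continuous_subspaceW sub cf).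
have cab : c \in `[a, b].
  move: crs; rewrite !in_itv/= => /andP[h1 h2].
  by rewrite (le_trans ar (ltW h1)) (le_trans (ltW h2) sb).
rewrite distrC e normrM (distrC r); apply: ler_wpM2r => //.
exact: (gK c cab).
Qed.

(** * The mean stationary waiting time as a function of the policy *)

Section mean_wait.
Local Open Scope ereal_scope.
Context {R : realType} {d : measure_display} {Om : measurableType d}.
Variables (P : probability Om R) (U V : nat -> {RV P >-> R}) (q : queue_model R).
Variable Winf : R -> R -> probability R R.
Hypothesis hUV : primitives_ok U V.
Hypothesis hq : model_ok q.
Hypothesis hmono : {in `[p_lo q, p_hi q] &, {homo lam q : r s /~ (r <= s)%R}}.
Hypothesis hWinf : forall mu p, box q (mu, p) -> steady_state U V mu (lam q p) (Winf mu p).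
Variables (th be C1 Ll eta : R).
Hypothesis th0 : (0 < th)%R.
Hypothesis be01 : (0 < be < 1)%R.
Hypothesis drift : forall z, par (smax q) (rmin q) z ->
  \int[P]_o (expR (texp th z * (V 0%N o * z.1 - U 0%N o * z.2)))%:E <= be%:E.
Hypothesis mom :
  \int[P]_o ((U 0%N o + V 0%N o) * expR (th * (smax q / rmin q) * V 0%N o))%:E <= C1%:E.
Hypothesis lamL : forall r s, r \in `[p_lo q, p_hi q] -> s \in `[p_lo q, p_hi q] ->
  (`|lam q r - lam q s| <= Ll * `|r - s|)%R.
Hypothesis texp_eta : forall x, box q x -> (texp th (zq q x) <= eta)%R.
Local Notation Cbe := ((1 - be)^-1)%R.
Local Notation Fn := (Fn (U 0%N) (V 0%N)).
Local Notation zq := (zq q).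

Definition wq (x : R * R) : R := fine (wbar (Winf x.1 x.2)).
Let lmin := lam q (p_hi q).
Let lmin0 : (0 < lmin)%R.
Proof. by case: hq => _ _ _; apply; exact: p_hi_itv. Qed.
Let ml0 : (0 < mu_lo q)%R. Proof. exact: (box_mu_gt0 hq (box_lo hq)). Qed.
Let rm0 := rmin_gt0 hq.
Let Cbe0 : (0 <= Cbe)%R. Proof. by rewrite invr_ge0 subr_ge0; case/andP: be01 => _ /ltW. Qed.

Lemma stationary_Winf x : box q x -> stationary (U 0%N) (V 0%N) (zq x) (Winf x.1 x.2).
Proof. by case: x => m p /hWinf. Qed.

Lemma wq_fin x : box q x -> (wq x)%:E = wbar (Winf x.1 x.2).
Proof.
move=> bx; rewrite fineK//.
exact: (wbar_fin th0 be01 rm0 drift (par_zq hq hmono bx) (stationary_Winf bx)).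
Qed.

Lemma wq_Rintegral x : box q x -> (\int[Winf x.1 x.2]_w w)%R = wq x.
Proof.
move=> bx; rewrite /Rintegral /wq /wbar; congr fine.
apply: ae_eq_integral => //.
  by mfun.
exists [set y : R | (y < 0)%R]; split.
- by apply: measurable_set_lt; [exact: measurable_id|exact: measurable_cst].
- exact: (stationary_lt0 (stationary_Winf bx)).
move=> y /= h; rewrite ltNge; apply/negP => y0; apply: h => _.
by rewrite max_r.
Qed.

Lemma wq_ge0 x : (0 <= wq x)%R.
Proof. by apply: fine_ge0; exact: wbar_ge0. Qed.

(** All exponents [texp th (zq x)] are at least [th * lmin]. The extra 1 lets the same constant
    bound both [wq] and the factor in front of [expR (eta * y)] in the transient error. *)
Definition cF : R := ((1 + Cbe) / (th * lmin))%R.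

Lemma cF_ge0 : (0 <= cF)%R.
Proof. by rewrite divr_ge0// ?mulr_ge0// ?addr_ge0// ltW. Qed.

Let inv_texp x : box q x -> ((texp th (zq x))^-1 <= (th * lmin)^-1)%R.
Proof.
move=> bx; rewrite texp_zq// lef_pV2 ?posrE ?mulr_gt0//; last exact: (box_lam_gt0 hq bx).
by rewrite ler_pM2l//; exact: (box_lam_ge hq hmono).
Qed.

Lemma wq_le x : box q x -> (wq x <= cF)%R.
Proof.
move=> bx; rewrite -lee_fin wq_fin//.
apply: (le_trans (wbar_le th0 be01 rm0 drift (par_zq hq hmono bx) (stationary_Winf bx))).
rewrite lee_fin /cF; apply: ler_pM => //.
- by rewrite invr_ge0 ltW// (texp_gt0 th0 rm0 (par_zq hq hmono bx)).
- by rewrite lerDr.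
- exact: inv_texp.
Qed.

Let err_le n y x : box q x -> (0 <= y)%R ->
  (be ^+ n / texp th (zq x) * (expR (texp th (zq x) * y) + Cbe) <= be ^+ n * cF * expR (eta * y))%R.
Proof.
move=> bx y0; have := texp_gt0 th0 rm0 (par_zq hq hmono bx).
have := inv_texp bx; have := texp_eta bx; move: (texp th (zq x)) => t te it t0.
rewrite /cF -!mulrA ler_wpM2l ?exprn_ge0//; first by case/andP: be01 => /ltW.
rewrite mulrC [leRHS](_ : _ = ((1 + Cbe) * expR (eta * y)) * (th * lmin)^-1)%R; last by ring.
apply: ler_pM.
- by rewrite addr_ge0// expR_ge0.
- by rewrite invr_ge0 ltW.
- rewrite [leRHS]mulrDl mul1r; apply: lerD.
    by rewrite ler_expR; apply: ler_wpM2r.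
  apply: ler_peMr => //; rewrite -[leLHS]expR0 ler_expR mulr_ge0//.
  by apply: le_trans te; exact: ltW.
- exact: it.
Qed.

Lemma Fn_le_wq n y x : box q x -> (0 <= y)%R ->
  Fn n (y, zq x) <= (wq x + be ^+ n * cF * expR (eta * y))%:E.
Proof.
move=> bx y0.
apply: (le_trans (Fn_le_wbar th0 be01 rm0 drift (par_zq hq hmono bx) (stationary_Winf bx) n y)).
by rewrite EFinD wq_fin// leeD2l// lee_fin; exact: err_le.
Qed.

Lemma wq_le_Fn n y x : box q x -> (0 <= y)%R ->
  (wq x)%:E <= Fn n (y, zq x) + (be ^+ n * cF * expR (eta * y))%:E.
Proof.
move=> bx y0; rewrite wq_fin//.
apply: (le_trans (wbar_le_Fn th0 be01 rm0 drift (par_zq hq hmono bx) (stationary_Winf bx) n y)).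
by rewrite leeD2l// lee_fin; exact: err_le.
Qed.

Lemma zq_measurable {d'} {T : measurableType d'} (X : T -> R * R) : measurable_fun setT X ->
  (forall o, box q (X o)) -> measurable_fun setT (fun o => zq (X o)).
Proof.
move=> mX bX; apply: measurable_fun_pair.
  exact: (box_muV_measurable hq mX bX).
exact: (box_lamV_measurable hq hmono mX bX).
Qed.

(** [Winf] is an arbitrary choice of stationary laws, with no measurability in the policy.
    Measurability of the mean comes from the geometric convergence of the measurable functions
    [Fn n] started at 0. *)
Lemma wq_measurable {d'} {T : measurableType d'} (X : T -> R * R) : measurable_fun setT X ->
  (forall o, box q (X o)) -> measurable_fun setT (fun o => wq (X o)).
Proof.
move=> mX bX.
have mF n : measurable_fun setT (fun o => fine (Fn n (0%R, zq (X o)))).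
  apply: (measurableT_comp (@fine_measurable R setT measurableT)).
  apply: (measurableT_comp (Fn_measurable (U 0%N) (V 0%N) n)).
  by apply: measurable_fun_pair => //; exact: zq_measurable.
apply: (@measurable_fun_cvg _ _ _ setT (fun n o => fine (Fn n (0%R, zq (X o)))) _ mF) => o _.
have [b0 b1] := andP be01.
have Ff n : Fn n (0%R, zq (X o)) \is a fin_num.
  rewrite ge0_fin_numE ?Fn_ge0//; apply: le_lt_trans (Fn_le_wq n (bX o) (lexx 0%R)) _.
  by rewrite ltry.
have bd n : (`|wq (X o) - fine (Fn n (0%R, zq (X o)))| <= be ^+ n * cF)%R.
  have h1 := Fn_le_wq n (bX o) (lexx 0%R); have h2 := wq_le_Fn n (bX o) (lexx 0%R).
  move: h1 h2; rewrite -(fineK (Ff n)) -EFinD !lee_fin mulr0 expR0 mulr1 => h1 h2.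
  by rewrite ler_norml; apply/andP; split; lra.
apply/cvgrPdist_le => /= e e0.
have cv : (fun n => be ^+ n * cF)%R @ \oo --> (0 : R)%R.
  rewrite -[X in _ --> X](mul0r cF); apply: cvgMl.
  by apply: cvg_expr; rewrite ger0_norm// ltW.
move/cvgrPdist_le: cv => /(_ e e0); apply: filterS => n.
rewrite sub0r normrN; apply: le_trans; apply: (le_trans (bd n)); exact: ler_norm.
Qed.

Let C10 : (0 <= C1)%R.
Proof.
rewrite -lee_fin; apply: le_trans mom; apply: integral_ge0 => o _.
by rewrite lee_fin mulr_ge0 ?expR_ge0// addr_ge0 ?(U0_ge0 hUV) ?(V0_ge0 hUV).
Qed.

Lemma inv_dist (a b c : R) : (0 < c)%R -> (c <= a)%R -> (c <= b)%R ->
  (`|a^-1 - b^-1| <= `|a - b| * c^-1 * c^-1)%R.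
Proof.
move=> c0 ca cb; have a0 := lt_le_trans c0 ca; have b0 := lt_le_trans c0 cb.
have -> : (a^-1 - b^-1 = (b - a) * a^-1 * b^-1)%R by field; rewrite !gt_eqF.
rewrite !normrM distrC !normfV (gtr0_norm a0) (gtr0_norm b0).
apply: ler_pM; rewrite ?mulr_ge0 ?invr_ge0 ?(ltW a0) ?(ltW b0)//.
  by rewrite ler_wpM2l// lef_pV2 ?posrE.
by rewrite lef_pV2 ?posrE.
Qed.

Definition Lw : R := ((Num.max 1 Ll * ((mu_lo q)^-1 ^+ 2 + lmin^-1 ^+ 2)) *
  (C1 * (1 + Cbe) * Cbe))%R.

Lemma wq_lip x y : box q x -> box q y ->
  (`|wq x - wq y| <= (`|x.1 - y.1| + `|x.2 - y.2|) * Lw)%R.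
Proof.
move=> bx bY.
apply: (le_trans (wbar_lip (U0_ge0 hUV) (V0_ge0 hUV) th0 be01 rm0 drift mom
   (par_zq hq hmono bx) (par_zq hq hmono bY) (stationary_Winf bx) (stationary_Winf bY))).
rewrite /Lw [leRHS]mulrA; apply: ler_wpM2r.
  by rewrite !mulr_ge0// addr_ge0.
have h1 : (`|(zq x).1 - (zq y).1| <= `|x.1 - y.1| * (mu_lo q)^-1 * (mu_lo q)^-1)%R.
  by apply: inv_dist => //; [case: bx|case: bY].
have h2 : (`|(zq x).2 - (zq y).2| <= `|lam q x.2 - lam q y.2| * lmin^-1 * lmin^-1)%R.
  by apply: inv_dist => //; exact: (box_lam_ge hq hmono).
have h3 : (`|lam q x.2 - lam q y.2| <= Num.max 1 Ll * `|x.2 - y.2|)%R.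
  apply: (le_trans (lamL (box_price bx) (box_price bY))).
  by rewrite ler_wpM2r// le_max lexx orbT.
have h4 : (1 <= Num.max 1 Ll)%R by rewrite le_max lexx.
have p1 : (0 <= (mu_lo q)^-1 ^+ 2)%R by rewrite exprn_ge0// invr_ge0 ltW.
have p2 : (0 <= lmin^-1 ^+ 2)%R by rewrite exprn_ge0// invr_ge0 ltW.
move: (Num.max 1 Ll)%R h3 h4 => L h3 h4; have L0 : (0 <= L)%R by exact: le_trans ler01 h4.
have h1' : (`|(zq x).1 - (zq y).1| <= L * `|x.1 - y.1| * (mu_lo q)^-1 ^+ 2)%R.
  apply: (le_trans h1); rewrite -mulrA -expr2 ler_wpM2r//.
  by rewrite ler_peMl.
have h2' : (`|(zq x).2 - (zq y).2| <= L * `|x.2 - y.2| * lmin^-1 ^+ 2)%R.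
  by apply: (le_trans h2); rewrite -mulrA -expr2 ler_wpM2r.
have p3 : (0 <= L * `|x.1 - y.1| * lmin^-1 ^+ 2)%R by apply: mulr_ge0 => //; exact: mulr_ge0.
have p4 : (0 <= L * `|x.2 - y.2| * (mu_lo q)^-1 ^+ 2)%R by apply: mulr_ge0 => //; exact: mulr_ge0.
have -> : ((`|x.1 - y.1| + `|x.2 - y.2|) * (L * ((mu_lo q)^-1 ^+ 2 + lmin^-1 ^+ 2)) =
  L * `|x.1 - y.1| * (mu_lo q)^-1 ^+ 2 + L * `|x.1 - y.1| * lmin^-1 ^+ 2 +
  (L * `|x.2 - y.2| * (mu_lo q)^-1 ^+ 2 + L * `|x.2 - y.2| * lmin^-1 ^+ 2))%R by ring.
apply: lerD; first by rewrite (le_trans h1')// lerDl.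
by rewrite (le_trans h2')// lerDr.
Qed.

End mean_wait.

(** * Moments and transient behaviour *)

Section real_expectation.
Context {R : realType} {d : measure_display} {Om : measurableType d} (P : probability Om R).
Implicit Types (f g : Om -> R).

Definition L1 f := P.-integrable setT (EFin \o f).
Definition ex f : R := \int[P]_o f o.

Lemma L1_measurable f : L1 f -> measurable_fun setT f.
Proof. by move=> /measurable_int /measurable_EFinP. Qed.

Lemma exE f : L1 f -> (ex f)%:E = (\int[P]_o (f o)%:E)%E.
Proof. by move=> fi; rewrite /ex /Rintegral fineK//; exact: integrable_fin_num. Qed.

Lemma expectation_ex f : L1 f -> ('E_P[f] = (ex f)%:E)%E.
Proof. by move=> fi; rewrite exE// unlock. Qed.

Lemma L1_dom f g : measurable_fun setT f -> (forall o, `|f o| <= g o) -> L1 g -> L1 f.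
Proof.
move=> mf fg; apply: le_integrable => //; first exact/measurable_EFinP.
by move=> o _ /=; rewrite lee_fin (le_trans (fg o))// ler_norm.
Qed.

Lemma L1_cst r : L1 (fun=> r).
Proof. exact: finite_measure_integrable_cst. Qed.

Lemma ex_cst r : ex (fun=> r) = r.
Proof. by apply: EFin_inj; rewrite (exE (@L1_cst r)) (integral_cstP P). Qed.

Lemma L1D f g : L1 f -> L1 g -> L1 (fun o => f o + g o).
Proof. by move=> fi gi; have := integrableD measurableT fi gi; apply: eq_integrable. Qed.

Lemma L1Z r f : L1 f -> L1 (fun o => r * f o).
Proof. by move=> fi; have := integrableZl measurableT r fi; apply: eq_integrable. Qed.

Lemma L1N f : L1 f -> L1 (fun o => - f o).
Proof. by move=> /(L1Z (-1)); apply: eq_integrable => // o _ /=; rewrite mulN1r. Qed.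

Lemma L1B f g : L1 f -> L1 g -> L1 (fun o => f o - g o).
Proof. by move=> fi /L1N; exact: L1D. Qed.

Lemma L1_norm f : L1 f -> L1 (fun o => `|f o|).
Proof.
move=> fi; apply: (le_integrable _ _ _ (fi)) => //; last first.
  by move=> o _ /=; rewrite lee_fin normr_id.
apply/measurable_EFinP; apply: (measurableT_comp (@normr_measurable _ setT)).
exact: L1_measurable fi.
Qed.

Lemma L1_sum I (s : seq I) (Q : pred I) (F : I -> Om -> R) : (forall i, Q i -> L1 (F i)) ->
  L1 (fun o => \sum_(i <- s | Q i) F i o).
Proof.
move=> Fi; elim: s => [|i s IH].
  by under [X in L1 X]funext do rewrite big_nil; exact: L1_cst.
case Qi : (Q i).
  under [X in L1 X]funext do rewrite big_cons Qi; exact: L1D (Fi _ Qi) IH.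
by under [X in L1 X]funext do rewrite big_cons Qi.
Qed.

Lemma exD f g : L1 f -> L1 g -> ex (fun o => f o + g o) = ex f + ex g.
Proof. by move=> fi gi; apply: RintegralD. Qed.

Lemma exZ r f : L1 f -> ex (fun o => r * f o) = r * ex f.
Proof. by move=> fi; apply: RintegralZl. Qed.

Lemma exB f g : L1 f -> L1 g -> ex (fun o => f o - g o) = ex f - ex g.
Proof. by move=> fi gi; apply: RintegralB. Qed.

Lemma ex_sum I (s : seq I) (Q : pred I) (F : I -> Om -> R) : (forall i, Q i -> L1 (F i)) ->
  ex (fun o => \sum_(i <- s | Q i) F i o) = \sum_(i <- s | Q i) ex (F i).
Proof.
move=> Fi; elim: s => [|i s IH].
  by under [X in ex X]funext do rewrite big_nil; rewrite big_nil ex_cst.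
rewrite big_cons; case Qi : (Q i).
  under [X in ex X]funext do rewrite big_cons Qi.
  by rewrite exD ?IH//; [exact: Fi|exact: L1_sum].
by under [X in ex X]funext do rewrite big_cons Qi.
Qed.

Lemma ex_le f g : L1 f -> L1 g -> (forall o, f o <= g o) -> ex f <= ex g.
Proof. by move=> fi gi fg; apply: le_Rintegral. Qed.

Lemma ex_norm f : L1 f -> `|ex f| <= ex (fun o => `|f o|).
Proof. by move=> fi; apply: le_normr_Rintegral. Qed.

Lemma ex_le_off (N : set Om) f g : measurable N -> P N = 0%E -> L1 f -> L1 g ->
  (forall o, ~ N o -> f o <= g o) -> ex f <= ex g.
Proof.
move=> mN N0 fi gi fg; rewrite -lee_fin !exE//.
rewrite (negligible_integral mN measurableT fi N0) (negligible_integral mN measurableT gi N0).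
apply: le_integral.
- exact: measurableD.
- by apply: (@integrableS _ _ _ P setT) => //; exact: measurableD.
- by apply: (@integrableS _ _ _ P setT) => //; exact: measurableD.
- by move=> o; rewrite inE => -[_ nN]; rewrite lee_fin; exact: fg.
Qed.

Lemma ex_eq_off (N : set Om) f g : measurable N -> P N = 0%E -> L1 f -> L1 g ->
  (forall o, ~ N o -> f o = g o) -> ex f = ex g.
Proof.
move=> mN N0 fi gi fg; apply/eqP; rewrite eq_le; apply/andP; split;
  by apply: (ex_le_off mN N0) => // o /fg ->.
Qed.

Lemma L1_bound f c : measurable_fun setT f -> (forall o, 0 <= f o) ->
  (\int[P]_o (f o)%:E <= c%:E)%E -> L1 f.
Proof.
move=> mf f0 fc; apply/integrableP; split; first exact/measurable_EFinP.
under eq_integral => o _ do rewrite /= ger0_norm//.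
by rewrite (le_lt_trans fc)// ltry.
Qed.

Lemma ex_bound f c : L1 f -> (\int[P]_o (f o)%:E <= c%:E)%E -> ex f <= c.
Proof. by move=> fi; rewrite -exE. Qed.

End real_expectation.

Section moments.
Context {R : realType} {d : measure_display} {Om : measurableType d}.
Variables (P : probability Om R) (U V : nat -> {RV P >-> R}) (q : queue_model R).

(** The content of [small_enough] for a named constant. [M] is uniform over all admissible policies,
    which is needed when a cycle is compared with its merged version. *)
Definition moments_le (eta M : R) := forall (D : nat -> nat) (x : nat -> Om -> R * R),
  policy_ok U V q D x ->
  forall k n m, (1 <= k)%N -> (1 <= n <= D k)%N -> (1 <= m <= 4)%N ->
  [/\ ('E_P[fun o => ((WW U V q D x k n o) ^+ m)%R] <= M%:E)%E,
      ('E_P[fun o => ((XX U V q D x k n o) ^+ m)%R] <= M%:E)%E,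
      ('E_P[fun o => ((QQ U V q D x k o)%:R ^+ m)%R] <= M%:E)%E,
      ('E_P[fun o => (expR (eta * WW U V q D x k n o))%R] <= M%:E)%E &
      ('E_P[fun o => (expR (eta * (QQ U V q D x k o)%:R))%R] <= M%:E)%E].

End moments.

Lemma mean_bound {R : realType} {d : measure_display} {Om : measurableType d}
    (P : probability Om R) (f : Om -> R) c :
  measurable_fun setT f -> (forall o, 0 <= f o) -> ('E_P[f] <= c%:E)%E ->
  L1 P f /\ ex P f <= c.
Proof.
rewrite unlock => mf f0 fc; have fi := L1_bound mf f0 fc.
by split=> //; exact: ex_bound.
Qed.

Section policy_moments.
Context {R : realType} {d : measure_display} {Om : measurableType d}.
Variables (P : probability Om R) (U V : nat -> {RV P >-> R}) (q : queue_model R).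
Hypothesis hUV : primitives_ok U V.
Hypothesis hq : model_ok q.
Hypothesis hmono : {in `[p_lo q, p_hi q] &, {homo lam q : r s /~ r <= s}}.
Variables (eta M : R).
Hypothesis hM : moments_le U V q eta M.
Variables (D : nat -> nat) (x : nat -> Om -> R * R).
Hypothesis hx : policy_ok U V q D x.
Local Notation WW := (WW U V q D x).
Local Notation XX := (XX U V q D x).
Local Notation QQ := (QQ U V q D x).

Lemma WW_measurable k n : measurable_fun setT (WW k n).
Proof. by have [] := customer_measurable hUV hq hmono hx (offset D k + n). Qed.
Lemma XX_measurable k n : measurable_fun setT (XX k n).
Proof. by have [] := customer_measurable hUV hq hmono hx (offset D k + n). Qed.
Lemma QR_measurable k : measurable_fun setT (fun o => (QQ k o)%:R : R).
Proof. exact: measurable_fun_natr (QQ_measurable hUV hq hmono hx k). Qed.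
Lemma WW_ge0 k n o : 0 <= WW k n o.
Proof. exact: W_ge0. Qed.
Lemma XX_ge0 k n o : 0 <= XX k n o.
Proof.
by apply: (X_ge0 D (V ^~ o) (fun k => policy_l0 hq hx o (k := k)) (fun m => U_ge0 hUV m o)).
Qed.

Lemma WW_mom k n m : (1 <= k)%N -> (1 <= n <= D k)%N -> (1 <= m <= 4)%N ->
  L1 P (fun o => WW k n o ^+ m) /\ ex P (fun o => WW k n o ^+ m) <= M.
Proof.
move=> k1 nD m4; have mW := WW_measurable k n; apply: mean_bound; first by mfun.
  by move=> o; rewrite exprn_ge0// WW_ge0.
by case: (hM hx k1 nD m4).
Qed.

Lemma XX_mom k n m : (1 <= k)%N -> (1 <= n <= D k)%N -> (1 <= m <= 4)%N ->
  L1 P (fun o => XX k n o ^+ m) /\ ex P (fun o => XX k n o ^+ m) <= M.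
Proof.
move=> k1 nD m4; have mW := XX_measurable k n; apply: mean_bound; first by mfun.
  by move=> o; rewrite exprn_ge0// XX_ge0.
by case: (hM hx k1 nD m4).
Qed.

Lemma WW_exp k n : (1 <= k)%N -> (1 <= n <= D k)%N ->
  L1 P (fun o => expR (eta * WW k n o)) /\ ex P (fun o => expR (eta * WW k n o)) <= M.
Proof.
move=> k1 nD; have mW := WW_measurable k n; apply: mean_bound; first by mfun.
  by move=> o; rewrite expR_ge0.
by case: (hM hx k1 nD (isT : (1 <= 1 <= 4)%N)).
Qed.

Lemma QQ_exp k : (1 <= k)%N ->
  L1 P (fun o => expR (eta * (QQ k o)%:R)) /\ ex P (fun o => expR (eta * (QQ k o)%:R)) <= M.
Proof.
move=> k1; have mQ := QR_measurable k; apply: mean_bound; first by mfun.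
  by move=> o; rewrite expR_ge0.
have nD : (1 <= 1 <= D k)%N by rewrite /= (policy_D1 hx).
by case: (hM hx k1 nD (isT : (1 <= 1 <= 4)%N)).
Qed.

Lemma WW_L1 k n : (1 <= k)%N -> (1 <= n <= D k)%N -> L1 P (WW k n).
Proof. by move=> k1 nD; have [] := WW_mom k1 nD (isT : (1 <= 1 <= 4)%N). Qed.

Lemma price_fun_measurable (g : R * R -> R) m : (forall k, (1 <= k)%N ->
    measurable_fun setT (fun o => g (x k o))) ->
  measurable_fun setT (fun o =>
    g (x (price_cycle D (customer_at (lam q) D (x ^~ o) (U ^~ o) (V ^~ o)) m) o)).
Proof.
move=> mg; pose c o := customer_at (lam q) D (x ^~ o) (U ^~ o) (V ^~ o).
apply: (@measurable_at_max _ _ _ (fun k o => g (x k o))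
  (fun k o => (offset D k <= m)%N &&
    (service_start (c o) (offset D k) < arrival (c o m)))) => //.
move=> k _; case: (leqP (offset D k) m) => km /=; last exact: measurable_cst.
have [mA _ _] := customer_measurable hUV hq hmono hx m.
have [mA' mW' _] := customer_measurable hUV hq hmono hx (offset D k).
by apply: measurable_fun_ltr => //; exact: measurable_funD.
Qed.

End policy_moments.

Lemma sigma_of_cst {R : realType} {d d' : measure_display} {Om : measurableType d}
  {T : measurableType d'} (S : set (Om -> R)) (y : T) B : sigma_of S ((fun=> y) @^-1` B).
Proof.
have [h0 hC _] : sigma_algebra setT (sigma_of S) by exact: smallest_sigma_algebra.
have [By|By] := pselect (B y).
  have -> : (fun=> y) @^-1` B = [set: Om] `\` set0 by apply/seteqP; split=> o // _; split.
  exact: hC.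
by have -> : (fun=> y) @^-1` B = set0 :> set Om by apply/seteqP; split.
Qed.

(** * Approach to steady state within a cycle *)

Section transient.
Context {R : realType} {d : measure_display} {Om : measurableType d}.
Variables (P : probability Om R) (U V : nat -> {RV P >-> R}) (q : queue_model R).
Hypothesis hUV : primitives_ok U V.
Hypothesis hq : model_ok q.
Hypothesis hmono : {in `[p_lo q, p_hi q] &, {homo lam q : r s /~ r <= s}}.
Hypothesis stuck0 : P (stuck U) = 0%E.
Variables (eta gamma M cF : R) (w : R * R -> R).
Hypothesis eta0 : 0 < eta.
Hypothesis gamma0 : 0 < gamma.
Hypothesis hM : moments_le U V q eta M.
Hypothesis M0 : 0 < M.
Hypothesis wm : forall {d'} {T : measurableType d'} (X : T -> R * R), measurable_fun setT X ->
  (forall o, box q (X o)) -> measurable_fun setT (fun o => w (X o)).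
Hypothesis w0 : forall x, 0 <= w x.
Hypothesis wc : forall x, box q x -> w x <= cF.
Hypothesis cF0 : 0 <= cF.
Local Notation Fn := (Fn (U 0%N) (V 0%N)).
Hypothesis Fn_le : forall n y x, box q x -> 0 <= y ->
  (Fn n (y, zq q x) <= (w x + expR (- gamma) ^+ n * cF * expR (eta * y))%:E)%E.
Hypothesis le_Fn : forall n y x, box q x -> 0 <= y ->
  ((w x)%:E <= Fn n (y, zq q x) + (expR (- gamma) ^+ n * cF * expR (eta * y))%:E)%E.
Variables (D : nat -> nat) (x : nat -> Om -> R * R).
Hypothesis hx : policy_ok U V q D x.
Local Notation c o := (customer_at (lam q) D (x ^~ o) (U ^~ o) (V ^~ o)).
Local Notation WW := (WW U V q D x).
Local Notation QQ := (QQ U V q D x).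
Local Notation early := (early U V q D x).

Lemma early_measurable k a : (1 <= k)%N -> (offset D k <= a)%N -> measurable (early k a).
Proof.
move=> k1 ka; apply: (info_measurable (P := P) (U := U) (V := V) (S1 := setT) (S2 := setT)).
by have [] := early_history hUV hq hmono stuck0 hx k1 ka (S1 := setT) (S2 := setT).
Qed.

(** On the early event every customer from [a] on arrives after the start of cycle [k], when its
    price takes effect. *)
Lemma early_price k a m o : (1 <= k)%N -> early k a o -> (offset D k <= a <= m)%N ->
  (m < offset D k.+1)%N -> price_cycle D (c o) m = k.
Proof.
move=> k1 [hd hQ] /andP[ka am] mk; have km := leq_trans ka am.
have [k2|k2] := leqP k 1.
  have ke : k = 1%N by apply/eqP; rewrite eqn_leq k2.
  by rewrite ke in mk *; exact: (price_cycle1 (lam q) (x ^~ o) (U ^~ o) (V ^~ o) mk).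
apply: price_cycle_eq => //; [exact: policy_D1 hx|by rewrite km|].
rewrite ltNge -[X in arrival (c o X)](subnKC km) -(QQ_lt hUV hq hmono hx)//.
by rewrite -leqNgt -(leq_add2l (offset D k)) subnKC// (leq_trans hQ).
Qed.

Section cut.
Variables (k a : nat) (G : Om -> R) (cG : R).
Hypothesis k1 : (1 <= k)%N.
Hypothesis ka : (offset D k <= a)%N.
Hypothesis cG0 : 0 <= cG.
Hypothesis G0 : forall o, 0 <= G o.
Hypothesis Gc : forall o, G o <= cG.
Hypothesis hG : forall B, measurable B -> history U V q D x k (G @^-1` B).
(** The weight, the policy and the waiting time all receive default values off [E], so that together
    they are a function of primitives below [m], independent of the pair [U m], [V m]. *)
Let E := early k a.
Let GE o := if o \in E then G o else 0.
Let xE o := if o \in E then x k o else lo_policy q.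
Let WE m o := if o \in E then wait (c o m) else 0.
Let Y m o : R * (R * (R * R)) := (GE o, (WE m o, zq q (xE o))).

Let GE0 o : 0 <= GE o. Proof. by rewrite /GE; case: ifP. Qed.
Let xEb o : box q (xE o).
Proof. by rewrite /xE; case: ifP => _; [exact: (policy_box hx)|exact: box_lo]. Qed.

Lemma Y_info m : (a <= m)%N -> (m <= offset D k.+1)%N -> info_fun U V `I_m `I_m (Y m).
Proof.
move=> am mk.
have i1 i : (i < a)%N -> `I_m i by move=> ia /=; exact: leq_trans am.
have i2 i : (i < offset D k)%N -> `I_m i by move=> ia; apply: i1; exact: leq_trans ka.
have kk : (1 <= k <= k)%N by rewrite k1 /=.
apply/info_fun_gP; apply: measurable_fun_pair.
  by apply/info_fun_gP; exact: (history_info_fun hUV hq hmono stuck0 hx _ kk hG ka i1 i2).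
apply: measurable_fun_pair.
  by apply/info_fun_gP; exact: (wait_info_fun hUV hq hmono stuck0 hx k1 ka am mk).
apply: zq_measurable => //.
apply/info_fun_gP; apply: (history_info_fun hUV hq hmono stuck0 hx _ kk _ ka i1 i2).
exact: (policy_hist hx k1).
Qed.

Let f i (z : (R * (R * (R * R))) * (R * R)) : \bar R :=
  ((`|z.1.1|)%:E * Fn i (step (z.1.2, z.2), z.1.2.2))%E.

Lemma f_measurable i : measurable_fun setT (f i).
Proof.
have m1 : measurable_fun setT (fun z : (R * (R * (R * R))) * (R * R) => z.1.2).
  exact: (measurableT_comp measurable_snd measurable_fst).
apply: emeasurable_funM.
  apply/measurable_EFinP; apply: (measurableT_comp (@normr_measurable _ setT)).
  exact: (measurableT_comp measurable_fst measurable_fst).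
apply: (measurableT_comp (Fn_measurable (U 0%N) (V 0%N) i)).
apply: measurable_fun_pair; last exact: (measurableT_comp measurable_snd m1).
apply: (measurableT_comp (@step_measurable R)).
by apply: measurable_fun_pair => //; exact: measurable_snd.
Qed.

Let J i m : \bar R := (\int[P]_o ((`|GE o|)%:E * Fn i (WE m o, zq q (xE o))))%E.

(** A Markov property: the first of the [i.+1] fresh steps has the same conditional law as the
    actual step from customer [m] to [m.+1], which on [E] runs under the policy of cycle [k]. Off
    [E] the weight vanishes. *)
Lemma transient_step i m : (a <= m < offset D k.+1)%N -> J i.+1 m = J i m.+1.
Proof.
move=> /andP[am mk]; rewrite /J.
have n1 : ~ (`I_m m) by rewrite /= ltnn.
have F := freeze_pair hUV n1 n1 (Y_info am (ltnW mk)) (f_measurable i) _.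
transitivity (\int[P]_o \int[P]_o' f i (Y m o, (U 0%N o', V 0%N o')))%E.
  apply: eq_integral => o _ /=; rewrite /f /= ge0_integralZl_EFin//.
  - by move=> o' _; exact: Fn_ge0.
  - exact: (Fn_measurable_o (U 0%N) (V 0%N) i).
rewrite -F; last by move=> z; apply: mule_ge0; rewrite ?lee_fin//; exact: Fn_ge0.
apply: eq_integral => o _; rewrite /f /Y /=.
rewrite /GE /WE /xE; case: ifPn => [/set_mem Eo|_]; last by rewrite normr0 !mul0e.
congr (_ * Fn i (_, _))%E.
rewrite WS /step /= /svc /gap (service_cycleE (policy_D1 hx) k1); last by rewrite mk (leq_trans ka).
by rewrite (early_price k1 Eo)// ka.
Qed.

Lemma transient_iter i m : (a <= m)%N -> (m + i <= offset D k.+1)%N -> J i m = J 0 (m + i).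
Proof.
elim: i m => [|i IH] m am mk; first by rewrite addn0.
rewrite addnS in mk.
rewrite transient_step ?am ?(leq_trans _ mk)// ?ltnS ?leq_addr//.
by rewrite IH ?addSnnS// ?addnS// ltnW.
Qed.

Let mE : measurable E. Proof. exact: early_measurable. Qed.

Let mGE : measurable_fun setT GE.
Proof.
apply: measurable_fun_ifT; last exact: measurable_cst.
  apply: (measurable_fun_bool true); rewrite setTI.
  by rewrite (_ : _ @^-1` _ = E)//; apply/seteqP; split=> o /=; [move=> /set_mem|move=> /mem_set].
move=> _ B mB; rewrite setTI.
exact: (history_sub (QQ_measurable hUV hq hmono hx k) (hG mB)).
Qed.


(** The last [n2] actual steps are exchanged for fresh ones, so that on [E] the mean waiting time
    becomes [Fn n2] started from customer [n1]. Its distance to [w (x k)] is geometric in [n2], with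
    an exponential of the waiting time at [n1] that [M] bounds. *)
Lemma transient_cut n1 n2 : (1 <= n1)%N -> (n1 + n2 <= D k)%N -> a = (offset D k + n1)%N ->
  `|ex P (fun o => GE o * (WW k (n1 + n2) o - w (x k o)))| <=
    cG * (expR (- gamma) ^+ n2 * cF * M).
Proof.
move=> n11 n2D aE; set B := expR (- gamma) ^+ n2 * cF.
have B0 : 0 <= B by rewrite mulr_ge0// exprn_ge0// expR_ge0.
have nD : (1 <= n1 + n2 <= D k)%N by rewrite n2D (leq_trans n11)// leq_addr.
have n1D : (1 <= n1 <= D k)%N by rewrite n11 (leq_trans _ n2D)// leq_addr.
have GEc o : GE o <= cG by rewrite /GE; case: ifP.
have iW := WW_L1 hUV hq hmono hM hx k1 nD.
have [ie be] := WW_exp hUV hq hmono hM hx k1 n1D.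
have mW := L1_measurable iW; have mW1 := WW_measurable hUV hq hmono hx k n1.
have mx := policy_measurable hUV hq hmono hx k1.
have mw : measurable_fun setT (fun o => w (x k o)) by apply: (wm mx) => o; exact: (policy_box hx o k1).
have iGW : L1 P (fun o => GE o * WW k (n1 + n2) o).
  apply: (@L1_dom _ _ _ P _ (fun o => cG * WW k (n1 + n2) o)); [by mfun| |exact: L1Z].
  by move=> o; rewrite ger0_norm ?mulr_ge0 ?WW_ge0// ler_wpM2r// WW_ge0.
have iGw : L1 P (fun o => GE o * w (x k o)).
  apply: (@L1_dom _ _ _ P _ (fun o => cG * cF)); [by mfun| |exact: (L1_cst P (cG * cF))].
  move=> o; rewrite ger0_norm ?mulr_ge0//; apply: ler_pM => //.
  exact/wc/(policy_box hx).
have iGe : L1 P (fun o => GE o * expR (eta * WW k n1 o)).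
  apply: (@L1_dom _ _ _ P _ (fun o => cG * expR (eta * WW k n1 o))); [by mfun| |exact: L1Z].
  by move=> o; rewrite ger0_norm ?mulr_ge0 ?expR_ge0// ler_wpM2r// expR_ge0.
have iGBe : L1 P (fun o => B * (GE o * expR (eta * WW k n1 o))) by exact: L1Z.
have Ge_le : ex P (fun o => B * (GE o * expR (eta * WW k n1 o))) <= cG * (B * M).
  rewrite exZ// mulrCA ler_wpM2l//.
  apply: (@le_trans _ _ (ex P (fun o => cG * expR (eta * WW k n1 o)))).
    by apply: ex_le => //; [exact: L1Z|move=> o; rewrite ler_wpM2r// expR_ge0].
  by rewrite exZ// ler_wpM2l.
have aD : (a + n2 <= offset D k.+1)%N by rewrite offsetS// aE -addnA leq_add2l.
have J0 : J n2 a = (ex P (fun o => GE o * WW k (n1 + n2) o))%:E.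
  rewrite transient_iter// exE//; apply: eq_integral => o _.
  rewrite /= /GE /WE aE -addnA; case: ifP => _; last by rewrite normr0 !mul0e mul0r.
  by rewrite ger0_norm// max_r ?W_ge0// EFinM.
have mJ : measurable_fun setT (fun o => ((`|GE o|)%:E * Fn n2 (WE a o, zq q (xE o)))%E).
  apply: emeasurable_funM; first by mfun.
  apply: (measurableT_comp (Fn_measurable (U 0%N) (V 0%N) n2)).
  have sub := @info_measurable _ _ _ P U V `I_a `I_a.
  have YI := Y_info (leqnn a) (leq_trans (leq_addr _ _) aD).
  have mY : measurable_fun setT (Y a).
    by move=> _ S mS; rewrite setTI; apply: sub; exact: YI.
  exact: (measurableT_comp measurable_snd mY).
have J_ge0 o : (0 <= (`|GE o|)%:E * Fn n2 (WE a o, zq q (xE o)))%E.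
  by apply: mule_ge0; rewrite ?lee_fin//; exact: Fn_ge0.
have WEa o : o \in E -> WE a o = WW k n1 o by rewrite /WE aE => ->.
have up : ex P (fun o => GE o * WW k (n1 + n2) o) <=
    ex P (fun o => GE o * w (x k o) + B * (GE o * expR (eta * WW k n1 o))).
  rewrite -lee_fin -J0 exE; last exact: L1D.
  apply: le_int => //.
    by mfun.
  move=> o; case: (boolP (o \in E)) => oE; last first.
    by rewrite /GE (negbTE oE) normr0 mul0e !mul0r mulr0 addr0.
  have := @Fn_le n2 (WW k n1 o) (x k o) (policy_box hx o k1) (WW_ge0 _ _ _ _ _ _ _ _).
  rewrite -/B WEa// /xE oE (ger0_norm (GE0 o)) => /(lee_wpmul2l _) h.
  apply: (le_trans (h (GE o)%:E _)); first by rewrite lee_fin.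
  by rewrite -EFinM lee_fin mulrDr [in leRHS]mulrCA.
have lo : ex P (fun o => GE o * w (x k o)) <=
    ex P (fun o => GE o * WW k (n1 + n2) o + B * (GE o * expR (eta * WW k n1 o))).
  rewrite exD// -lee_fin EFinD -J0 !exE// /J -(ge0_integralD _ measurableT)//; last 2 first.
  - by move=> o _; rewrite lee_fin !mulr_ge0 ?expR_ge0.
  - by mfun.
  apply: le_int => //.
  - by mfun.
  - by apply: emeasurable_funD => //; mfun.
  - by move=> o; rewrite lee_fin mulr_ge0.
  move=> o; case: (boolP (o \in E)) => oE; last first.
    by rewrite /GE (negbTE oE) normr0 mul0e !mul0r mulr0 adde0.
  have := @le_Fn n2 (WW k n1 o) (x k o) (policy_box hx o k1) (WW_ge0 _ _ _ _ _ _ _ _).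
  rewrite -/B WEa// /xE oE (ger0_norm (GE0 o)) => /(lee_wpmul2l _) h.
  have {}h := h (GE o)%:E; rewrite EFinM.
  apply: (le_trans (h _)); first by rewrite lee_fin.
  rewrite muleDr//; last by rewrite ge0_adde_def// inE ?Fn_ge0// lee_fin mulr_ge0 ?expR_ge0.
  by rewrite -EFinM (_ : (GE o * (B * _) = B * (GE o * expR (eta * WW k n1 o)))%R)//; ring.
have -> : ex P (fun o => GE o * (WW k (n1 + n2) o - w (x k o))) =
    ex P (fun o => GE o * WW k (n1 + n2) o) - ex P (fun o => GE o * w (x k o)).
  by rewrite -exB//; congr ex; apply/funext => o; rewrite mulrBr.
move: up lo; rewrite !exD// => up lo; rewrite ler_norml; apply/andP; split; lra.
Qed.

End cut.

(** Only half of the customers contribute to the contraction. The other half controls the leftover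
    queue, and AM-GM costs a second factor 2 there: exp(-eta n1 / 2) with [n1] at least n / 2. *)
Definition kap : R := Num.min gamma eta / 4.
Definition CA : R := expR (gamma / 2) * cF * M + (M + cF ^+ 2 + M).

Lemma kap_gt0 : 0 < kap.
Proof. by rewrite divr_gt0// lt_min gamma0 eta0. Qed.

Lemma CA_ge0 : 0 <= CA.
Proof. by rewrite !addr_ge0 ?mulr_ge0 ?expR_ge0 ?exprn_ge0// ltW. Qed.

Lemma stuck_meas : measurable (stuck U).
Proof. exact: stuck_measurable. Qed.

Section whole.
Variables (k n : nat).
Hypothesis k1 : (1 <= k)%N.
Hypothesis nD : (1 <= n <= D k)%N.

(** The weight is split along [early k (offset D k + n1)]. On the event [transient_cut] applies; off
    it, up to a null set, at least [n1] customers are present at the start of the cycle, which is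
    exponentially unlikely. *)
Lemma transient_ge0 (G : Om -> R) cG : (forall o, 0 <= G o) -> (forall o, G o <= cG) -> 0 <= cG ->
  (forall B, measurable B -> history U V q D x k (G @^-1` B)) ->
  `|ex P (fun o => G o * (WW k n o - w (x k o)))| <= cG * (CA * expR (- kap * n%:R)).
Proof.
move=> G0 Gc cG0 hG.
(* The first half is rounded up so that [n1 >= 1], as the moment bounds start with customer 1. The
   loss in [n2] is the prefactor expR (gamma / 2) of [CA]. *)
pose n1 := uphalf n; pose n2 := n./2; pose a := (offset D k + n1)%N; pose E := early k a.
have nE : n = (n1 + n2)%N by rewrite /n1 /n2 addnC -[LHS]odd_double_half uphalf_half -addnn; lia.
have n11 : (1 <= n1)%N by case/andP: nD => h _; rewrite /n1; case: (n) h.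
have ka : (offset D k <= a)%N by exact: leq_addr.
have n2D : (n1 + n2 <= D k)%N by rewrite -nE; case/andP: nD.
have cut := transient_cut k1 ka cG0 G0 Gc hG n11 n2D erefl.
rewrite -/E -nE in cut.
have mE : measurable E by exact: early_measurable.
have iW := WW_L1 hUV hq hmono hM hx k1 nD.
have [iW2 bW2] := WW_mom hUV hq hmono hM hx k1 nD (isT : (1 <= 2 <= 4)%N).
have [iQ bQ] := QQ_exp hUV hq hmono hM hx k1.
have mW := L1_measurable iW.
have mx := policy_measurable hUV hq hmono hx k1.
have mw : measurable_fun setT (fun o => w (x k o)) by apply: (wm mx) => o; exact: (policy_box hx o k1).
have mG : measurable_fun setT G.
  move=> _ B mB; rewrite setTI.
  exact: (history_sub (QQ_measurable hUV hq hmono hx k) (hG _ mB)).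
pose H o := if o \in E then G o else 0.
have mH : measurable_fun setT H.
  apply: measurable_fun_ifT => //; apply: (measurable_fun_bool true); rewrite setTI.
  by rewrite (_ : _ @^-1` _ = E)//; apply/seteqP; split=> o /=; [move=> /set_mem|move=> /mem_set].
have HG o : 0 <= H o <= G o by rewrite /H; case: ifP => _; rewrite ?lexx ?G0.
have wn o : `|WW k n o - w (x k o)| <= WW k n o + cF.
  have h1 := WW_ge0 U V q D x k n o; have h2 := w0 (x k o); have h3 := wc (policy_box hx o k1).
  rewrite ler_norml; apply/andP; split; lra.
have iWc : L1 P (fun o => cG * (WW k n o + cF)) by apply/L1Z/L1D => //; exact: (L1_cst P cF).
have iH : L1 P (fun o => H o * (WW k n o - w (x k o))).
  apply: (L1_dom _ _ iWc); first by mfun.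
  move=> o; have /andP[h1 h2] := HG o; rewrite normrM (ger0_norm h1); apply: ler_pM => //.
  exact: le_trans h2 (Gc o).
have iHc : L1 P (fun o => (G o - H o) * (WW k n o - w (x k o))).
  apply: (L1_dom _ _ iWc); first by mfun.
  move=> o; have /andP[h1 h2] := HG o; rewrite normrM ger0_norm ?subr_ge0//; apply: ler_pM => //.
    by rewrite subr_ge0.
  by have := Gc o; lra.
have -> : ex P (fun o => G o * (WW k n o - w (x k o))) =
    ex P (fun o => H o * (WW k n o - w (x k o))) + ex P (fun o => (G o - H o) * (WW k n o - w (x k o))).
  by rewrite -exD//; congr ex; apply/funext => o; ring.
pose eps := expR (- (eta * n1%:R / 2)).
have eps0 : 0 < eps by exact: expR_gt0.
have rest : `|ex P (fun o => (G o - H o) * (WW k n o - w (x k o)))| <= cG * (eps * (M + cF ^+ 2 + M)).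
  apply: (le_trans (ex_norm iHc)).
  pose T o := cG * (eps * (WW k n o ^+ 2 + cF ^+ 2 + expR (eta * (QQ k o)%:R))).
  have iT : L1 P T by apply/L1Z/L1Z/L1D => //; apply: L1D => //; exact: (L1_cst P (cF ^+ 2)).
  apply: (@le_trans _ _ (ex P T)); last first.
    rewrite exZ; last by apply/L1Z/L1D => //; apply: L1D => //; exact: (L1_cst P (cF ^+ 2)).
    rewrite exZ; last by apply/L1D => //; apply: L1D => //; exact: (L1_cst P (cF ^+ 2)).
    rewrite exD//; last by apply: L1D => //; exact: (L1_cst P (cF ^+ 2)).
    rewrite exD//; last exact: (L1_cst P (cF ^+ 2)).
    by rewrite ex_cst ler_wpM2l// ler_pM2l// !lerD.
  apply: (ex_le_off stuck_meas stuck0) => //; first exact: L1_norm.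
  move=> o nst; have hd : divergent (U ^~ o) by apply: contrapT.
  rewrite normrM; have /andP[h1 h2] := HG o.
  rewrite (@ger0_norm _ (G o - H o)) ?subr_ge0//.
  case: (boolP (o \in E)) => oE.
    have -> : G o - H o = 0 by rewrite /H oE subrr.
    rewrite mul0r; apply: mulr_ge0 => //; apply: mulr_ge0; first exact: ltW.
    by rewrite !addr_ge0 ?expR_ge0// exprn_ge0// ?WW_ge0.
  apply: ler_pM; rewrite ?subr_ge0//.
    by rewrite (le_trans _ (Gc o))// lerBlDr lerDl.
  apply: (le_trans (wn o)).
  have hQ : (n1 <= QQ k o)%N.
    rewrite leqNgt; apply/negP => Qn; move/negP: oE; apply; rewrite inE; split=> //.
    by rewrite leq_add2l ltnW.
  (* This quantity plays the role of the constant 1 in AM-GM for [eps * WW] and [eps * cF]. *)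
  have hE : eps * (eps * expR (eta * (QQ k o)%:R)) >= 1.
    rewrite /eps -!expRD -[leLHS]expR0 ler_expR.
    have : eta * n1%:R <= eta * (QQ k o)%:R by rewrite ler_pM2l// ler_nat.
    by lra.
  rewrite -(ler_pM2l eps0).
  have h3 : 0 <= (eps * WW k n o - 1) ^+ 2 by exact: sqr_ge0.
  have h4 : 0 <= (eps * cF - 1) ^+ 2 by exact: sqr_ge0.
  move: hE; set Z := expR _ => hE.
  have E1 : eps * (eps * (WW k n o ^+ 2 + cF ^+ 2 + Z)) =
     (eps * WW k n o) ^+ 2 + (eps * cF) ^+ 2 + eps * (eps * Z) by ring.
  rewrite E1 mulrDr; move: h3 h4; rewrite !sqrrB1 => h3 h4.
  have h5 := sqr_ge0 (eps * WW k n o); have h6 := sqr_ge0 (eps * cF).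
  move: ((eps * WW k n o) ^+ 2) ((eps * cF) ^+ 2) (eps * WW k n o) (eps * cF) (eps * (eps * Z)) hE h3 h4 h5 h6.
  by move=> *; lra.
apply: (le_trans (ler_normD _ _)); apply: (le_trans (lerD cut rest)).
have k4 : kap <= gamma / 4 /\ kap <= eta / 4.
  by rewrite /kap; split; rewrite ler_pM2r// ge_min lexx ?orbT.
have nR : n%:R = n1%:R + n2%:R :> R by rewrite nE natrD.
have n12 : n1%:R <= n2%:R + 1 :> R.
  by rewrite natr1 ler_nat /n1 /n2 uphalf_half; case: odd; rewrite ?add0n ?add1n.
have n21 : n2%:R <= n1%:R :> R by rewrite ler_nat /n1 /n2 uphalf_half leq_addl.
have n20 : 0 <= n2%:R :> R by [].
have [k4a k4b] := k4; have kp := ltW kap_gt0.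
have e1 : expR (- gamma) ^+ n2 <= expR (gamma / 2) * expR (- kap * n%:R).
  rewrite -expRM_natl -expRD ler_expR.
  have h1 : kap * n%:R <= kap * (2 * n2%:R + 1) by rewrite ler_wpM2l// nR; lra.
  have h2 : kap * (2 * n2%:R + 1) <= (gamma * n2%:R) / 2 + gamma / 4.
    have -> : (gamma * n2%:R) / 2 + gamma / 4 = gamma / 4 * (2 * n2%:R + 1) by field.
    by apply: ler_wpM2r => //; rewrite addr_ge0// mulr_ge0.
  have h3 : 0 <= gamma * n2%:R by rewrite mulr_ge0// ltW.
  rewrite mulrN mulNr (mulrC n2%:R).
  by move: (kap * n%:R) (gamma * n2%:R) (kap * _) h1 (h2) h3 => ? ? ? ? ? ?; lra.
have e2 : eps <= expR (- kap * n%:R).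
  rewrite /eps ler_expR.
  have h1 : kap * n%:R <= kap * (2 * n1%:R) by rewrite ler_wpM2l// nR; lra.
  have h2 : kap * (2 * n1%:R) <= eta / 4 * (2 * n1%:R) by rewrite ler_wpM2r//; lra.
  rewrite mulNr.
  by move: (kap * n%:R) (kap * (_ * _)) h1 h2 => ? ? ? ?; lra.
rewrite -mulrDr ler_wpM2l//.
rewrite [CA * _](_ : _ = expR (gamma / 2) * expR (- kap * n%:R) * (cF * M) +
   expR (- kap * n%:R) * (M + cF ^+ 2 + M)); last by rewrite /CA; ring.
rewrite -mulrA; apply: lerD; apply: ler_wpM2r => //.
  by rewrite mulr_ge0// ltW.
by rewrite !addr_ge0 ?exprn_ge0// ltW.
Qed.

(** A signed weight is the difference of [G + cG], bounded by [2 * cG], and the constant [cG]; hence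
    the factor 3. *)
Lemma transient_bound (G : Om -> R) cG : (forall o, `|G o| <= cG) -> 0 <= cG ->
  (forall B, measurable B -> history U V q D x k (G @^-1` B)) ->
  `|ex P (fun o => G o * (WW k n o - w (x k o)))| <= 3 * cG * (CA * expR (- kap * n%:R)).
Proof.
move=> Gc cG0 hG.
have iW := WW_L1 hUV hq hmono hM hx k1 nD; have mW := L1_measurable iW.
have mx := policy_measurable hUV hq hmono hx k1.
have mw : measurable_fun setT (fun o => w (x k o)) by apply: (wm mx) => o; exact: (policy_box hx o k1).
have mG : measurable_fun setT G.
  move=> _ B mB; rewrite setTI.
  exact: (history_sub (QQ_measurable hUV hq hmono hx k) (hG _ mB)).
have h1 : `|ex P (fun o => (G o + cG) * (WW k n o - w (x k o)))| <= 2 * cG * (CA * expR (- kap * n%:R)).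
  apply: transient_ge0.
  - by move=> o; have := Gc o; rewrite ler_norml => /andP[+ _]; lra.
  - by move=> o; have := Gc o; rewrite ler_norml => /andP[_ +]; lra.
  - by rewrite mulr_ge0.
  - move=> B mB; have mS : measurable ((fun r : R => r + cG) @^-1` B).
      by rewrite -[X in measurable X]setTI; apply: measurable_funD.
    exact: hG _ mS.
have h2 : `|ex P (fun o => cG * (WW k n o - w (x k o)))| <= cG * (CA * expR (- kap * n%:R)).
  apply: (transient_ge0 (G := fun=> cG)) => //.
  by move=> B mB; exact: sigma_of_cst.
have wn o : `|WW k n o - w (x k o)| <= WW k n o + cF.
  have h3 := WW_ge0 U V q D x k n o; have h4 := w0 (x k o); have h5 := wc (policy_box hx o k1).
  rewrite ler_norml; apply/andP; split; lra.
have iWw : L1 P (fun o => WW k n o - w (x k o)).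
  by apply: (L1_dom _ wn); [mfun|apply: L1D => //; exact: (L1_cst P cF)].
have iG : L1 P (fun o => G o * (WW k n o - w (x k o))).
  apply: (L1_dom (g := fun o => cG * `|WW k n o - w (x k o)|)); first by mfun.
    by move=> o; rewrite normrM ler_wpM2r.
  exact/L1Z/L1_norm.
have E1 : ex P (fun o => G o * (WW k n o - w (x k o))) =
   ex P (fun o => (G o + cG) * (WW k n o - w (x k o))) - ex P (fun o => cG * (WW k n o - w (x k o))).
  rewrite -exB//; first by congr ex; apply/funext => o; ring.
    by under [X in L1 _ X]funext do rewrite mulrDl; apply: L1D => //; exact: L1Z.
  exact: L1Z.
rewrite E1 (le_trans (ler_normB _ _))// (le_trans (lerD h1 h2))//.
by move: (CA * _) => ?; rewrite -mulrDl; lra.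
Qed.

End whole.
End transient.

(** * Centering the primitives *)

Section tame.
Context {R : realType}.
Variable q : queue_model R.
Implicit Types (f g : R * R -> R) (y z : R * R).

Definition dist1 y z : R := `|y.1 - z.1| + `|y.2 - z.2|.

(** One constant serves as bound and Lipschitz constant. Measurability is asked of compositions with
    box-valued maps, because the model functions are unspecified off the box, and for every
    sigma-algebra, because it is used with [info] and with [history]. *)
Definition tame L f := [/\ 0 <= L,
  forall y z, box q y -> box q z -> `|f y - f z| <= L * dist1 y z,
  forall y, box q y -> `|f y| <= L &
  forall d (T : measurableType d) (X : T -> R * R), measurable_fun setT X ->
    (forall o, box q (X o)) -> measurable_fun setT (fun o => f (X o))].

Lemma dist1_ge0 y z : 0 <= dist1 y z. Proof. exact: addr_ge0. Qed.

Lemma tame_cst r : tame `|r| (fun=> r).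
Proof.
by split=> // y z _ _; rewrite subrr normr0 mulr_ge0// dist1_ge0.
Qed.

Lemma tameD L1 L2 f g : tame L1 f -> tame L2 g -> tame (L1 + L2) (fun y => f y + g y).
Proof.
move=> [h1 h2 h3 h4] [k1 k2 k3 k4]; split; first exact: addr_ge0.
- move=> y z yb zb; rewrite opprD addrACA mulrDl (le_trans (ler_normD _ _))// lerD//.
    exact: h2.
  exact: k2.
- by move=> y yb; rewrite (le_trans (ler_normD _ _))// lerD// ?h3 ?k3.
- by move=> d T X mX bX; apply: measurable_funD; [exact: h4|exact: k4].
Qed.

Lemma tameM L1 L2 f g : tame L1 f -> tame L2 g -> tame (2 * (L1 * L2)) (fun y => f y * g y).
Proof.
move=> [h1 h2 h3 h4] [k1 k2 k3 k4]; have LL : 0 <= L1 * L2 by exact: mulr_ge0.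
split; first by rewrite mulr_ge0.
- move=> y z yb zb; have d0 := dist1_ge0 y z.
  have -> : f y * g y - f z * g z = (f y - f z) * g y + f z * (g y - g z) by ring.
  rewrite (le_trans (ler_normD _ _))// !normrM -mulrA mulr_natl mulr2n lerD//.
    rewrite [L1 * L2]mulrC [leLHS]mulrC -mulrA; apply: ler_pM => //; [exact: k3|exact: h2].
  rewrite -mulrA; apply: ler_pM => //; [exact: h3|exact: k2].
- move=> y yb; rewrite normrM; apply: (@le_trans _ _ (L1 * L2)); last by lra.
  by apply: ler_pM => //; [exact: h3|exact: k3].
- by move=> d T X mX bX; apply: measurable_funM; [exact: h4|exact: k4].
Qed.

Hypothesis hq : model_ok q.
Hypothesis hmono : {in `[p_lo q, p_hi q] &, {homo lam q : r s /~ r <= s}}.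

Lemma tame_inv c L f : 0 < c -> (forall y, box q y -> c <= f y) -> tame L f ->
  tame (c^-1 + L * (c^-1 * c^-1)) (fun y => (f y)^-1).
Proof.
move=> c0 cf [h1 h2 h3 h4]; have ci : 0 <= c^-1 by rewrite invr_ge0 ltW.
have L0 : 0 <= L * (c^-1 * c^-1) by rewrite !mulr_ge0.
have fc y : box q y -> (f y)^-1 <= c^-1.
  by move=> yb; rewrite lef_pV2 ?posrE ?cf// (lt_le_trans c0)// cf.
split; first by rewrite addr_ge0.
- move=> y z yb zb; apply: (le_trans (inv_dist c0 (cf _ yb) (cf _ zb))).
  apply: (@le_trans _ _ (L * dist1 y z * c^-1 * c^-1)).
    by rewrite !ler_wpM2r// h2.
  rewrite [leRHS]mulrDl (_ : L * _ * _ * _ = L * (c^-1 * c^-1) * dist1 y z); last by ring.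
  by rewrite lerDr mulr_ge0// dist1_ge0.
- move=> y yb; rewrite ger0_norm; last by rewrite invr_ge0 (le_trans (ltW c0))// cf.
  by rewrite (le_trans (fc _ yb))// lerDl.
- move=> d T X mX bX; apply: measurable_fun_invr; first exact: h4.
  by move=> o; rewrite (le_trans (ltW c0))// cf.
Qed.

Lemma tame_fst : exists L, tame L (fun y => y.1).
Proof.
have [/andP[m0 m1] /andP[p0 p1] _ _] := hq.
exists (1 + mu_hi q); split; first by rewrite addr_ge0// (le_trans (ltW m0))// ltW.
- move=> y z _ _; rewrite mulrDl mul1r; apply: (@le_trans _ _ (dist1 y z)); first by rewrite lerDl.
  by rewrite lerDl mulr_ge0 ?dist1_ge0// (le_trans (ltW m0))// ltW.
- move=> y yb; rewrite ger0_norm; last by rewrite ltW// (box_mu_gt0 hq yb).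
  by case: yb => _ h _ _; lra.
- by move=> d T X mX _; exact: (measurableT_comp measurable_fst mX).
Qed.

Lemma tame_snd : exists L, tame L (fun y => y.2).
Proof.
have [/andP[m0 m1] /andP[p0 p1] _ _] := hq.
exists (1 + p_hi q); split; first by rewrite addr_ge0// (le_trans (ltW p0))// ltW.
- move=> y z _ _; rewrite mulrDl mul1r; apply: (@le_trans _ _ (dist1 y z)); first by rewrite lerDr.
  by rewrite lerDl mulr_ge0 ?dist1_ge0// (le_trans (ltW p0))// ltW.
- move=> y [_ _ h1 h2]; rewrite ger0_norm; last by rewrite (le_trans (ltW p0)).
  by lra.
- by move=> d T X mX _; exact: (measurableT_comp measurable_snd mX).
Qed.

Lemma tame_lam Ll : (forall r s, r \in `[p_lo q, p_hi q] -> s \in `[p_lo q, p_hi q] ->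
    `|lam q r - lam q s| <= Ll * `|r - s|) -> exists L, tame L (fun y => lam q y.2).
Proof.
move=> lamL; have l0 := box_lam_gt0 hq (box_lo hq).
exists (`|Ll| + lam q (p_lo q)); split; first by rewrite addr_ge0// ltW.
- move=> y z yb zb; rewrite mulrDl.
  apply: (@le_trans _ _ (`|Ll| * dist1 y z)); last by rewrite lerDl mulr_ge0 ?dist1_ge0// ltW.
  apply: (le_trans (lamL _ _ (box_price yb) (box_price zb))).
  apply: (@le_trans _ _ (`|Ll| * `|y.2 - z.2|)); first by rewrite ler_wpM2r// ler_norm.
  by rewrite ler_wpM2l// lerDr.
- move=> y yb; rewrite ger0_norm; last by rewrite ltW// (box_lam_gt0 hq yb).
  by rewrite (le_trans (box_lam_le hq hmono yb))// lerDr.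
- by move=> d T X mX bX; exact: box_lam_measurable.
Qed.

End tame.

Section mean_zero.
Context {R : realType} {d : measure_display} {Om : measurableType d}.
Variables (P : probability Om R).

(* [hZ] says that Z has the law of Z0 and is independent of Y. *)
Lemma frozen_mean (Y Z Z0 : Om -> R) cY : measurable_fun setT Y -> (forall o, `|Y o| <= cY) ->
  L1 P Z -> (forall o, 0 <= Z o) -> L1 P Z0 -> (forall o, 0 <= Z0 o) -> ex P Z = 1 -> ex P Z0 = 1 ->
  (forall f : R * R -> \bar R, measurable_fun setT f -> (forall z, (0 <= f z)%E) ->
     (\int[P]_o f (Y o, Z o) = \int[P]_o \int[P]_o' f (Y o, Z0 o'))%E) ->
  ex P (fun o => Y o * (Z o - 1)) = 0.
Proof.
move=> mY Yc iZ Z_0 iZ0 Z0_0 EZ EZ0 hZ.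
have mZ := L1_measurable iZ; have mZ0 := L1_measurable iZ0.
(* The exchange of integrals is available for nonnegative functions only, so [Y] is shifted by its
   bound and the shift is subtracted at the end. *)
have Y1 o : 0 <= Y o + cY by have := Yc o; rewrite ler_norml => /andP[+ _]; lra.
pose g (z : R * R) := (`|z.1 + cY| * `|z.2|)%:E.
have iY : L1 P Y by apply: (L1_dom mY Yc); exact: (L1_cst P cY).
have iYZ : L1 P (fun o => Y o * Z o).
  apply: (L1_dom (g := fun o => cY * Z o)); [by mfun| |exact: L1Z].
  by move=> o; rewrite normrM (ger0_norm (Z_0 o)) ler_wpM2r.
have E1 : ex P (fun o => (Y o + cY) * Z o) = ex P (fun o => Y o + cY).
  have iY' : L1 P (fun o => Y o + cY) by apply: L1D => //; exact: (L1_cst P cY).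
  apply: EFin_inj; rewrite !exE//; last first.
    by under [X in L1 _ X]funext do rewrite mulrDl; apply: L1D => //; exact: L1Z.
  transitivity (\int[P]_o g (Y o, Z o))%E.
    by apply: eq_integral => o _; rewrite /g /= !ger0_norm.
  rewrite hZ.
  - apply: eq_integral => o _; rewrite /g /=.
    under eq_integral do rewrite EFinM.
    have mZ0' : measurable_fun setT (fun o => (`|Z0 o|)%:E) by mfun.
    rewrite ge0_integralZl_EFin//.
    transitivity ((`|Y o + cY|)%:E * (ex P Z0)%:E)%E.
      by rewrite exE//; congr (_ * _)%E; apply: eq_integral => o' _; rewrite ger0_norm.
    by rewrite EZ0 mule1 ger0_norm.
  - by rewrite /g; mfun.
  - by move=> z; rewrite lee_fin mulr_ge0.
have E2 : ex P (fun o => (Y o + cY) * Z o) = ex P (fun o => Y o * Z o) + cY.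
  rewrite -[X in _ + X]mulr1 -EZ -exZ// -exD//; last exact: L1Z.
  by congr ex; apply/funext => o; rewrite mulrDl.
have E3 : ex P (fun o => Y o + cY) = ex P Y + cY.
  by rewrite exD//; [rewrite ex_cst|exact: (L1_cst P cY)].
rewrite (_ : (fun o => _) = (fun o => Y o * Z o - Y o)); last by apply/funext => o; ring.
by rewrite exB//; lra.
Qed.

Variables (U V : nat -> {RV P >-> R}).
Hypothesis hUV : primitives_ok U V.

Lemma U_lawE m (f : R -> \bar R) : measurable_fun setT f -> (forall y, (0 <= f y)%E) ->
  (\int[P]_o f (U m o) = \int[P]_o f (U 0%N o))%E.
Proof.
move=> mf f0; have n1 : ~ (set0 : set nat) m by [].
have iY : info_fun U V set0 set0 (fun _ : Om => 0 : R).
  by apply/info_fun_gP; exact: measurable_cst.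
rewrite (freezeU hUV n1 iY (f := fun z => f z.2)) //.
  rewrite (_ : (fun o => _) = (fun=> \int[P]_o f (U 0%N o)))%E//.
  by rewrite integral_cst//= probability_setT mule1.
exact: (measurableT_comp mf measurable_snd).
Qed.

Lemma U_mean m : L1 P (U m) /\ ex P (U m) = 1.
Proof.
have E : (\int[P]_o (U m o)%:E = 1)%E by case: hUV => _ _ _ _ /(_ m)[+ _]; rewrite unlock.
have i : L1 P (U m) by apply: (L1_bound (c := 1)) => //; [move=> o; exact: U_ge0 hUV m o|rewrite E].
by split=> //; apply: EFin_inj; rewrite exE.
Qed.

Lemma V_mean m : L1 P (V m) /\ ex P (V m) = 1.
Proof.
have E : (\int[P]_o (V m o)%:E = 1)%E by case: hUV => _ _ _ _ /(_ m)[_ +]; rewrite unlock.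
have i : L1 P (V m) by apply: (L1_bound (c := 1)) => //; [move=> o; exact: V_ge0 hUV m o|rewrite E].
by split=> //; apply: EFin_inj; rewrite exE.
Qed.

Lemma U_centered S1 S2 m (Y : Om -> R) cY : info_fun U V S1 S2 Y -> ~ S1 m ->
  (forall o, `|Y o| <= cY) -> ex P (fun o => Y o * (U m o - 1)) = 0.
Proof.
move=> iY nS Yc; have [i1 e1] := U_mean m; have [i0 e0] := U_mean 0.
apply: (frozen_mean (Z0 := U 0%N) (cY := cY)) => //.
- by move=> _ B mB; rewrite setTI; apply: info_measurable; exact: iY.
- by move=> o; exact: U_ge0 hUV m o.
- by move=> o; exact: U_ge0 hUV 0%N o.
- by move=> f mf f0; exact: (freezeU hUV nS iY mf f0).
Qed.

Lemma V_centered S1 S2 m (Y : Om -> R) cY : info_fun U V S1 S2 Y -> ~ S2 m ->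
  (forall o, `|Y o| <= cY) -> ex P (fun o => Y o * (V m o - 1)) = 0.
Proof.
move=> iY nS Yc; have [i1 e1] := V_mean m; have [i0 e0] := V_mean 0.
apply: (frozen_mean (Z0 := V 0%N) (cY := cY)) => //.
- by move=> _ B mB; rewrite setTI; apply: info_measurable; exact: iY.
- by move=> o; exact: V_ge0 hUV m o.
- by move=> o; exact: V_ge0 hUV 0%N o.
- by move=> f mf f0; exact: (freezeV hUV nS iY mf f0).
Qed.

(** With m = min(1, eta / 4), m (U + 1) <= 1 + (eta / 4) U <= exp(eta U / 4); the fourth power of
    this is integrable. *)
Lemma U_fourth_moment eta : 0 < eta -> ('M_P (U 0%N) eta < +oo)%E -> exists2 C, 0 < C &
  forall m, L1 P (fun o => (U m o + 1) ^+ 4) /\ ex P (fun o => (U m o + 1) ^+ 4) <= C.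
Proof.
move=> eta0; rewrite mgfE => fin.
have : (0 <= \int[P]_o (expR (eta * U 0%N o))%:E)%E.
  by apply: integral_ge0 => o _; rewrite lee_fin expR_ge0.
move: fin; case E : (\int[P]_o (expR (eta * U 0%N o))%:E)%E => [r| |]// _; rewrite lee_fin => r0.
pose K := (Num.min 1 (eta / 4))^-1 ^+ 4.
have mm : 0 < Num.min 1 (eta / 4) by rewrite lt_min ltr01 divr_gt0.
have K0 : 0 < K by rewrite exprn_gt0// invr_gt0.
have UK m o : (U m o + 1) ^+ 4 <= K * expR (eta * U m o).
  have u0 := U_ge0 hUV m o.
  rewrite /K exprVn ler_pdivlMl ?exprn_gt0//.
  rewrite [X in expR X](_ : _ = 4%:R * (eta / 4 * U m o)); last by field.
  rewrite expRM_natl -exprMn lerXn2r ?nnegrE ?expR_ge0//.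
    by rewrite mulr_ge0 ?addr_ge0// ltW.
  apply: le_trans (expR_ge1Dx _).
  have h1 : Num.min 1 (eta / 4) <= 1 by rewrite ge_min lexx.
  have h2 : Num.min 1 (eta / 4) <= eta / 4 by rewrite ge_min lexx orbT.
  by rewrite mulrDr mulr1 addrC lerD// ler_wpM2r.
exists (K * r + 1); first by rewrite ltr_pwDr// mulr_ge0// ltW.
move=> m; have iE : L1 P (fun o => expR (eta * U m o)) /\ ex P (fun o => expR (eta * U m o)) <= r.
  have h : (\int[P]_o (expR (eta * U m o))%:E <= r%:E)%E.
    have mf : measurable_fun setT (fun y : R => (expR (eta * y))%:E) by mfun.
    have f0 y : (0 <= (expR (eta * y))%:E)%E by rewrite lee_fin expR_ge0.
    by rewrite (U_lawE m mf f0) E.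
  have i : L1 P (fun o => expR (eta * U m o)).
    by apply: L1_bound h; [mfun|move=> o; exact: expR_ge0].
  by split; [exact: i|exact: ex_bound i h].
have [ie be] := iE.
have i4 : L1 P (fun o => (U m o + 1) ^+ 4).
  apply: (L1_dom (g := fun o => K * expR (eta * U m o))); [by mfun| |exact: L1Z].
  by move=> o; rewrite ger0_norm// exprn_ge0// addr_ge0// (U_ge0 hUV).
split=> //; apply: (@le_trans _ _ (ex P (fun o => K * expR (eta * U m o)))).
  by apply: ex_le => //; exact: L1Z.
rewrite exZ// (@le_trans _ _ (K * r))//; last by rewrite lerDl.
by rewrite ler_wpM2l// ltW.
Qed.

End mean_zero.

(** * Effect of customers priced before the current cycle *)

Section deviations.
Context {R : realType} {d : measure_display} {Om : measurableType d}.
Variables (P : probability Om R) (U V : nat -> {RV P >-> R}) (q : queue_model R).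
Hypothesis hUV : primitives_ok U V.
Hypothesis hq : model_ok q.
Hypothesis hmono : {in `[p_lo q, p_hi q] &, {homo lam q : r s /~ r <= s}}.
Hypothesis stuck0 : P (stuck U) = 0%E.
Variables (D : nat -> nat) (x : nat -> Om -> R * R).
Hypothesis hx : policy_ok U V q D x.
Local Notation c o := (customer_at (lam q) D (x ^~ o) (U ^~ o) (V ^~ o)).
Local Notation QQ := (QQ U V q D x).
Local Notation early := (early U V q D x).
Local Notation pc o m := (price_cycle D (c o) m).
Let D1 := policy_D1 hx.

Lemma price_cycle_ge o j m : (1 <= j)%N -> (offset D j <= m)%N ->
  service_start (c o) (offset D j) < arrival (c o m) -> (j <= pc o m)%N.
Proof.
move=> j1 jm h; rewrite /price_cycle leq_max; apply/orP; right.
apply: (@leq_bigmax_seq _ _ _ (fun j => j) j); last by rewrite jm h.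
by rewrite mem_index_iota j1 ltnS (leq_trans (offset_ge D1 j)).
Qed.

Lemma price_cycle_le o k m : (1 <= k)%N -> (m < offset D k.+1)%N -> (pc o m <= k)%N.
Proof.
move=> k1 mk; rewrite /price_cycle geq_max k1 /=.
by apply/bigmax_leqP_seq => j _ /andP[jm _]; rewrite -ltnS; apply: offset_le_lt mk.
Qed.

Variable k : nat.
Hypothesis k2 : (2 <= k)%N.
Let k1 : (1 <= k)%N. Proof. exact: ltnW. Qed.
Let kp1 : (1 <= k.-1)%N. Proof. by case: k k2 => // -[]. Qed.
Let offk : offset D k = (offset D k.-1 + D k.-1)%N.
Proof. by rewrite -offsetS// prednK. Qed.

(** If at most [D k.-1] customers are present when cycle [k.-1] starts, customer [offset D k]
    arrives later than that start, so nobody in cycle [k] is affected by a price older than that of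
    cycle [k.-1]. *)
Lemma price_cycle_near o i : divergent (U ^~ o) -> (i < D k)%N ->
  (QQ k.-1 o <= D k.-1)%N -> pc o (offset D k + i) = k \/ pc o (offset D k + i) = k.-1.
Proof.
move=> hd iD hQ; set m := (offset D k + i)%N.
have mk : (m < offset D k.+1)%N by rewrite offsetS// ltn_add2l.
have le := price_cycle_le o k1 mk.
suff ge : (k.-1 <= pc o m)%N by move: le ge k2; lia.
have [kk|kk] := leqP k.-1 1; first by rewrite (leq_trans kk)// price_cycle_ge1.
apply: price_cycle_ge => //.
  by rewrite (leq_trans _ (leq_addr _ _))// offset_mono// leq_pred.
have h : service_start (c o) (offset D k.-1) < arrival (c o (offset D k)).
  by rewrite offk ltNge -(QQ_lt hUV hq hmono hx _ hd)// -leqNgt.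
apply: (lt_le_trans h).
apply: (A_mono D (V ^~ o) (fun k => policy_l0 hq hx o (k := k)) (fun m => U_ge0 hUV m o)).
exact: leq_addr.
Qed.

(* The change of policy between the last two cycles, plus one if customers of
   cycle k may still have been priced before cycle k-1. *)
Definition shift o : R := dist1 (x k o) (x k.-1 o) + (D k.-1 < QQ k.-1 o)%N%:R.

Lemma shift_ge0 o : 0 <= shift o.
Proof. by rewrite addr_ge0// dist1_ge0. Qed.

Definition shift_max : R := mu_hi q + mu_hi q + (p_hi q + p_hi q) + 1.

Lemma shift_le o : shift o <= shift_max.
Proof.
have [b1 b2 b3 b4] := policy_box hx o k1; have [c1 c2 c3 c4] := policy_box hx o kp1.
have m1 := policy_m0 hq hx o k1; have m2 := policy_m0 hq hx o kp1.
have [_ /andP[p0 _] _ _] := hq.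
apply: lerD; last by case: (_ < _)%N.
by rewrite /dist1; apply: lerD; apply: (le_trans (ler_normB _ _)); apply: lerD;
  rewrite gtr0_norm// (lt_le_trans p0).
Qed.

Lemma shift_measurable : measurable_fun setT shift.
Proof.
have m1 := policy_measurable hUV hq hmono hx k1.
have m2 := policy_measurable hUV hq hmono hx kp1.
rewrite /shift /dist1; apply: measurable_funD; first by mfun.
apply: (measurable_fun_natr (f := fun o => (D k.-1 < QQ k.-1 o)%N : nat)).
apply: (measurableT_comp (f := fun m : nat => (D k.-1 < m)%N : nat)) => //.
exact: (QQ_measurable hUV hq hmono hx).
Qed.

Definition waiting i o : R := (i < QQ k o)%N%:R.

Lemma waiting_measurable i : measurable_fun setT (waiting i).
Proof.
apply: (measurable_fun_natr (f := fun o => (i < QQ k o)%N : nat)).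
apply: (measurableT_comp (f := fun m : nat => (i < m)%N : nat)) => //.
exact: (QQ_measurable hUV hq hmono hx).
Qed.

Lemma waiting_shift_L1 i m : L1 P (fun o => waiting i o * shift o * (U m o + 1)).
Proof.
have ms := shift_measurable; have mw := waiting_measurable i.
have [iU _] := U_mean hUV m.
have iU2 : L1 P (fun o => U m o + 1) by apply: L1D => //; exact: (L1_cst P 1).
apply: (L1_dom (g := fun o => shift_max * (U m o + 1))); [by mfun| |exact: L1Z].
have u1 o : 0 <= U m o + 1 by rewrite addr_ge0// (U_ge0 hUV).
move=> o; rewrite ger0_norm ?mulr_ge0 ?shift_ge0//; apply: ler_wpM2r => //.
apply: (le_trans _ (shift_le o)).
by rewrite ler_piMl ?shift_ge0// /waiting; case: (_ < _)%N.
Qed.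

Section tame_function.
Variables (L : R) (f : R * R -> R).
Hypothesis tf : tame q L f.

Let L0 : 0 <= L. Proof. by case: tf. Qed.
Let fL j o : (1 <= j)%N -> `|f (x j o)| <= L.
Proof. by case: tf => _ _ h _ j1; apply/h/(policy_box hx). Qed.

Lemma tame_diff o j : (1 <= j)%N -> (QQ k.-1 o <= D k.-1)%N -> j = k \/ j = k.-1 ->
  `|f (x k o) - f (x j o)| <= 2 * L * shift o.
Proof.
move=> j1 hQ; have [_ fl _ _] := tf.
have LL : 0 <= 2 * L * shift o by rewrite !mulr_ge0// shift_ge0.
case=> ->; first by rewrite subrr normr0.
apply: (le_trans (fl _ _ (policy_box hx o k1) (policy_box hx o kp1))).
rewrite /shift ltnNge hQ addr0; apply: ler_wpM2r; first exact: dist1_ge0.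
by have := L0; lra.
Qed.

Lemma tame_diff_bad o (r : R) : `|r| <= L -> (D k.-1 < QQ k.-1 o)%N ->
  `|f (x k o) - r| <= 2 * L * shift o.
Proof.
move=> rL hQ; apply: (le_trans (ler_normB _ _)).
apply: (@le_trans _ _ (2 * L)); first by have := fL o k1; have := L0; lra.
by rewrite ler_peMr ?mulr_ge0// /shift hQ lerDr dist1_ge0.
Qed.

Lemma price_deviation o i : divergent (U ^~ o) -> (i < D k)%N ->
  `|f (x k o) - f (x (pc o (offset D k + i)) o)| <= waiting i o * (2 * L * shift o).
Proof.
move=> hd iD; rewrite /waiting; case: (ltnP i (QQ k o)) => iQ /=.
  rewrite mul1r; have [hQ|hQ] := leqP (QQ k.-1 o) (D k.-1).
    by apply: tame_diff => //; [exact: price_cycle_ge1|exact: price_cycle_near].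
  by apply: tame_diff_bad => //; apply: fL; exact: price_cycle_ge1.
rewrite mul0r (@early_price _ _ _ _ _ _ _ hUV hq hmono _ _ hx k (offset D k + i))//.
- by rewrite subrr normr0.
- by split=> //; rewrite leq_add2l.
- by rewrite leq_addr /=.
- by rewrite offsetS// ltn_add2l.
Qed.

(* The value of [f] on the policy of cycle k, as far as it can be told before
   customer i+1 of that cycle arrives. *)
Definition predicted i o : R :=
  if o \in early k (offset D k + i) then f (x k o)
  else if o \in early k.-1 (offset D k) then f (x k.-1 o) else 0.

Lemma predicted_le i o : `|predicted i o| <= L.
Proof.
by rewrite /predicted; case: ifP => _; last case: ifP => _; rewrite ?normr0 ?fL.
Qed.

(** If neither event holds, cycle [k.-1] started with more than [D k.-1] customers; then [shift] is
    at least 1 and the trivial bound [2 * L] suffices. *)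
Lemma predicted_dist o i : divergent (U ^~ o) ->
  `|f (x k o) - predicted i o| <= waiting i o * (2 * L * shift o).
Proof.
move=> hd; have pl := predicted_le i o; move: pl.
rewrite /waiting /predicted; case: ifPn => [/set_mem [_]|nE].
  by rewrite leq_add2l ltnNge => -> _; rewrite subrr normr0 mul0r.
have -> : (i < QQ k o)%N.
  rewrite ltnNge; apply/negP => h; move/negP: nE; apply; rewrite inE; split=> //.
  by rewrite leq_add2l.
rewrite mul1r; case: ifPn => [/set_mem [_ hE] pl|nE2 pl].
  by move: hE; rewrite offk leq_add2l => hQ; apply: tame_diff => //; right.
apply: tame_diff_bad => //.
rewrite ltnNge; apply/negP => h; move/negP: nE2; apply; rewrite inE; split=> //.
by rewrite offk leq_add2l.
Qed.

Lemma predicted_info i : info_fun U V `I_(offset D k + i) `I_(offset D k) (predicted i).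
Proof.
have [_ _ _ fm] := tf.
pose m := (offset D k + i)%N; pose lo := lo_policy q.
have km : (offset D k <= m)%N by exact: leq_addr.
have kk : (offset D k.-1 <= offset D k)%N by rewrite offset_mono// leq_pred.
pose cutx j a o := if o \in early j a then x j o else lo.
have cutb j a o : (1 <= j)%N -> box q (cutx j a o).
  by move=> j1; rewrite /cutx; case: ifP => _; [exact: (policy_box hx)|exact: box_lo].
have cutm j a : (1 <= j)%N -> (offset D j <= a)%N -> (a <= m)%N -> (offset D j <= offset D k)%N ->
    info_fun U V `I_m `I_(offset D k) (cutx j a).
  move=> j1 ja am jk; apply: (@history_info_fun _ _ _ P U V q hUV hq hmono stuck0 D x hx _ _ (x j) lo j j).
  - by rewrite j1 /=.
  - exact: (policy_hist hx j1).
  - by [].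
  - by move=> i0 h /=; exact: leq_trans am.
  - by move=> i0 h /=; exact: leq_trans jk.
have mearly j a : (1 <= j)%N -> (offset D j <= a)%N -> (a <= m)%N -> (offset D j <= offset D k)%N ->
    info U V `I_m `I_(offset D k) (early j a).
  move=> j1 ja am jk.
  have [] // := early_history hUV hq hmono stuck0 hx j1 (S1 := `I_m) (S2 := `I_(offset D k)) ja.
  - by move=> i0 h /=; exact: leq_trans am.
  - by move=> i0 h /=; exact: leq_trans jk.
have bm j a : (1 <= j)%N -> (offset D j <= a)%N -> (a <= m)%N -> (offset D j <= offset D k)%N ->
    measurable_fun setT ((fun o => o \in early j a) :
      g_sigma_algebraType (info U V `I_m `I_(offset D k)) -> bool).
  move=> j1 ja am jk; apply: (measurable_fun_bool true); rewrite setTI.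
  rewrite (_ : _ @^-1` _ = early j a); first by apply/infoE; exact: mearly.
  by apply/seteqP; split=> o /=; [move=> /set_mem|move=> /mem_set].
apply/info_fun_gP.
rewrite (_ : predicted i = fun o => if o \in early k m then f (cutx k m o) else
   if o \in early k.-1 (offset D k) then f (cutx k.-1 (offset D k) o) else 0); last first.
  by apply/funext => o; rewrite /predicted /cutx -/m; case: ifP => // _; case: ifP.
apply: measurable_fun_ifT; first exact: bm.
  by apply: fm; [apply/info_fun_gP; exact: cutm|move=> o; exact: cutb].
apply: measurable_fun_ifT; [exact: bm| |exact: measurable_cst].
by apply: fm; [apply/info_fun_gP; exact: cutm|move=> o; exact: cutb].
Qed.

Lemma tame_measurable j : (1 <= j)%N -> measurable_fun setT (fun o => f (x j o)).
Proof.
move=> j1; case: tf => _ _ _ h; apply: h; first exact: (policy_measurable hUV hq hmono hx).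
by move=> o; exact: (policy_box hx).
Qed.

Lemma tame_history j : (1 <= j)%N ->
  forall B, measurable B -> history U V q D x j ((fun o => f (x j o)) @^-1` B).
Proof.
move=> j1 B mB; case: tf => _ _ _ h.
have sE : <<s history U V q D x j >> = history U V q D x j.
  by rewrite sigma_algebra_id//; exact: smallest_sigma_algebra.
have mx : measurable_fun setT (x j : g_sigma_algebraType (history U V q D x j) -> R * R).
  by move=> _ S mS; rewrite setTI /measurable/= sE; exact: (policy_hist hx j1).
have := h _ _ _ mx (fun o => policy_box hx o j1) measurableT _ mB.
by rewrite setTI /measurable/= sE.
Qed.

Lemma tame_L1 j g : (1 <= j)%N -> L1 P g -> L1 P (fun o => f (x j o) * g o).
Proof.
move=> j1 ig; have mg := L1_measurable ig; have mf := tame_measurable j1.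
apply: (L1_dom (g := fun o => L * `|g o|)); first by mfun.
  by move=> o; rewrite normrM ler_wpM2r// fL.
exact/L1Z/L1_norm.
Qed.

(** [x k] may depend on interarrival times of any index but only on services before cycle [k]. The
    information therefore contains all of [U], and the union of [early k a] over all [a] is the
    event of divergence. *)
Lemma service_centered m : (offset D k <= m)%N ->
  ex P (fun o => f (x k o) * (V m o - 1)) = 0.
Proof.
move=> km; have [_ _ fb fm] := tf.
have [iV _] := V_mean hUV m.
have iV1 : L1 P (fun o => V m o - 1) by apply: L1B => //; exact: (L1_cst P 1).
pose E := [set o | divergent (U ^~ o)].
pose X o := if o \in E then x k o else lo_policy q.
have Xb o : box q (X o) by rewrite /X; case: ifP => _; [exact: (policy_box hx)|exact: box_lo].
have iX : info_fun U V setT `I_(offset D k) X.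
  move=> A mA.
  have -> : X @^-1` A = (\bigcup_a (if (offset D k <= a)%N then x k @^-1` A `&` early k a else set0))
      `|` ((if lo_policy q \in A then setT else set0) `\` E).
    apply/seteqP; split=> o /=; rewrite /X.
      case: (boolP (o \in E)) => [/set_mem Eo Ao|nE Ao].
        left; exists (offset D k + QQ k o)%N => //; rewrite leq_addr; split=> //.
      right; split; last by move=> /mem_set; rewrite (negbTE nE).
      by rewrite mem_set.
    move=> [[a _]|[Ao nE]].
      by case: ifP => // _ [Ao [Eo _]]; rewrite mem_set.
    have -> : (o \in E) = false by apply/negP => /set_mem.
    by move: Ao; case: ifP => // /set_mem.
  have ho j : (j < offset D k)%N -> `I_(offset D k) j by [].
  apply: infoUn.
    apply: info_bigcup => a; case: ifP => ka; last exact: info0.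
    have [_ h] := early_history hUV hq hmono stuck0 hx k1 (S1 := setT) ka (fun _ _ => I) ho.
    by apply: h; exact: (policy_hist hx k1).
  apply: infoD; first by case: ifP => _; [exact: infoT|exact: info0].
  exact: divergent_info.
have iF : info_fun U V setT `I_(offset D k) (fun o => f (X o)).
  by apply/info_fun_gP; apply: fm => //; exact/info_fun_gP.
have nk : ~ `I_(offset D k) m by rewrite /= ltnNge km.
rewrite -(V_centered hUV iF nk (cY := L)); last by move=> o; exact: fb.
have mFX : measurable_fun setT (fun o => f (X o)).
  by move=> _ B mB; rewrite setTI; apply: info_measurable; exact: iF.
apply: (ex_eq_off (stuck_meas U) stuck0).
- exact: tame_L1.
- apply: (L1_dom (g := fun o => L * `|V m o - 1|)); first by mfun.
    by move=> o; rewrite normrM ler_wpM2r// fb.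
  exact/L1Z/L1_norm.
- move=> o nst; have hd : divergent (U ^~ o) by apply: contrapT.
  by rewrite /X mem_set.
Qed.

(** For a customer already waiting, [f (x k o)] may depend on this very interarrival time. Its
    predictable substitute has mean exactly zero against it, and the replacement error is carried by
    [waiting] and [shift]. *)
Lemma arrival_centered i : (i < D k)%N ->
  `|ex P (fun o => f (x k o) * (U (offset D k + i) o - 1))| <=
  2 * L * ex P (fun o => waiting i o * shift o * (U (offset D k + i) o + 1)).
Proof.
move=> iD; set m := (offset D k + i)%N.
have [iU _] := U_mean hUV m.
have iU1 : L1 P (fun o => U m o - 1) by apply: L1B => //; exact: (L1_cst P 1).
have iU2 : L1 P (fun o => U m o + 1) by apply: L1D => //; exact: (L1_cst P 1).
have nS : ~ `I_m m by rewrite /= ltnn.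
have C := U_centered hUV (@predicted_info i) nS (predicted_le i).
have mp : measurable_fun setT (predicted i).
  by move=> _ B mB; rewrite setTI; apply: info_measurable; exact: (@predicted_info i).
have iP : L1 P (fun o => predicted i o * (U m o - 1)).
  apply: (L1_dom (g := fun o => L * `|U m o - 1|)); first by mfun.
    by move=> o; rewrite normrM ler_wpM2r// predicted_le.
  exact/L1Z/L1_norm.
have iR := waiting_shift_L1 i m.
have -> : ex P (fun o => f (x k o) * (U m o - 1)) =
    ex P (fun o => (f (x k o) - predicted i o) * (U m o - 1)).
  rewrite (_ : (fun o => (_ - _) * _) = (fun o => f (x k o) * (U m o - 1) - predicted i o * (U m o - 1))).
    by rewrite exB// ?C ?subr0//; exact: tame_L1.
  by apply/funext => o; ring.
have iF : L1 P (fun o => (f (x k o) - predicted i o) * (U m o - 1)).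
  rewrite (_ : (fun o => _) = (fun o => f (x k o) * (U m o - 1) - predicted i o * (U m o - 1))).
    by apply: L1B => //; exact: tame_L1.
  by apply/funext => o; ring.
rewrite -exZ//; apply: (le_trans (ex_norm iF)).
apply: (ex_le_off (stuck_meas U) stuck0).
- exact: L1_norm.
- exact: L1Z.
- move=> o nst; have hd : divergent (U ^~ o) by apply: contrapT.
  rewrite normrM [leRHS](_ : _ = waiting i o * (2 * L * shift o) * (U m o + 1)); last by ring.
  apply: ler_pM => //; first exact: predicted_dist.
  by rewrite (le_trans (ler_normB _ _))// normr1 ger0_norm// (U_ge0 hUV).
Qed.

Lemma price_centered i (g : Om -> R) cg : (i < D k)%N -> L1 P g -> 0 <= cg ->
  (forall o, `|g o| <= cg * (U (offset D k + i) o + 1)) ->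
  `|ex P (fun o => (f (x k o) - f (x (pc o (offset D k + i)) o)) * g o)| <=
  2 * L * cg * ex P (fun o => waiting i o * shift o * (U (offset D k + i) o + 1)).
Proof.
move=> iD ig cg0 gU; set m := (offset D k + i)%N in gU *.
have mg := L1_measurable ig.
have [iU _] := U_mean hUV m.
have iU2 : L1 P (fun o => U m o + 1) by apply: L1D => //; exact: (L1_cst P 1).
have iR := waiting_shift_L1 i m.
have mf := tame_measurable k1.
have mpf : measurable_fun setT (fun o => f (x (pc o m) o)).
  by apply: (price_fun_measurable hUV hq hmono hx) => j j1; exact: tame_measurable.
have iF : L1 P (fun o => (f (x k o) - f (x (pc o m) o)) * g o).
  apply: (L1_dom (g := fun o => (L + L) * `|g o|)); first by mfun.
    move=> o; rewrite normrM ler_wpM2r// (le_trans (ler_normB _ _))// lerD// fL//.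
    exact: price_cycle_ge1.
  exact/L1Z/L1_norm.
rewrite -exZ//; apply: (le_trans (ex_norm iF)).
apply: (ex_le_off (stuck_meas U) stuck0).
- exact: L1_norm.
- exact: L1Z.
- move=> o nst; have hd : divergent (U ^~ o) by apply: contrapT.
  rewrite normrM [leRHS](_ : _ = waiting i o * (2 * L * shift o) * (cg * (U m o + 1))); last by ring.
  by apply: ler_pM => //; exact: price_deviation.
Qed.

End tame_function.
End deviations.

(** * The change of policy between two cycles *)

Section shift_estimates.
Context {R : realType} {d : measure_display} {Om : measurableType d}.
Variables (P : probability Om R) (U V : nat -> {RV P >-> R}) (q : queue_model R).
Hypothesis hUV : primitives_ok U V.
Hypothesis hq : model_ok q.
Hypothesis hmono : {in `[p_lo q, p_hi q] &, {homo lam q : r s /~ r <= s}}.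
Variables (eta M : R).
Hypothesis eta0 : 0 < eta.
Hypothesis hM : moments_le U V q eta M.
Variables (D : nat -> nat) (x : nat -> Om -> R * R).
Hypothesis hx : policy_ok U V q D x.
Local Notation QQ := (QQ U V q D x).
Variable k : nat.
Hypothesis k2 : (2 <= k)%N.
Let k1 : (1 <= k)%N. Proof. exact: ltnW. Qed.
Let kp1 : (1 <= k.-1)%N. Proof. by case: k k2 => // -[]. Qed.
Local Notation shift := (shift U V q D x k).
Local Notation waiting := (waiting U V q D x k).

Let ms : measurable_fun setT shift. Proof. exact: shift_measurable. Qed.
Let s0 o : 0 <= shift o. Proof. exact: shift_ge0. Qed.

Lemma shift_L1 g : L1 P g -> L1 P (fun o => shift o * g o).
Proof.
move=> ig; have mg := L1_measurable ig.
apply: (L1_dom (g := fun o => shift_max q * `|g o|)); first by mfun.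
  by move=> o; rewrite normrM (ger0_norm (s0 o)) ler_wpM2r// (shift_le hq hx k2).
exact/L1Z/L1_norm.
Qed.

Lemma shift_sq_L1 : L1 P (fun o => shift o ^+ 2).
Proof.
have i : L1 P shift.
  by have := shift_L1 (L1_cst P 1); under [X in L1 _ X]funext do rewrite mulr1.
by have := shift_L1 i; under [X in L1 _ X]funext do rewrite -expr2.
Qed.

(** Square of a sum of three terms, whence the 3; the indicator of D < Q is at most exp(eta (Q -
    D)), whose mean the exponential moment bounds. *)
Lemma shift_sq e : ('E_P[fun o => (enorm (x k.-1 o - x k o) ^+ 2)%R] <= e%:E)%E ->
  ex P (fun o => shift o ^+ 2) <= 3 * (e + M * expR (- (eta * (D k.-1)%:R))).
Proof.
move=> he.
have m1 := policy_measurable hUV hq hmono hx k1.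
have m2 := policy_measurable hUV hq hmono hx kp1.
pose N o := (x k.-1 o - x k o).1 ^+ 2 + (x k.-1 o - x k o).2 ^+ 2.
have N0 o : 0 <= N o by rewrite addr_ge0// sqr_ge0.
have NE o : enorm (x k.-1 o - x k o) ^+ 2 = N o by rewrite /enorm (sqr_sqrtr (N0 o)).
have mN : measurable_fun setT N.
  rewrite /N (_ : (fun o => _) = (fun o => ((x k.-1 o).1 - (x k o).1) ^+ 2 + ((x k.-1 o).2 - (x k o).2) ^+ 2)).
    by mfun.
  by [].
have [iN bN] : L1 P N /\ ex P N <= e.
  by apply: mean_bound => //; move: he; under [X in ('E_P[X] <= _)%E]funext do rewrite NE.
have [iQ bQ] := QQ_exp hUV hq hmono hM hx kp1.
set r := expR (- _); have r0 : 0 <= r by exact: expR_ge0.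
have iT : L1 P (fun o => N o + r * expR (eta * (QQ k.-1 o)%:R)) by apply: L1D => //; exact: L1Z.
apply: (@le_trans _ _ (ex P (fun o => 3 * (N o + r * expR (eta * (QQ k.-1 o)%:R))))); last first.
  rewrite exZ// exD//; last exact: L1Z.
  by rewrite exZ// ler_wpM2l// lerD// mulrC ler_wpM2r.
apply: ex_le => //; [exact: shift_sq_L1|exact: L1Z|move=> o].
set b := (D k.-1 < QQ k.-1 o)%N.
have hb : b%:R <= r * expR (eta * (QQ k.-1 o)%:R).
  rewrite /b; case: ltnP => h /=; last by rewrite mulr_ge0// expR_ge0.
  rewrite -expRD -[leLHS]expR0 ler_expR.
  have : eta * (D k.-1)%:R <= eta * (QQ k.-1 o)%:R by rewrite ler_pM2l// ler_nat ltnW.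
  by lra.
rewrite /shift -/b /dist1 /N.
have bb : (b%:R : R) ^+ 2 = b%:R by case: b {hb}; rewrite ?expr1n ?expr0n.
have E1 : `|(x k o).1 - (x k.-1 o).1| ^+ 2 = (x k.-1 o - x k o).1 ^+ 2.
  by rewrite real_normK ?num_real// -sqrrN opprB.
have E2 : `|(x k o).2 - (x k.-1 o).2| ^+ 2 = (x k.-1 o - x k o).2 ^+ 2.
  by rewrite real_normK ?num_real// -sqrrN opprB.
rewrite -E1 -E2; move: bb hb; clear E1 E2.
move: (b%:R : R) `|(x k o).1 - _| `|(x k o).2 - _| (r * _) => B a1 a2 Z bb hb.
have h1 := sqr_ge0 (a1 - a2); have h2 := sqr_ge0 (a1 - B); have h3 := sqr_ge0 (a2 - B).
by nra.
Qed.

Variables (eps Cs : R).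
Hypothesis eps0 : 0 < eps.
Hypothesis hCs : ex P (fun o => shift o ^+ 2) <= Cs * eps ^+ 2.

Lemma shift_mul (f Z : Om -> R) CZ : L1 P f -> L1 P (fun o => Z o ^+ 2) ->
  ex P (fun o => Z o ^+ 2) <= CZ -> (forall o, `|f o| <= shift o * Z o) ->
  `|ex P f| <= eps * (Cs + CZ).
Proof.
move=> iF iZ bZ fZ; apply: (le_trans (ex_norm iF)).
have e0 : eps != 0 by rewrite gt_eqF.
have i1 : L1 P (fun o => eps^-1 * shift o ^+ 2) by exact: (L1Z _ shift_sq_L1).
have i2 : L1 P (fun o => eps * Z o ^+ 2) by exact: L1Z.
apply: (@le_trans _ _ (ex P (fun o => eps^-1 * shift o ^+ 2 + eps * Z o ^+ 2))).
  apply: ex_le; [exact: L1_norm|exact: L1D|move=> o].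
  apply: (le_trans (fZ o)).
  have := sqr_ge0 (shift o - eps * Z o); have := sqr_ge0 (shift o + eps * Z o) => h1 h2.
  rewrite -(ler_pM2l eps0) mulrDr mulVKf//; nra.
rewrite exD// (exZ _ shift_sq_L1).
rewrite exZ// mulrDr lerD//; last by rewrite ler_pM2l.
rewrite ler_pdivrMl// mulrA -expr2 mulrC; exact: hCs.
Qed.

(** The indicator of i < Q is at most exp(eta (Q - i - 1) / 4), which yields a factor summable in
    [i]. The quarter is chosen because the square of exp(eta Q / 4) (U + 1) is then bounded by
    exp(eta Q) and (U + 1)^4, with no independence between Q and U. *)
Lemma shift_arrival C4 i m : (forall m, L1 P (fun o => (U m o + 1) ^+ 4) /\ ex P (fun o => (U m o + 1) ^+ 4) <= C4) ->
  ex P (fun o => waiting i o * shift o * (U m o + 1)) <=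
  expR (- (eta / 4)) ^+ i.+1 * (eps * (Cs + (M + C4))).
Proof.
move=> h4; have [i4 b4] := h4 m.
have [iQ bQ] := QQ_exp hUV hq hmono hM hx k1.
have [iU _] := U_mean hUV m.
have iU2 : L1 P (fun o => U m o + 1) by apply: L1D => //; exact: (L1_cst P 1).
have mw : measurable_fun setT (waiting i) by exact: waiting_measurable.
have mQ : measurable_fun setT (fun o => (QQ k o)%:R : R) by exact: QR_measurable.
have u1 o : 0 <= U m o + 1 by rewrite addr_ge0// (U_ge0 hUV).
pose r := expR (- (eta / 4)) ^+ i.+1; have r0 : 0 < r by rewrite exprn_gt0// expR_gt0.
pose Z o := expR (eta / 4 * (QQ k o)%:R) * (U m o + 1).
have Z0 o : 0 <= Z o by rewrite mulr_ge0// expR_ge0.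
have mZ : measurable_fun setT Z by rewrite /Z; mfun.
have iB : L1 P (fun o => expR (eta * (QQ k o)%:R) + (U m o + 1) ^+ 4) by exact: L1D.
have ZB o : Z o ^+ 2 <= expR (eta * (QQ k o)%:R) + (U m o + 1) ^+ 4.
  have -> : eta * (QQ k o)%:R = 4%:R * (eta / 4 * (QQ k o)%:R) by field.
  rewrite /Z expRM_natl; move: (expR _) (U m o + 1) (expR_ge0 (eta / 4 * (QQ k o)%:R)) (u1 o) => a b a0 b0.
  have := sqr_ge0 (a ^+ 2 - b ^+ 2); rewrite sqrrB -!exprM exprMn /=.
  have := exprn_ge0 4 a0; have := exprn_ge0 4 b0.
  have := mulr_ge0 (exprn_ge0 2 a0) (exprn_ge0 2 b0).
  by move: (a ^+ 4) (b ^+ 4) (a ^+ 2 * b ^+ 2) => ? ? ?; lra.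
have iZ2 : L1 P (fun o => Z o ^+ 2).
  by apply: (L1_dom _ _ iB); [mfun|move=> o; rewrite ger0_norm ?ZB// sqr_ge0].
have bZ2 : ex P (fun o => Z o ^+ 2) <= M + C4.
  by apply: (le_trans (ex_le iZ2 iB ZB)); rewrite exD// lerD.
have iF : L1 P (fun o => r^-1 * (waiting i o * shift o * (U m o + 1))).
  apply: L1Z; apply: (L1_dom (g := fun o => shift o * (U m o + 1))); [by mfun| |exact: shift_L1].
  move=> o; rewrite ger0_norm ?mulr_ge0//; apply: ler_wpM2r => //.
  by rewrite ler_piMl// /waiting; case: (_ < _)%N.
have B : `|ex P (fun o => r^-1 * (waiting i o * shift o * (U m o + 1)))| <= eps * (Cs + (M + C4)).
  apply: (shift_mul iF iZ2 bZ2) => o.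
  rewrite ger0_norm ?mulr_ge0// ?invr_ge0 ?(ltW r0)// /Z mulrA (mulrC (shift o)) !mulrA.
  apply: ler_wpM2r => //; apply: ler_wpM2r => //.
  rewrite /waiting; case: ltnP => iQ' /=; last by rewrite mulr0 expR_ge0.
  rewrite mulr1 /r -expRM_natl -expRN ler_expR mulrN opprK mulrC.
  by rewrite ler_pM2l ?divr_gt0// ler_nat.
have iG : L1 P (fun o => waiting i o * shift o * (U m o + 1)).
  rewrite (_ : (fun o => _) = fun o => r * (r^-1 * (waiting i o * shift o * (U m o + 1)))); first exact: L1Z.
  by apply/funext => o; rewrite mulVKf// gt_eqF.
have := le_trans (ler_norm _) B; rewrite exZ// ler_pdivrMl//.
Qed.

End shift_estimates.

Section decay.
Context {R : realType} {d : measure_display} {Om : measurableType d}.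
Variables (P : probability Om R) (U V : nat -> {RV P >-> R}) (q : queue_model R).

(** The conclusion of [transient_bound], quantified over all policies so that it can be applied to
    the merged policy with the same constants. *)
Definition transient_decay (w : R * R -> R) (B kp : R) :=
  forall (D : nat -> nat) (x : nat -> Om -> R * R), policy_ok U V q D x ->
  forall k n, (1 <= k)%N -> (1 <= n <= D k)%N ->
  forall (G : Om -> R) cG, (forall o, `|G o| <= cG) -> 0 <= cG ->
  (forall S, measurable S -> history U V q D x k (G @^-1` S)) ->
  `|ex P (fun o => G o * (WW U V q D x k n o - w (x k o)))| <= cG * (B * expR (- kp * n%:R)).

End decay.

(** * Merging two consecutive cycles *)

Section extended_cycle.
Context {R : realType} {d : measure_display} {Om : measurableType d}.
Variables (P : probability Om R) (U V : nat -> {RV P >-> R}) (q : queue_model R).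
Hypothesis hUV : primitives_ok U V.
Hypothesis hq : model_ok q.
Variables (D : nat -> nat) (x : nat -> Om -> R * R) (j : nat).
Hypothesis hx : policy_ok U V q D x.
Hypothesis j1 : (1 <= j)%N.

(* Cycle j+1 is merged into cycle j, whose policy stays in force. *)
Definition extend_D i : nat :=
  if (i < j)%N then D i else if i == j then (D j + D j.+1)%N else 1%N.
Definition extend_x i o : R * R := if (i <= j)%N then x i o else lo_policy q.

Let box_x i o : (1 <= i)%N -> box q (extend_x i o).
Proof. by move=> i1; rewrite /extend_x; case: ifP => _; [exact: (policy_box hx)|exact: box_lo]. Qed.
Let D1 i : (1 <= i)%N -> (1 <= extend_D i)%N.
Proof.
move=> i1; rewrite /extend_D; case: ifP => _; first exact: (policy_D1 hx).
by case: ifP => // _; rewrite ltn_addr// (policy_D1 hx).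
Qed.

Lemma extend_DE i : (i < j)%N -> D i = extend_D i.
Proof. by rewrite /extend_D => ->. Qed.

Lemma extend_Dj : extend_D j = (D j + D j.+1)%N.
Proof. by rewrite /extend_D ltnn eqxx. Qed.

Lemma extend_xE i o : (i <= j)%N -> x i o = extend_x i o.
Proof. by rewrite /extend_x => ->. Qed.

Lemma extend_offset i : (i <= j)%N -> offset D i = offset extend_D i.
Proof. by move=> ij; apply: offset_ext => i' /andP[_ h]; apply: extend_DE; exact: leq_trans ij. Qed.

(** Up to cycle [j] the merged policy has the same offsets and, by causality, the same queue
    lengths, hence the same histories; afterwards it is constant. *)
Lemma extend_ok : policy_ok U V q extend_D extend_x.
Proof.
move=> i i1; split; [exact: D1|by move=> o; exact: box_x|].
case: (leqP i j) => ij; last first.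
  have -> : extend_x i = fun=> lo_policy q by apply/funext => o; rewrite /extend_x leqNgt ij.
  by move=> A mA; exact: sigma_of_cst.
have -> : extend_x i = x i by apply/funext => o; rewrite -extend_xE.
have QE : QQ U V q extend_D extend_x i = QQ U V q D x i.
  apply/funext => o; apply/esym/cycle_queue_causal => //.
  - exact: policy_D1 hx.
  - by move=> n n1; exact: (policy_l0 hq hx).
  - by move=> n n1; exact: (policy_m0 hq hx).
  - by move=> n n1; exact/box_lam_gt0/box_x.
  - by move=> n n1; exact/box_mu_gt0/box_x.
  - by move=> m; exact: (U_ge0 hUV).
  - by move=> m; exact: (V_ge0 hUV).
  - by move=> m; exact: (V_ge0 hUV).
  - by move=> n /andP[_ ni]; apply: extend_DE; exact: leq_trans ij.
  - by move=> n /andP[_ ni]; apply: extend_xE; exact: leq_trans (ltnW ni) ij.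
move=> A mA; rewrite /history QE -extend_offset//.
exact: (policy_hist hx i1 mA).
Qed.

End extended_cycle.

(** * Mean waiting times of early, late and last customers *)

Section cycle_means.
Context {R : realType} {d : measure_display} {Om : measurableType d}.
Variables (P : probability Om R) (U V : nat -> {RV P >-> R}) (q : queue_model R).
Hypothesis hUV : primitives_ok U V.
Hypothesis hq : model_ok q.
Hypothesis hmono : {in `[p_lo q, p_hi q] &, {homo lam q : r s /~ r <= s}}.
Variables (eta M : R).
Hypothesis hM : moments_le U V q eta M.
Variables (w : R * R -> R) (Lw B kp : R).
Hypothesis kp0 : 0 < kp.
Hypothesis B0 : 0 <= B.
Hypothesis tw : tame q Lw w.
Hypothesis bound : transient_decay U V q w B kp.
Variables (D : nat -> nat) (x : nat -> Om -> R * R).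
Hypothesis hx : policy_ok U V q D x.
Variable k : nat.
Hypothesis k2 : (2 <= k)%N.
Let k1 : (1 <= k)%N. Proof. exact: ltnW. Qed.
Let kp1 : (1 <= k.-1)%N. Proof. by case: k k2 => // -[]. Qed.
Variables (eps Cs : R).
Hypothesis eps0 : 0 < eps.
Local Notation shift := (shift U V q D x k).
Local Notation WW := (WW U V q D x).
Hypothesis hCs : ex P (fun o => shift o ^+ 2) <= Cs * eps ^+ 2.
Hypothesis eps_k : expR (- kp * (D k)%:R) <= eps.
Hypothesis eps_k1 : expR (- kp * (D k.-1)%:R) <= eps.

Let dist_shift o : dist1 (x k o) (x k.-1 o) <= shift o.
Proof. by rewrite lerDl. Qed.
Let s0 o : 0 <= shift o. Proof. exact: shift_ge0. Qed.
Let offk : offset D k = (offset D k.-1 + D k.-1)%N.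
Proof. by rewrite -offsetS// prednK. Qed.

Lemma tame_shift L f : tame q L f -> `|ex P (fun o => f (x k o) - f (x k.-1 o))| <= eps * (Cs + L ^+ 2).
Proof.
move=> tf; have [L0 fL _ _] := tf.
have m1 := tame_measurable hUV hq hmono hx tf k1.
have m2 := tame_measurable hUV hq hmono hx tf kp1.
apply: (shift_mul hUV hq hmono hx k2 eps0 hCs (Z := fun=> L)).
- apply: (L1_dom (g := fun=> L + L)); [by mfun| |exact: (L1_cst P (L + L))].
  move=> o; case: tf => _ _ h _; apply: (le_trans (ler_normB _ _)).
  by apply: lerD; apply/h/(policy_box hx).
- exact: (L1_cst P (L ^+ 2)).
- by rewrite ex_cst.
- move=> o; apply: (le_trans (fL _ _ (policy_box hx o k1) (policy_box hx o kp1))).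
  by rewrite mulrC ler_wpM2r.
Qed.

(** Customer 0 of cycle [k] is the last customer of cycle [k.-1], so both ends are close to steady
    state. The weight [f (x k)] is not in the history of cycle [k.-1]; it is first exchanged for
    [f (x k.-1)], at a cost of order [shift]. *)
Lemma wait_ends L f : tame q L f ->
  `|ex P (fun o => f (x k o) * (WW k (D k) o - WW k 0 o))| <=
  eps * (2 * L * B + (Cs + (2 * (L * Lw)) ^+ 2) + (Cs + L ^+ 2 * M)).
Proof.
move=> tf; have [L0 fL fb fm] := tf.
have W0E o : WW k 0 o = WW k.-1 (D k.-1) o by rewrite /WW /cycle_wait addn0 offk.
have nD : (1 <= D k <= D k)%N by rewrite leqnn (policy_D1 hx).
have nD' : (1 <= D k.-1 <= D k.-1)%N by rewrite leqnn (policy_D1 hx).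
have iW := WW_L1 hUV hq hmono hM hx k1 nD.
have iW' := WW_L1 hUV hq hmono hM hx kp1 nD'.
have [iW2 bW2] := WW_mom hUV hq hmono hM hx kp1 nD' (isT : (1 <= 2 <= 4)%N).
have tfw := tameM tf tw.
have h1 := bound hx k1 nD (fun o => fb _ (policy_box hx o k1)) L0 (tame_history hx tf k1).
have h2 := bound hx kp1 nD' (fun o => fb _ (policy_box hx o kp1)) L0 (tame_history hx tf kp1).
have h3 := tame_shift tfw.
have iw : forall i, (1 <= i)%N -> L1 P (fun o => w (x i o)).
  move=> i i1; have := tame_L1 hUV hq hmono hx tw i1 (L1_cst P 1).
  by under [X in L1 _ X]funext do rewrite mulr1.
have iWw : L1 P (fun o => f (x k o) * (WW k (D k) o - w (x k o))).
  by apply: (tame_L1 hUV hq hmono hx tf k1); apply: L1B => //; exact: iw.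
have iWw' : L1 P (fun o => f (x k.-1 o) * (WW k.-1 (D k.-1) o - w (x k.-1 o))).
  by apply: (tame_L1 hUV hq hmono hx tf kp1); apply: L1B => //; exact: iw.
have ifw : L1 P (fun o => f (x k o) * w (x k o) - f (x k.-1 o) * w (x k.-1 o)).
  by apply: L1B; apply: (tame_L1 hUV hq hmono hx tf) => //; exact: iw.
have idf : L1 P (fun o => (f (x k o) - f (x k.-1 o)) * WW k.-1 (D k.-1) o).
  under [X in L1 _ X]funext do rewrite mulrBl.
  by apply: L1B; exact: (tame_L1 hUV hq hmono hx tf).
have h4 : `|ex P (fun o => (f (x k o) - f (x k.-1 o)) * WW k.-1 (D k.-1) o)| <= eps * (Cs + L ^+ 2 * M).
  apply: (shift_mul hUV hq hmono hx k2 eps0 hCs (Z := fun o => L * WW k.-1 (D k.-1) o)) => //.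
  - by under [X in L1 _ X]funext do rewrite exprMn; exact: L1Z.
  - under [X in ex _ X]funext do rewrite exprMn.
    by rewrite exZ// ler_wpM2l// sqr_ge0.
  - move=> o; rewrite normrM (ger0_norm (WW_ge0 _ _ _ _ _ _ _ _)) mulrA.
    apply: ler_wpM2r; first exact: WW_ge0.
    apply: (le_trans (fL _ _ (policy_box hx o k1) (policy_box hx o kp1))).
    by rewrite mulrC ler_wpM2r.
rewrite (_ : (fun o => _) = fun o => ((f (x k o) * (WW k (D k) o - w (x k o)) -
   f (x k.-1 o) * (WW k.-1 (D k.-1) o - w (x k.-1 o))) +
   (f (x k o) * w (x k o) - f (x k.-1 o) * w (x k.-1 o))) -
   (f (x k o) - f (x k.-1 o)) * WW k.-1 (D k.-1) o); last first.
  by apply/funext => o; rewrite W0E; ring.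
rewrite exB//; last by apply: L1D => //; exact: L1B.
rewrite exD//; last exact: L1B.
rewrite exB//.
apply: (le_trans (ler_normB _ _)); rewrite [leRHS]mulrDr; apply: lerD => //.
apply: (le_trans (ler_normD _ _)); rewrite [leRHS]mulrDr; apply: lerD => //.
apply: (le_trans (ler_normB _ _)); rewrite -mulrA mulrCA mulr_natl mulr2n.
have LB : 0 <= L * B by exact: mulr_ge0.
by apply: lerD; [apply: (le_trans h1)|apply: (le_trans h2)]; rewrite mulrA mulrC ler_wpM2r.
Qed.

Lemma wait_late n : (1 <= n <= D k)%N ->
  `|ex P (fun o => WW k n o - w (x k o))| <= B * expR (- kp) ^+ n.
Proof.
move=> nD; have := bound hx k1 nD (G := fun=> 1) (cG := 1) _ _ _.
under [X in ex _ X]funext do rewrite mul1r.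
rewrite mul1r -expRM_natl mulrN mulNr (mulrC n%:R); apply => //.
  by move=> o; rewrite normr1.
by move=> S mS; exact: sigma_of_cst.
Qed.

Variables (Ll : R).
Hypothesis tl : tame q Ll (fun y => lam q y.2).
Let Ce : R := (mu_lo q)^-1 + Ll * (lam q (p_hi q))^-1.

(** In the merged system the customer is number [D k.-1 + n] of its cycle, so the length of cycle
    [k.-1] alone brings it near [w (x k.-1)]. The exchange of systems and the change from
    [w (x k.-1)] to [w (x k)] are both of order [shift]. *)
Lemma wait_early n : (1 <= n <= D k)%N ->
  `|ex P (fun o => WW k n o - w (x k o))| <=
  eps * ((Cs + Ce ^+ 2 * (40 * M)) + B + (Cs + Lw ^+ 2)).
Proof.
move=> nD; pose j := k.-1; have jk : j.+1 = k by rewrite prednK.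
pose D' := extend_D D j; pose x' := extend_x q x j.
have hx' : policy_ok U V q D' x' by exact: extend_ok.
have nD'E : (D j + n <= D' j)%N by rewrite /D' extend_Dj jk leq_add2l; case/andP: nD.
have nD' : (1 <= D j + n <= D' j)%N by rewrite nD'E ltn_addl//; case/andP: nD.
pose W' := Defs.WW U V q D' x' j (D j + n).
pose X' := Defs.XX U V q D' x' j (D j + n).
pose Wk := WW k n; pose Xk := Defs.XX U V q D x k n.
have ml0 : 0 < mu_lo q := box_mu_gt0 hq (box_lo hq).
have ll0 : 0 < lam q (p_hi q) by case: hq => _ _ _; apply; exact: p_hi_itv.
have [Ll0 lL _ _] := tl.
have Ce0 : 0 <= Ce by rewrite addr_ge0 ?mulr_ge0 ?invr_ge0// ltW.
have cmp o : `|Wk o - W' o| <= shift o * (Ce * (Wk o + 2 * Xk o + (W' o + 2 * X' o))).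
  have bk := policy_box hx o k1; have bj := policy_box hx o kp1.
  have mk := box_mu_gt0 hq bk; have mj := box_mu_gt0 hq bj.
  have lk := box_lam_gt0 hq bk; have lj := box_lam_gt0 hq bj.
  have dmu : `|(x k o).1 - (x j o).1| <= shift o by apply: le_trans (dist_shift o); rewrite lerDl.
  have dlam : `|lam q (x k o).2 - lam q (x j o).2| <= Ll * shift o.
    by apply: (le_trans (lL _ _ bk bj)); rewrite ler_wpM2l.
  have inv_rel (a b c L : R) : 0 < c -> c <= a -> c <= b -> `|a - b| <= L * shift o ->
      `|a^-1 - b^-1| <= (shift o * (L * c^-1)) * a^-1 /\
      `|a^-1 - b^-1| <= (shift o * (L * c^-1)) * b^-1.
    move=> c0 ca cb ab; have a0 := lt_le_trans c0 ca; have b0 := lt_le_trans c0 cb.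
    have -> : a^-1 - b^-1 = (b - a) * a^-1 * b^-1 by field; rewrite !gt_eqF.
    rewrite !normrM distrC !normfV (gtr0_norm a0) (gtr0_norm b0).
    have ai : a^-1 <= c^-1 by rewrite lef_pV2 ?posrE.
    have bi : b^-1 <= c^-1 by rewrite lef_pV2 ?posrE.
    rewrite [shift o * _]mulrA (mulrC (shift o)).
    split; first rewrite mulrAC.
      by apply: ler_wpM2r; [rewrite invr_ge0 ltW|apply: ler_pM => //; rewrite invr_ge0 ltW].
    by apply: ler_wpM2r; [rewrite invr_ge0 ltW|apply: ler_pM => //; rewrite invr_ge0 ltW].
  have [r1 r2] : `|(x k o).1^-1 - (x j o).1^-1| <= (shift o * (1 * (mu_lo q)^-1)) * (x k o).1^-1 /\
      `|(x k o).1^-1 - (x j o).1^-1| <= (shift o * (1 * (mu_lo q)^-1)) * (x j o).1^-1.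
    by apply: inv_rel; rewrite ?mul1r//; [case: bk|case: bj].
  have [r3 r4] := inv_rel _ _ _ _ ll0 (box_lam_ge hq hmono bk) (box_lam_ge hq hmono bj) dlam.
  have le1 : shift o * (1 * (mu_lo q)^-1) <= shift o * Ce.
    by rewrite ler_wpM2l// mul1r lerDl mulr_ge0// invr_ge0 ltW.
  have le2 : shift o * (Ll * (lam q (p_hi q))^-1) <= shift o * Ce.
    by rewrite ler_wpM2l// lerDr invr_ge0 ltW.
  have up (r s t a : R) : 0 < a -> r <= s * a^-1 -> s <= t -> r <= t * a^-1.
    by move=> a0 h st; apply: (le_trans h); rewrite ler_wpM2r// invr_ge0 ltW.
  rewrite mulrA.
  have := @cycle_compare _ (lam q) D D' (x ^~ o) (x' ^~ o) (U ^~ o) (V ^~ o) j (shift o * Ce)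
    (policy_D1 hx) (policy_D1 hx') (fun i => policy_l0 hq hx o (k := i))
    (fun i => policy_m0 hq hx o (k := i)) (fun i => policy_l0 hq hx' o (k := i))
    (fun i => policy_m0 hq hx' o (k := i)) (fun m => U_ge0 hUV m o) (fun m => V_ge0 hUV m o) kp1.
  rewrite jk /= => cmp.
  have idx : (offset D k + n = offset D' j + (D j + n))%N.
    by rewrite /D' -extend_offset// addnA offk.
  have := cmp _ _ _ _ (up _ _ _ _ mk r1 le1) (up _ _ _ _ mj r2 le1) (up _ _ _ _ lk r3 le2)
    (up _ _ _ _ lj r4 le2) n (offset D k + n)%N _ erefl.
  rewrite /Wk /W' /Xk /X' /Defs.WW /Defs.XX /cycle_wait /cycle_busy -idx; apply.
  - by move=> i /andP[_ ij]; exact: extend_DE.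
  - by rewrite /D' extend_Dj jk.
  - by move=> i /andP[_ ij]; exact: extend_xE.
  - exact: mulr_ge0.
  - by case/andP: nD.
have iWk := WW_L1 hUV hq hmono hM hx k1 nD.
have iW' := WW_L1 hUV hq hmono hM hx' kp1 nD'.
have [iWk2 bWk2] := WW_mom hUV hq hmono hM hx k1 nD (isT : (1 <= 2 <= 4)%N).
have [iW'2 bW'2] := WW_mom hUV hq hmono hM hx' kp1 nD' (isT : (1 <= 2 <= 4)%N).
have [iXk2 bXk2] := XX_mom hUV hq hmono hM hx k1 nD (isT : (1 <= 2 <= 4)%N).
have [iX'2 bX'2] := XX_mom hUV hq hmono hM hx' kp1 nD' (isT : (1 <= 2 <= 4)%N).
have mXk := XX_measurable hUV hq hmono hx k n.
have mX' := XX_measurable hUV hq hmono hx' j (D j + n).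
have mWk := L1_measurable iWk; have mW' := L1_measurable iW'.
pose Z o := Ce * (Wk o + 2 * Xk o + (W' o + 2 * X' o)).
(* Square of a sum of four terms; with every second moment at most [M] this gives 4 (1 + 4 + 1 + 4)
   M = 40 M. *)
pose Z2 o := Ce ^+ 2 * (4 * (Wk o ^+ 2 + 4 * Xk o ^+ 2 + (W' o ^+ 2 + 4 * X' o ^+ 2))).
have iZ2 : L1 P Z2.
  by apply/L1Z/L1Z; apply: L1D; apply: L1D => //; exact: L1Z.
have ZZ o : Z o ^+ 2 <= Z2 o.
  rewrite /Z /Z2 exprMn ler_wpM2l ?sqr_ge0//.
  move: (Wk o) (Xk o) (W' o) (X' o) => a b a' b'.
  have := sqr_ge0 (a - 2 * b); have := sqr_ge0 (a - a'); have := sqr_ge0 (a - 2 * b').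
  have := sqr_ge0 (2 * b - a'); have := sqr_ge0 (2 * b - 2 * b'); have := sqr_ge0 (a' - 2 * b').
  by nra.
have mZ : measurable_fun setT Z by rewrite /Z; mfun.
have iZ : L1 P (fun o => Z o ^+ 2).
  by apply: (L1_dom _ _ iZ2); [mfun|move=> o; rewrite ger0_norm ?sqr_ge0].
have bZ : ex P (fun o => Z o ^+ 2) <= Ce ^+ 2 * (40 * M).
  apply: (le_trans (ex_le iZ iZ2 ZZ)); rewrite /Z2 exZ; last first.
    by apply/L1Z; apply: L1D; apply: L1D => //; exact: L1Z.
  rewrite exZ; last by apply: L1D; apply: L1D => //; exact: L1Z.
  rewrite exD; [|by apply: L1D => //; exact: L1Z|by apply: L1D => //; exact: L1Z].
  rewrite exD//; last exact: L1Z.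
  rewrite exD//; last exact: L1Z.
  rewrite !exZ// ler_wpM2l ?sqr_ge0//; move: bWk2 bW'2 bXk2 bX'2.
  by rewrite -/Wk -/Xk -/W' -/X'; move: (ex _ _) (ex _ _) (ex _ _) (ex _ _) => ? ? ? ?; lra.
have iw i : (1 <= i)%N -> L1 P (fun o => w (x i o)).
  move=> i1; have := tame_L1 hUV hq hmono hx tw i1 (L1_cst P 1).
  by under [X in L1 _ X]funext do rewrite mulr1.
have t1 : `|ex P (fun o => Wk o - W' o)| <= eps * (Cs + Ce ^+ 2 * (40 * M)).
  by apply: (shift_mul hUV hq hmono hx k2 eps0 hCs (Z := Z)) => //; exact: L1B.
have t2 : `|ex P (fun o => W' o - w (x j o))| <= eps * B.
  have := bound hx' kp1 nD' (G := fun=> 1) (cG := 1) _ _ _.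
  under [X in ex _ X]funext do rewrite mul1r.
  rewrite mul1r => h; apply: (le_trans (y := B * expR (- kp * (D j + n)%:R))).
    rewrite (_ : (fun o => W' o - w (x j o)) = fun o => W' o - w (x' j o)); last first.
      by apply/funext => o; rewrite /x' -extend_xE.
    apply: h => //; first by move=> o; rewrite normr1.
    by move=> S mS; exact: sigma_of_cst.
  rewrite mulrC ler_wpM2r//; apply: le_trans eps_k1.
  by rewrite ler_expR natrD mulrDr gerDl mulr_le0_ge0// oppr_le0 ltW.
have t3 := tame_shift tw.
rewrite (_ : (fun o => _) = fun o => ((Wk o - W' o) + (W' o - w (x j o))) - (w (x k o) - w (x j o))); last first.
  by apply/funext => o; rewrite -/(Wk o); ring.
have i3 : L1 P (fun o => w (x k o) - w (x j o)) by apply: L1B; exact: iw.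
have i1 : L1 P (fun o => Wk o - W' o) by exact: L1B.
have i2 : L1 P (fun o => W' o - w (x j o)) by apply: L1B => //; exact: iw.
rewrite exB//; last exact: L1D.
rewrite exD//.
apply: (le_trans (ler_normB _ _)); rewrite [leRHS]mulrDr; apply: lerD => //.
by apply: (le_trans (ler_normD _ _)); rewrite [leRHS]mulrDr; apply: lerD.
Qed.

End cycle_means.

(** * The regret of one cycle *)

Section sums.
Context {R : realType}.
Implicit Types (r : R) (a : nat -> R).

Lemma geometric_le r n : 0 <= r < 1 -> \sum_(0 <= j < n) r ^+ j <= (1 - r)^-1.
Proof.
move=> /andP[r0 r1]; have r1' : 0 < 1 - r by rewrite subr_gt0.
rewrite -[leRHS]mul1r ler_pdivlMr//.
suff -> : (\sum_(0 <= j < n) r ^+ j) * (1 - r) = 1 - r ^+ n by rewrite gerBl exprn_ge0.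
elim: n => [|n IH]; first by rewrite big_geq// mul0r expr0 subrr.
by rewrite big_nat_recr//= mulrDl IH exprS; ring.
Qed.

(** The first [N] terms take the uniform bound and the others the geometric one. With [N] of order
    log k this is the origin of the logarithm in the rate. *)
Lemma two_regime_sum a r (E B : R) n N : 0 <= r < 1 -> 0 <= E -> 0 <= B ->
  (forall i, (i < n)%N -> a i <= E) -> (forall i, (i < n)%N -> a i <= B * r ^+ i.+1) ->
  \sum_(0 <= i < n) a i <= N%:R * E + B * r ^+ N * (1 - r)^-1.
Proof.
move=> hr E0 B0 h1 h2; have /andP[r0 r1] := hr.
have first m : (m <= n)%N -> \sum_(0 <= i < m) a i <= m%:R * E.
  move=> mn; rewrite -[m%:R * E](_ : \sum_(0 <= i < m) E = _); last by rewrite big_const_nat iter_addr_0 subn0 mulr_natl.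
  by rewrite !big_nat; apply: ler_sum => i /andP[_ im]; apply: h1; exact: leq_trans mn.
have B0' : 0 <= B * r ^+ N * (1 - r)^-1 by rewrite !mulr_ge0// ?exprn_ge0// invr_ge0 subr_ge0 ltW.
have [nN|nN] := leqP n N.
  apply: (le_trans (first _ (leqnn n))); rewrite -[leLHS]addr0; apply: lerD => //.
  by rewrite ler_wpM2r// ler_nat.
rewrite (big_cat_nat _ (n := N))//=; last exact: ltnW.
apply: lerD; first by apply: first; exact: ltnW.
rewrite -{1}[N]add0n big_addn.
apply: (@le_trans _ _ (\sum_(0 <= i < n - N) B * r ^+ N * r ^+ i)).
  rewrite !big_nat; apply: ler_sum => i /andP[_ iN].
  apply: (le_trans (h2 _ _)); first by rewrite addnC -ltn_subRL.
  rewrite -mulrA; apply: ler_wpM2l => //; rewrite -exprD (addnC N).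
  by rewrite exprS ler_piMl ?exprn_ge0// ltW.
rewrite -mulr_sumr; apply: ler_wpM2l; last exact: geometric_le.
by rewrite mulr_ge0// exprn_ge0.
Qed.

Lemma sum_threshold (F G : nat -> R) Q n :
  \sum_(1 <= i < (minn Q n).+1) F i + \sum_(Q.+1 <= i < n.+1) G i =
  \sum_(0 <= i < n) (if (i < Q)%N then F i.+1 else G i.+1).
Proof.
rewrite !big_add1 /=; have [nQ|Qn] := leqP n Q.
  rewrite [X in _ + X]big_geq ?ltnS// addr0.
  by apply: eq_big_nat => i /andP[_ iN]; rewrite (leq_trans iN nQ).
rewrite [RHS](big_cat_nat _ (n := Q))//=; last exact: ltnW.
congr (_ + _); apply: eq_big_nat => i /andP[h1 h2]; first by rewrite h2.
by rewrite ltnNge h1.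
Qed.

End sums.

(** * Pathwise decomposition of the regret of a cycle *)

Section regret_identity.
Context {R : realType} {d : measure_display} {Om : measurableType d}.
Variables (P : probability Om R) (U V : nat -> {RV P >-> R}) (q : queue_model R).
Hypothesis hUV : primitives_ok U V.
Hypothesis hq : model_ok q.
Hypothesis hmono : {in `[p_lo q, p_hi q] &, {homo lam q : r s /~ r <= s}}.
Hypothesis hcost : {in `[mu_lo q, mu_hi q] &, {homo cost q : r s / r <= s}}.
Variables (Winf : R -> R -> probability R R) (w : R * R -> R).
Hypothesis hw : forall z, box q z -> \int[Winf z.1 z.2]_y y = w z.
Variables (D : nat -> nat) (x : nat -> Om -> R * R).
Hypothesis hx : policy_ok U V q D x.
Variable k : nat.
Hypothesis k1 : (1 <= k)%N.
Local Notation c o := (customer_at (lam q) D (x ^~ o) (U ^~ o) (V ^~ o)).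
Local Notation WW := (WW U V q D x).
Local Notation TT := (TT U V q D x).
Local Notation pc i o := (price_cycle D (c o) (offset D k + i)).
Local Notation u i o := (U (offset D k + i) o).
Local Notation v i o := (V (offset D k + i) o).

(** Stationary holding cost of one customer minus the price paid; the loss rate is the staffing cost
    plus [margin_rate]. *)
Definition margin (z : R * R) : R := h0 q * (w z + z.1^-1) - z.2.
Definition margin_rate (z : R * R) : R := margin z * lam q z.2.

Definition cost_term i o : R :=
  h0 q * (WW k i.+1 o - w (x k o)) + h0 q * ((x k o).1^-1 * (v i o - 1)) +
  ((x k o).2 - (x (pc i o) o).2) * waiting U V q D x k i o
  - margin (x k o) * (u i o - 1) +
  ((lam q (x k o).2)^-1 - (lam q (x (pc i o) o).2)^-1) * (margin_rate (x k o) * u i o).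

Definition end_term o : R := margin_rate (x k o) * (WW k (D k) o - WW k 0 o).

Lemma TT_sum o : TT k o =
  \sum_(0 <= i < D k) u i o / lam q (x (pc i o) o).2 + (WW k (D k) o - WW k 0 o).
Proof.
rewrite /Defs.TT cycle_length_sum// big_add1 /= -addrA; congr (_ + (_ - _)).
- by apply: eq_big_nat => i _; rewrite addnS.
- by rewrite /Defs.WW /cycle_wait -offsetS.
- by rewrite /Defs.WW /cycle_wait addn0.
Qed.

(** The staffing cost times the cycle length cancels. The rest of the loss rate multiplies the sum
    of the interarrival times, in which each rate is compared with that of cycle [k], and the change
    of the waiting time over the cycle, which is [end_term]. *)
Lemma regret_pointwise o :
  cycle_cost U V q D x k o - loss_rate q Winf (x k o) * TT k o =
  \sum_(0 <= i < D k) cost_term i o - end_term o.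
Proof.
rewrite /cycle_cost sum_threshold /loss_rate (hw (policy_box hx o k1)) TT_sum.
set p := x k o; have bp : box q p := policy_box hx o k1.
have m0 := box_mu_gt0 hq bp; have l0 := box_lam_gt0 hq bp.
set Wd := WW k (D k) o - WW k 0 o.
set f := h0 q * lam q p.2 * (w p + 1 / p.1) + cost q p.1 - p.2 * lam q p.2.
have fE : f = cost q p.1 + margin_rate p by rewrite /f /margin_rate /margin; field; rewrite gt_eqF.
rewrite fE /end_term -/p -/Wd; set S := (X in X + _ * _ - _); set G := \sum_(_ <= i < _) _ / _.
transitivity (S - margin_rate p * G - margin_rate p * Wd); first by ring.
congr (_ - _); rewrite /S /G {S G} mulr_sumr -sumrB; apply: eq_big_nat => i iD.
have bj : box q (x (pc i o) o) by apply: (policy_box hx); exact: price_cycle_ge1.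
have lj := box_lam_gt0 hq bj.
rewrite /cost_term /waiting -/p /SS /cycle_service /pp /cycle_price /price addnS /=.
rewrite -/p /margin_rate /margin.
by case: ifP => _ /=; field; rewrite !gt_eqF.
Qed.

Lemma cost_bounded z : box q z -> `|cost q z.1| <= `|cost q (mu_lo q)| + `|cost q (mu_hi q)|.
Proof.
move=> [z1 z2 _ _]; have zi : z.1 \in `[mu_lo q, mu_hi q] by rewrite in_itv/= z1.
have lohi : mu_lo q <= mu_hi q by exact: le_trans z2.
have li : mu_lo q \in `[mu_lo q, mu_hi q] by rewrite in_itv/= lexx.
have hi : mu_hi q \in `[mu_lo q, mu_hi q] by rewrite in_itv/= lexx lohi.
have h1 := hcost li zi z1; have h2 := hcost zi hi z2.
have := ler_norm (cost q (mu_hi q)); have := lerNnormlW (lexx `|cost q (mu_lo q)|).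
have := normr_ge0 (cost q (mu_hi q)); have := normr_ge0 (cost q (mu_lo q)).
by rewrite ler_norml => *; apply/andP; split; lra.
Qed.

Lemma cost_measurable : measurable_fun setT (fun o => cost q (x k o).1).
Proof.
pose clamp p := Num.max (mu_lo q) (Num.min p (mu_hi q)).
have lohi : mu_lo q <= mu_hi q by case: hq => /andP[_ /ltW].
have clampP p : clamp p \in `[mu_lo q, mu_hi q].
  by rewrite in_itv/= /clamp le_max lexx ge_max lohi ge_min lexx orbT.
have mx := policy_measurable hUV hq hmono hx k1.
rewrite (_ : (fun o => _) = (cost q \o clamp) \o (fun o => (x k o).1)).
  apply: measurableT_comp; last by mfun.
  apply: nondecreasing_measurable => // r s rs /=; apply: hcost => //.
  by rewrite /clamp ge_max !le_max lexx /= le_min !ge_min rs lexx !orbT.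
apply/funext => o /=; congr (cost q _); case: (policy_box hx o k1) => h1 h2 _ _.
by rewrite /clamp (min_idPl h2) (max_idPr h1).
Qed.

Variables (Lw Ll : R).
Hypothesis tw : tame q Lw w.
Hypothesis tl : tame q Ll (fun y => lam q y.2).

Lemma tame_mu_inv : exists L, tame q L (fun y => y.1^-1).
Proof.
have [L tL] := tame_fst hq; have m0 := box_mu_gt0 hq (box_lo hq).
by eexists; apply: (tame_inv m0 _ tL) => y [].
Qed.

Lemma tame_lam_inv : exists L, tame q L (fun y => (lam q y.2)^-1).
Proof.
have l0 : 0 < lam q (p_hi q) by case: hq => _ _ _; apply; exact: p_hi_itv.
by eexists; apply: (tame_inv l0 _ tl) => y; exact: box_lam_ge.
Qed.

Lemma tame_margin : exists L, tame q L margin.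
Proof.
have [L1' t1] := tame_mu_inv; have [L2' t2] := tame_snd hq.
have t3 := tameM (tame_cst q (h0 q)) (tameD tw t1).
have t4 := tameM (tame_cst q (-1)) t2.
eexists; have := tameD t3 t4; rewrite (_ : (fun y => _) = margin); first exact.
by apply/funext => y; rewrite /margin mulN1r.
Qed.

Lemma tame_margin_rate : exists L, tame q L margin_rate.
Proof. by have [L tm] := tame_margin; eexists; exact: (tameM tm tl). Qed.

Hypothesis iW : forall i, (i <= D k)%N -> L1 P (WW k i).

Let iU i : L1 P (fun o => u i o). Proof. by have [] := U_mean hUV (offset D k + i). Qed.
Let iV i : L1 P (fun o => v i o). Proof. by have [] := V_mean hUV (offset D k + i). Qed.

Lemma tame_price_measurable L f i : tame q L f -> measurable_fun setT (fun o => f (x (pc i o) o)).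
Proof.
move=> tf; apply: (price_fun_measurable hUV hq hmono hx (g := f)) => j j1.
exact: (tame_measurable hUV hq hmono hx tf j1).
Qed.

Lemma tame_price_L1 L f g i : tame q L f -> L1 P g ->
  L1 P (fun o => (f (x k o) - f (x (pc i o) o)) * g o).
Proof.
move=> tf ig; have [_ _ fb _] := tf; have mg := L1_measurable ig.
have m1 := tame_measurable hUV hq hmono hx tf k1.
have m2 := tame_price_measurable i tf.
apply: (L1_dom (g := fun o => (L + L) * `|g o|)); first by mfun.
  move=> o; rewrite normrM ler_wpM2r// (le_trans (ler_normB _ _))// lerD// fb//;
    apply: (policy_box hx) => //; exact: price_cycle_ge1.
exact/L1Z/L1_norm.
Qed.

Lemma waiting_L1 i : L1 P (fun o => waiting U V q D x k i o).
Proof.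
apply: (L1_dom (g := fun=> 1)); [exact: waiting_measurable| |exact: (L1_cst P 1)].
by move=> o; rewrite /waiting; case: (_ < _)%N; rewrite ?normr1 ?normr0.
Qed.

Definition price_term i o : R := ((x k o).2 - (x (pc i o) o).2) * waiting U V q D x k i o.
Definition arrival_term i o : R := margin (x k o) * (u i o - 1).
Definition rate_term i o : R :=
  ((lam q (x k o).2)^-1 - (lam q (x (pc i o) o).2)^-1) * (margin_rate (x k o) * u i o).
Definition wait_term i o : R := WW k i.+1 o - w (x k o).
Definition service_term i o : R := (x k o).1^-1 * (v i o - 1).

Let i1 : L1 P (fun _ : Om => 1 : R). Proof. exact: (L1_cst P 1). Qed.

Lemma price_term_L1 i : L1 P (price_term i).
Proof. by have [L ts] := tame_snd hq; apply: (tame_price_L1 i ts); exact: waiting_L1. Qed.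
Lemma arrival_term_L1 i : L1 P (arrival_term i).
Proof. by have [L tm] := tame_margin; apply: (tame_L1 hUV hq hmono hx tm k1); exact: L1B. Qed.
Lemma rate_term_L1 i : L1 P (rate_term i).
Proof.
have [L tm] := tame_margin_rate; have [L' ti] := tame_lam_inv.
by apply: (tame_price_L1 i ti); exact: (tame_L1 hUV hq hmono hx tm k1).
Qed.
Lemma wait_term_L1 i : (i < D k)%N -> L1 P (wait_term i).
Proof.
move=> iD; apply: L1B; first exact: iW.
by have := tame_L1 hUV hq hmono hx tw k1 i1; under [X in L1 _ X]funext do rewrite mulr1.
Qed.
Lemma service_term_L1 i : L1 P (service_term i).
Proof. by have [L tm] := tame_mu_inv; apply: (tame_L1 hUV hq hmono hx tm k1); exact: L1B. Qed.
Lemma end_term_L1 : L1 P end_term.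
Proof.
by have [L tm] := tame_margin_rate; apply: (tame_L1 hUV hq hmono hx tm k1); apply: L1B; exact: iW.
Qed.

Lemma cost_term_L1 i : (i < D k)%N -> L1 P (cost_term i).
Proof.
move=> iD; apply: L1D; last exact: rate_term_L1.
apply: L1B; last exact: arrival_term_L1.
apply: L1D; last exact: price_term_L1.
by apply: L1D; apply: L1Z; [exact: wait_term_L1|exact: service_term_L1].
Qed.

Lemma cost_term_ex i : (i < D k)%N -> ex P (cost_term i) =
  h0 q * ex P (wait_term i) + h0 q * ex P (service_term i) + ex P (price_term i)
  - ex P (arrival_term i) + ex P (rate_term i).
Proof.
move=> iD; have hW := wait_term_L1 iD; have hS := service_term_L1 i.
have hP := price_term_L1 i; have hA := arrival_term_L1 i; have hR := rate_term_L1 i.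
have hWS : L1 P (fun o => h0 q * wait_term i o + h0 q * service_term i o) by apply: L1D; exact: L1Z.
have hWSP : L1 P (fun o => h0 q * wait_term i o + h0 q * service_term i o + price_term i o).
  exact: L1D.
rewrite /cost_term exD//; last exact: L1B.
rewrite exB// exD// exD; [|exact: L1Z|exact: L1Z].
by rewrite !exZ.
Qed.

Lemma TT_L1 : L1 P (TT k).
Proof.
have [L ti] := tame_lam_inv; have [_ _ tb _] := ti.
under [X in L1 _ X]funext do rewrite TT_sum.
apply: L1D; last by apply: L1B; exact: iW.
apply: L1_sum => i _; have mp := tame_price_measurable i ti; have mU := L1_measurable (iU i).
apply: (L1_dom (g := fun o => L * `|u i o|)); first by mfun.
  move=> o; rewrite normrM mulrC ler_wpM2r// tb//.
  by apply: (policy_box hx); exact: price_cycle_ge1.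
exact/L1Z/L1_norm.
Qed.

Lemma regret_ex : regret_ns U V q D x Winf k =
  (\sum_(0 <= i < D k) ex P (cost_term i) - ex P end_term)%:E.
Proof.
pose S o := \sum_(0 <= i < D k) cost_term i o.
have iS : L1 P S.
  under [X in L1 _ X]funext do rewrite /S big_nat.
  by apply: L1_sum => i /andP[_]; exact: cost_term_L1.
have iE := end_term_L1.
have [Lr [_ _ rb rm]] := tame_margin_rate.
have iF : L1 P (fun o => loss_rate q Winf (x k o) * TT k o).
  have mT := L1_measurable TT_L1.
  have lE o : loss_rate q Winf (x k o) = cost q (x k o).1 + margin_rate (x k o).
    have bp := policy_box hx o k1; have m0 := box_mu_gt0 hq bp.
    by rewrite /loss_rate (hw bp) /margin_rate /margin; field; rewrite gt_eqF.
  have mL : measurable_fun setT (fun o => loss_rate q Winf (x k o)).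
    under eq_fun do rewrite lE; apply: measurable_funD; first exact: cost_measurable.
    apply: rm; first exact: (policy_measurable hUV hq hmono hx k1).
    by move=> o; exact: (policy_box hx).
  apply: (L1_dom (g := fun o => (`|cost q (mu_lo q)| + `|cost q (mu_hi q)| + Lr) * `|TT k o|)).
  - by mfun.
  - move=> o; have bp := policy_box hx o k1; rewrite normrM ler_wpM2r// lE.
    by rewrite (le_trans (ler_normD _ _))// lerD// ?rb// cost_bounded.
  - exact: (L1Z _ (L1_norm TT_L1)).
have iC : L1 P (cycle_cost U V q D x k).
  have -> : cycle_cost U V q D x k = fun o => (S o - end_term o) + loss_rate q Winf (x k o) * TT k o.
    by apply/funext => o; rewrite -regret_pointwise subrK.
  by apply: L1D => //; exact: L1B.
rewrite /regret_ns (expectation_ex iC) (expectation_ex iF) -EFinB -exB//.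
under [X in ex _ X]funext do rewrite regret_pointwise.
rewrite exB//; congr (_ - _)%:E.
rewrite [RHS]big_nat -ex_sum; last by move=> i /andP[_]; exact: cost_term_L1.
by congr ex; apply/funext => o; rewrite big_nat.
Qed.

End regret_identity.

(** * Summation over the customers of a cycle *)

Section cycle_regret.
Context {R : realType} {d : measure_display} {Om : measurableType d}.
Variables (P : probability Om R) (U V : nat -> {RV P >-> R}) (q : queue_model R).
Hypothesis hUV : primitives_ok U V.
Hypothesis hq : model_ok q.
Hypothesis hmono : {in `[p_lo q, p_hi q] &, {homo lam q : r s /~ r <= s}}.
Hypothesis hcost : {in `[mu_lo q, mu_hi q] &, {homo cost q : r s / r <= s}}.
Hypothesis stuck0 : P (stuck U) = 0%E.
Variables (eta M C4 : R).
Hypothesis eta0 : 0 < eta.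
Hypothesis M0 : 0 < M.
Hypothesis hM : moments_le U V q eta M.
Hypothesis C40 : 0 < C4.
Hypothesis hC4 : forall m, L1 P (fun o => (U m o + 1) ^+ 4) /\ ex P (fun o => (U m o + 1) ^+ 4) <= C4.
Variables (Winf : R -> R -> probability R R) (w : R * R -> R) (Lw Ll B kp : R).
Hypothesis hw : forall z, box q z -> \int[Winf z.1 z.2]_y y = w z.
Hypothesis kp0 : 0 < kp.
Hypothesis B0 : 0 <= B.
Hypothesis tw : tame q Lw w.
Hypothesis tl : tame q Ll (fun y => lam q y.2).
Hypothesis bound : transient_decay U V q w B kp.

(** The moment bounds start with customer 1. Customer 0 is the last one of the previous cycle, or
    has waiting time 0 in cycle 1. *)
Lemma WW_L1_all D x (hx : policy_ok U V q D x) k i : (1 <= k)%N -> (i <= D k)%N ->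
  L1 P (WW U V q D x k i).
Proof.
move=> k1 iD; case: (posnP i) => [->|i0]; last by apply: (WW_L1 hUV hq hmono hM hx) => //; rewrite i0.
have [k2|k2] := leqP k 1.
  have -> : WW U V q D x k 0 = fun=> 0.
    apply/funext => o; have -> : k = 1%N by apply/eqP; rewrite eqn_leq k2.
    by rewrite /WW /cycle_wait offset1.
  exact: (L1_cst P 0).
have kp1 : (1 <= k.-1)%N by case: k k2 {k1 iD} => // -[].
have -> : WW U V q D x k 0 = WW U V q D x k.-1 (D k.-1).
  by apply/funext => o; rewrite /WW /cycle_wait addn0 -offsetS// prednK.
by apply: (WW_L1 hUV hq hmono hM hx) => //; rewrite leqnn (policy_D1 hx).
Qed.

Lemma regret_finite D x (hx : policy_ok U V q D x) k : (1 <= k)%N ->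
  exists r, regret_ns U V q D x Winf k = r%:E.
Proof.
move=> k1; eexists; apply: (regret_ex hUV hq hmono hcost hw hx k1 tw tl) => i iD.
exact: WW_L1_all.
Qed.

(** The constant is chosen before the policy and the cycle. The first [N] waiting times cost [eps]
    each; their tail, the leftover customers and the end term cost a multiple of [eps] together,
    whence [N.+1]. *)
Lemma cycle_regret_bound Cs : 0 <= Cs -> exists2 C, 0 <= C &
  forall D x, policy_ok U V q D x -> forall k, (2 <= k)%N -> forall eps, 0 < eps -> forall N,
  ex P (fun o => shift U V q D x k o ^+ 2) <= Cs * eps ^+ 2 ->
  expR (- kp * (D k)%:R) <= eps -> expR (- kp * (D k.-1)%:R) <= eps -> expR (- kp) ^+ N <= eps ->
  (regret_ns U V q D x Winf k <= (C * (eps * N.+1%:R))%:E)%E.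
Proof.
move=> Cs0.
have [Ls ts] := tame_snd hq; have [Lm tm] := tame_margin hq tw.
have [Lr tr] := tame_margin_rate hq tw tl; have [Li ti] := tame_lam_inv hq hmono tl.
have hh0 : 0 < h0 q by case: hq.
have [Ls0 _ _ _] := ts; have [Lm0 _ _ _] := tm; have [Lr0 _ rb _] := tr; have [Li0 _ _ _] := ti.
pose Ce := (mu_lo q)^-1 + Ll * (lam q (p_hi q))^-1.
pose E1 := (Cs + Ce ^+ 2 * (40 * M)) + B + (Cs + Lw ^+ 2).
pose E2 := 2 * Lr * B + (Cs + (2 * (Lr * Lw)) ^+ 2) + (Cs + Lr ^+ 2 * M).
pose r := expR (- kp); pose r2 := expR (- (eta / 4)).
have r01 : 0 <= r < 1 by rewrite expR_ge0 /= expR_lt1 oppr_lt0.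
have r201 : 0 <= r2 < 1 by rewrite expR_ge0 /= expR_lt1 oppr_lt0 divr_gt0.
pose Cx := 2 * Ls * 1 + 2 * Lm + 2 * Li * Lr.
have Cx0 : 0 <= Cx by rewrite !addr_ge0// !mulr_ge0.
have E10 : 0 <= E1.
  by rewrite !addr_ge0// ?sqr_ge0// mulr_ge0 ?sqr_ge0// mulr_ge0// ltW.
have E20 : 0 <= E2.
  by rewrite !addr_ge0 ?sqr_ge0 ?mulr_ge0 ?sqr_ge0// ltW.
have g1 : 0 <= (1 - r)^-1 by rewrite invr_ge0 subr_ge0 ltW; case/andP: r01.
have g2 : 0 <= (1 - r2)^-1 by rewrite invr_ge0 subr_ge0 ltW; case/andP: r201.
have MC : 0 <= Cs + (M + C4) by apply: addr_ge0 => //; apply: addr_ge0; exact: ltW.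
pose T1 := h0 q * E1; pose T2 := h0 q * (B * (1 - r)^-1).
pose T3 := Cx * ((Cs + (M + C4)) * (1 - r2)^-1).
have T10 : 0 <= T1 by apply: mulr_ge0 => //; exact: ltW.
have T20 : 0 <= T2 by apply: mulr_ge0; [exact: ltW|exact: mulr_ge0].
have T30 : 0 <= T3 by apply: mulr_ge0 => //; exact: mulr_ge0.
have CC : 0 <= T1 + T2 + T3 + E2 by apply: addr_ge0 => //; apply: addr_ge0 => //; exact: addr_ge0.
exists (T1 + T2 + T3 + E2) => //.
move=> D x hx k k2 eps eps0 N hCs ek ek1 eN.
have k1 : (1 <= k)%N by exact: ltnW.
have iW i : (i <= D k)%N -> L1 P (WW U V q D x k i) by exact: WW_L1_all.
rewrite (regret_ex hUV hq hmono hcost hw hx k1 tw tl iW) lee_fin.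
pose a i := `|ex P (wait_term U V q w D x k i)|.
pose J i := ex P (fun o => waiting U V q D x k i o * shift U V q D x k o * (U (offset D k + i) o + 1)).
have term i : (i < D k)%N -> ex P (cost_term U V q w D x k i) <= h0 q * a i + Cx * J i.
  move=> iD; rewrite (cost_term_ex hUV hq hmono hx k1 tw tl iW iD).
  have [Lmu tmu] := tame_mu_inv hq.
  have e2 : ex P (service_term V D x k i) = 0.
    by apply: (service_centered hUV hq hmono stuck0 hx k2 tmu); exact: leq_addr.
  have U0 o : 0 <= U (offset D k + i) o by exact: (U_ge0 hUV).
  have e3 : `|ex P (price_term U V q D x k i)| <= 2 * Ls * 1 * J i.
    have wU o : `|waiting U V q D x k i o| <= 1 * (U (offset D k + i) o + 1).
      by rewrite mul1r /waiting; case: (_ < _)%N; rewrite ?normr1 ?normr0 ?addr_ge0// lerDr.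
    exact: (price_centered hUV hq hmono stuck0 hx k2 ts iD (waiting_L1 hUV hq hmono hx k i) ler01 wU).
  have e4 : `|ex P (arrival_term U q w D x k i)| <= 2 * Lm * J i.
    exact: (arrival_centered hUV hq hmono stuck0 hx k2 tm iD).
  have e5 : `|ex P (rate_term U V q w D x k i)| <= 2 * Li * Lr * J i.
    have rU o : `|margin_rate q w (x k o) * U (offset D k + i) o| <= Lr * (U (offset D k + i) o + 1).
      rewrite normrM; apply: ler_pM => //; first exact/rb/(policy_box hx).
      by rewrite ger0_norm// lerDl.
    have iR : L1 P (fun o => margin_rate q w (x k o) * U (offset D k + i) o).
      by apply: (tame_L1 hUV hq hmono hx tr k1); have [] := U_mean hUV (offset D k + i).
    exact: (price_centered hUV hq hmono stuck0 hx k2 ti iD iR Lr0 rU).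
  have e1 := ler_wpM2l (ltW hh0) (ler_norm (ex P (wait_term U V q w D x k i))).
  rewrite e2 mulr0 addr0 (_ : Cx * J i = 2 * Ls * 1 * J i + 2 * Lm * J i + 2 * Li * Lr * J i); last first.
    by rewrite /Cx; ring.
  move: e1 e3 e4 e5; rewrite -/(a i) !ler_norml.
  move=> e1 /andP[_ e3] /andP[e4 _] /andP[_ e5]; lra.
have sum1 : \sum_(0 <= i < D k) a i <= N%:R * (eps * E1) + B * r ^+ N * (1 - r)^-1.
  apply: two_regime_sum => //; first by rewrite mulr_ge0// ltW.
    move=> i iD; have nD : (1 <= i.+1 <= D k)%N by [].
    exact: (wait_early hUV hq hmono hM kp0 B0 tw bound hx k2 eps0 hCs ek1 tl nD).
  move=> i iD; have nD : (1 <= i.+1 <= D k)%N by [].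
  exact: (wait_late bound hx k2 nD).
have sum2 : \sum_(0 <= i < D k) J i <= eps * ((Cs + (M + C4)) * (1 - r2)^-1).
  apply: (@le_trans _ _ (\sum_(0 <= i < D k) (eps * (Cs + (M + C4))) * r2 ^+ i)).
    rewrite !big_nat; apply: ler_sum => i /andP[_ iD].
    apply: (le_trans (shift_arrival hUV hq hmono eta0 hM hx k2 eps0 hCs i (offset D k + i) hC4)).
    rewrite mulrC; apply: ler_wpM2l; first by rewrite mulr_ge0// ltW.
    by rewrite -/r2 exprS ler_piMl ?exprn_ge0 ?expR_ge0// ltW; case/andP: r201.
  rewrite -mulr_sumr mulrA; apply: ler_wpM2l; first by rewrite mulr_ge0// ltW.
  exact: geometric_le.
have e6 : `|ex P (end_term U V q w D x k)| <= eps * E2.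
  exact: (wait_ends hUV hq hmono hM B0 tw bound hx k2 eps0 hCs ek ek1 tr).
apply: (@le_trans _ _ (h0 q * (N%:R * (eps * E1) + B * r ^+ N * (1 - r)^-1) +
    Cx * (eps * ((Cs + (M + C4)) * (1 - r2)^-1)) + eps * E2)).
  apply: (@le_trans _ _ (\sum_(0 <= i < D k) (h0 q * a i + Cx * J i) + eps * E2)).
    apply: lerD; first by rewrite !big_nat; apply: ler_sum => i /andP[_ iD]; exact: term.
    by move: e6; rewrite ler_norml => /andP[+ _]; rewrite lerNl.
  rewrite lerD2r big_split /= -!mulr_sumr; apply: lerD; apply: ler_wpM2l => //; exact: ltW.
have h2 : h0 q * (N%:R * (eps * E1)) = eps * N%:R * T1 by rewrite /T1; ring.
have h3 : h0 q * (B * r ^+ N * (1 - r)^-1) <= eps * T2.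
  rewrite (_ : _ * _ = r ^+ N * T2); last by rewrite /T2; ring.
  by apply: ler_wpM2r.
have h4 : Cx * (eps * ((Cs + (M + C4)) * (1 - r2)^-1)) = eps * T3 by rewrite /T3; ring.
rewrite mulrDr h2 h4 -natr1.
have x1 : 0 <= eps * T1 by rewrite mulr_ge0// ltW.
have x2 : 0 <= eps * N%:R * T2 by rewrite !mulr_ge0// ltW.
have x3 : 0 <= eps * N%:R * T3 by rewrite !mulr_ge0// ltW.
have x4 : 0 <= eps * N%:R * E2 by rewrite !mulr_ge0// ltW.
have -> : (T1 + T2 + T3 + E2) * (eps * (N%:R + 1)) = eps * N%:R * T1 + eps * T1 +
   (eps * N%:R * T2 + eps * T2) + (eps * N%:R * T3 + eps * T3) + (eps * N%:R * E2 + eps * E2) by ring.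
by move: (eps * N%:R * T1) (eps * T1) (eps * N%:R * T2) (eps * T2) (eps * N%:R * T3) (eps * T3)
  (eps * N%:R * E2) (eps * E2) (h0 q * (B * _ * _)) h3 x1 x2 x3 x4 => *; lra.
Qed.

End cycle_regret.

(** * Choice of the parameters and the final estimate *)

Lemma natr_powR {R : realType} (n : nat) (y : R) : (1 <= n)%N ->
  n%:R `^ y = expR (y * ln n%:R).
Proof. by move=> n1; rewrite /powR pnatr_eq0 gtn_eqF. Qed.

Theorem theorem1 (R : realType) (d : measure_display) (Om : measurableType d)
    (P : probability Om R) (U V : nat -> {RV P >-> R}) (q : queue_model R)
    (eta gamma : R) (Winf : R -> R -> probability R R)
    (D : nat -> nat) (x : nat -> Om -> R * R) (K2 alpha : R)
    (hq : model_ok q) (hUV : primitives_ok U V)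
    (hWinf : forall mu p, box q (mu, p) ->
       steady_state U V mu (lam q p) (Winf mu p))
    (hstab : stability q) (htail : light_tail U V q eta gamma)
    (hsmall : small_enough U V q eta)
    (hx : policy_ok U V q D x) (hproj : projected_updates U V q D x)
    (hK2 : 0 < K2) (halpha : 0 < alpha <= 1)
    (hD : forall k : nat, (1 <= k)%N ->
       (Num.ceil (6 * ln k%:R / Num.min gamma eta) <= (D k)%:Z) /\
       (D k)%:R <= K2 * k%:R `^ (2 - alpha))
    (hstep : forall k : nat, (1 <= k)%N ->
       ('E_P[fun o => (enorm (x k o - x k.+1 o) ^+ 2)%R]
          <= (K2 * k%:R `^ (- (2 * alpha)))%:E)%E) :
  exists K : R, 0 < K /\
    (forall k : nat, (2 <= k)%N ->
       (regret_ns U V q D x Winf k <= (K * k%:R `^ (- alpha) * ln k%:R)%:E)%E)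
    /\
    (forall L : nat, (2 <= L)%N ->
       (\sum_(1 <= k < L.+1) regret_ns U V q D x Winf k
          <= (K * \sum_(1 <= k < L.+1) k%:R `^ (- alpha) * ln k%:R)%:E)%E).
Proof.
have [mub pb h0p _] := (hq); have [C1lam hmono _ hcost hlam] := hstab.
have [eta0 gamma0 mgf [th [a [th_eta ha hU hV]]]] := htail.
have [M M0 hM] := hsmall; have [al0 al1] := andP halpha.
have th0 : 0 < th by case/andP: th_eta.
have [lohi_mu lohi_p] : mu_lo q < mu_hi q /\ p_lo q < p_hi q by case/andP: mub; case/andP: pb.
have stuck0 := no_stuck hUV hq th_eta ha hU gamma0.
have be := be01 gamma0.
have drift := drift_be hUV hq hlam th_eta ha hU hV gamma0.
have [C1 mom] := mom_fin hUV hq hlam th_eta hV.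
have [Kl lamL] := C1_on_lipschitz lohi_p C1lam.
have texp_eta y : box q y -> texp th (zq q y) <= eta.
  by move=> yb; have := texp_lt hq hmono hlam th_eta yb; lra.
pose w := wq Winf; pose cw := cF q th (expR (- gamma)).
have cw0 : 0 <= cw by exact: cF_ge0.
have wc y : box q y -> w y <= cw by move=> yb; exact: (wq_le hq hmono hWinf th0 be drift yb).
have w0 y : 0 <= w y by exact: wq_ge0.
have wm d' (T : measurableType d') (X : T -> R * R) : measurable_fun setT X ->
    (forall o, box q (X o)) -> measurable_fun setT (fun o => w (X o)).
  by move=> mX bX; exact: (wq_measurable hq hmono hWinf th0 be drift texp_eta mX bX).
have [Ll tl] := tame_lam hq hmono lamL.
have tw : tame q (cw + `|Lw q (expR (- gamma)) C1 Kl|) w.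
  split; first by rewrite addr_ge0.
  - move=> y z yb zb.
    apply: (le_trans (wq_lip hUV hq hmono hWinf th0 be drift mom lamL yb zb)).
    rewrite mulrC; apply: ler_wpM2r; first exact: dist1_ge0.
    by rewrite (le_trans (ler_norm _))// lerDr.
  - by move=> y yb; rewrite ger0_norm// (le_trans (wc _ yb))// lerDl.
  - exact: wm.
have hw z : box q z -> \int[Winf z.1 z.2]_y y = w z by move=> zb; exact: (wq_Rintegral hWinf zb).
have Fle n y z : box q z -> 0 <= y ->
    (Fn (U 0%N) (V 0%N) n (y, zq q z) <= (w z + expR (- gamma) ^+ n * cw * expR (eta * y))%:E)%E.
  by move=> zb y0; exact: (Fn_le_wq hq hmono hWinf th0 be drift texp_eta n zb y0).
have leF n y z : box q z -> 0 <= y ->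
    ((w z)%:E <= Fn (U 0%N) (V 0%N) n (y, zq q z) + (expR (- gamma) ^+ n * cw * expR (eta * y))%:E)%E.
  by move=> zb y0; exact: (wq_le_Fn hq hmono hWinf th0 be drift texp_eta n zb y0).
pose kp := kap eta gamma; pose B := 3 * CA gamma M cw.
have kp0 : 0 < kp by exact: kap_gt0.
have B0 : 0 <= B by rewrite mulr_ge0// CA_ge0.
have bound : transient_decay U V q w B kp.
  move=> D' x' hx' k n k1 nD G cG Gc cG0 hG.
  have := transient_bound hUV hq hmono stuck0 eta0 gamma0 hM M0 wm w0 wc cw0 Fle leF hx' k1 nD Gc cG0 hG.
  by rewrite (_ : 3 * cG * _ = cG * (B * expR (- kp * n%:R)))// /B; ring.
have [_ fin4] := mgf 0%N; have [C4 C40 hC4] := U_fourth_moment hUV eta0 fin4.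
(* The constant of [shift_sq]: [K2] from the step condition, [M] from the exponential moment of the
   queue length. *)
pose Cs := 3 * (K2 + M).
have Cs0 : 0 <= Cs by rewrite mulr_ge0// addr_ge0// ltW.
have [C C0 hC] := cycle_regret_bound hUV hq hmono hcost stuck0 eta0 M0 hM C40 hC4 hw kp0 B0 tw tl bound Cs0.
pose l2 : R := ln 2; have l20 : 0 < l2 by rewrite ln_gt0// ltr1n.
have hDk n : (1 <= n)%N -> 6 * ln n%:R <= Num.min gamma eta * (D n)%:R.
  move=> n1; have [+ _] := hD n n1; rewrite ceil_le_int ler_pdivrMr; last by rewrite lt_min gamma0.
  by move=> h; rewrite [leRHS]mulrC.
(* The factor 2 is that of [eps]; the sum in brackets bounds [N.+1] divided by ln k. *)
pose K1 := C * (2 * (kp^-1 + 2 / l2)).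
have K10 : 0 <= K1.
  by rewrite mulr_ge0// mulr_ge0// addr_ge0 ?divr_ge0 ?invr_ge0// ltW.
have main k : (2 <= k)%N ->
    (regret_ns U V q D x Winf k <= (K1 * k%:R `^ (- alpha) * ln k%:R)%:E)%E.
  move=> k2; have k1 : (1 <= k)%N by exact: ltnW.
  have kp1 : (1 <= k.-1)%N by case: k k2 {k1} => // -[].
  set j := k.-1 in kp1; have jk : j.+1 = k by rewrite prednK.
  pose lk : R := ln k%:R; pose lj : R := ln j%:R.
  have j0 : 0 < j%:R :> R by rewrite ltr0n.
  have k0 : 0 < k%:R :> R by rewrite ltr0n.
  have lj0 : 0 <= lj by rewrite ln_ge0// ler1n.
  have ljk : lj <= lk by rewrite ler_ln ?posrE// ler_nat -jk.
  (* As k <= 2 (k - 1), hypotheses about cycle [k.-1] pass to [k] at the cost of ln 2 in the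
     exponent. *)
  have lkj : lk <= lj + l2.
    rewrite addrC -lnM ?posrE// ler_ln ?posrE ?mulr_gt0//.
    by rewrite -natrM ler_nat -jk mul2n -addnn -addn1 leq_add2l.
  have l2k : l2 <= lk by rewrite ler_ln ?posrE// ler_nat.
  have ajk : alpha * lk <= alpha * lj + l2.
    apply: (@le_trans _ _ (alpha * (lj + l2))); first by rewrite ler_pM2l.
    by rewrite mulrDr lerD2l ler_piMl// ltW.
  have ak : alpha * lk <= lk by rewrite ler_piMl// (le_trans lj0).
  have aj : alpha * lj <= lj by rewrite ler_piMl.
  (* This is 2 k^-alpha; the factor 2 makes it dominate (k - 1)^-alpha as well. *)
  pose eps := expR (l2 - alpha * lk); have eps0 : 0 < eps by exact: expR_gt0.
  have kpE y : kp * y = Num.min gamma eta * y / 4 by rewrite /kp /kap; ring.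
  have hk : 6 * lk <= Num.min gamma eta * (D k)%:R := hDk _ k1.
  have hj : 6 * lj <= Num.min gamma eta * (D j)%:R := hDk _ kp1.
  have mn : Num.min gamma eta * (D j)%:R <= eta * (D j)%:R by rewrite ler_wpM2r// ge_min lexx orbT.
  (* The least natural number above ln k / kp, so that exp(-kp N) is at most 1 / k and hence at most
     [eps]. *)
  pose N := (Num.truncn (lk / kp)).+1.
  have sq : ex P (fun o => shift U V q D x k o ^+ 2) <= Cs * eps ^+ 2.
    have hs := hstep _ kp1; rewrite jk in hs.
    apply: (le_trans (shift_sq hUV hq hmono eta0 hM hx k2 hs)).
    rewrite /Cs -mulrA ler_wpM2l// [leRHS]mulrDl natr_powR//.
    have e2 : expR (- (2 * alpha) * lj) <= eps ^+ 2.
      rewrite /eps -expRM_natl ler_expR.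
      by move: (alpha * lk) (alpha * lj) ajk (mulrA 2 alpha lj) => ? ? h E; rewrite mulNr -/lj -E; lra.
    apply: lerD; apply: ler_wpM2l; rewrite ?(ltW M0) ?(ltW hK2)//.
    (* The exponential term is dominated because eta D_j >= 6 ln j >= 2 alpha ln j. *)
    apply: le_trans e2; rewrite ler_expR.
    by move: (alpha * lj) aj (mulrA 2 alpha lj) => ? h E; rewrite mulNr -/lj -E -/j; lra.
  (* Since [kp] is a quarter of min(gamma, eta), kp D_k is at least (6 / 4) ln k, hence at least
     alpha ln k. *)
  have ek : expR (- kp * (D k)%:R) <= eps.
    by rewrite ler_expR mulNr kpE; lra.
  have ek1 : expR (- kp * (D k.-1)%:R) <= eps.
    by rewrite ler_expR mulNr kpE -/j; lra.
  have eN : expR (- kp) ^+ N <= eps.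
    rewrite -expRM_natl ler_expR.
    have : lk / kp < N%:R by exact: truncnS_gt.
    rewrite ltr_pdivrMr// => h.
    by rewrite mulrN; move: (N%:R * kp) h => ? ?; lra.
  apply: (le_trans (hC D x hx k k2 eps eps0 N sq ek ek1 eN)).
  rewrite lee_fin natr_powR// /K1 -!mulrA; apply: ler_wpM2l => //.
  have lk0 : 0 < lk by exact: lt_le_trans l2k.
  (* The 2 by which [N.+1] exceeds the truncated quotient is absorbed by ln k >= ln 2. *)
  have NN : N.+1%:R <= lk * (kp^-1 + 2 / l2).
    have : (Num.truncn (lk / kp))%:R <= lk / kp by rewrite truncn_le; apply: divr_ge0; exact: ltW.
    have : 2 <= lk * (2 / l2) by rewrite mulrCA ler_peMr// ler_pdivlMr// mul1r.
    by rewrite mulrDr /N -natr1 -natr1; lra.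
  have -> : eps = 2 * expR (- alpha * lk) by rewrite /eps expRD lnK ?posrE// mulNr.
  rewrite [leRHS](_ : _ = 2 * (expR (- alpha * lk) * (lk * (kp^-1 + 2 / l2)))); last by rewrite -/lk; ring.
  by rewrite -mulrA ler_wpM2l// ler_wpM2l// expR_ge0.
have [r1 r1E] := regret_finite hUV hq hmono hcost hM hw tw tl hx (leqnn 1).
pose b k : R := k%:R `^ (- alpha) * ln k%:R.
have b0 k : (1 <= k)%N -> 0 <= b k.
  by move=> k1; rewrite mulr_ge0 ?powR_ge0// ln_ge0// ler1n.
have b2 : 0 < b 2 by rewrite mulr_gt0// powR_gt0.
(* On the right the term of cycle 1 vanishes because ln 1 = 0. The finite regret of cycle 1 is
   charged to the term [b 2], which is present as L >= 2; the summand 1 makes the constant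
   positive. *)
exists (K1 + `|r1| / b 2 + 1).
have r0 : 0 <= `|r1| / b 2 by rewrite divr_ge0// ltW.
split; first by rewrite ltr_wpDl// addr_ge0.
split=> [k k2|L L2].
  apply: (le_trans (main k k2)); rewrite lee_fin -[leLHS]mulrA -[leRHS]mulrA -/(b k).
  apply: ler_wpM2r.
    by apply: b0; exact: ltnW.
  by rewrite -addrA lerDl addr_ge0.
have L1' : (1 < L.+1)%N by rewrite ltnS ltnW.
rewrite big_ltn// r1E.
apply: (@le_trans _ _ (r1%:E + (\sum_(2 <= k < L.+1) K1 * b k)%:E)%E).
  rewrite leeD2l// -sumEFin big_nat [leRHS]big_nat; apply: lee_sum => k /andP[k2 _].
  by rewrite /b mulrA; exact: main.
rewrite -EFinD lee_fin -mulr_sumr.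
set S := \sum_(2 <= k < L.+1) b k.
have S0 : b 2 <= S.
  rewrite /S big_ltn ?ltnS// lerDl big_nat; apply: sumr_ge0 => k /andP[k2 _].
  by apply: b0; exact: leq_trans k2.
have -> : \sum_(1 <= k < L.+1) k%:R `^ (- alpha) * ln k%:R = S.
  by rewrite big_ltn// ln1 mulr0 add0r.
have : r1 <= `|r1| / b 2 * S.
  rewrite (le_trans (ler_norm _))// -mulrA ler_peMr// ler_pdivlMl// mulr1.
  exact: S0.
have := le_trans (ltW b2) S0.
by move: (`|r1| / b 2) => y S00 h; rewrite !mulrDl mul1r; lra.
Qed.
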